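(* Consider the following two variants of local bootstrap percolation. (a) The modified local model. (b) The Froböse local model. For each of these two models there exist constants $c,C,p_0>0$ such that for all $p\in(0,p_0)$, $$ \exp\frac{-2\lambda+c\sqrt p}{p}\;\le\;\mathbb{P}_p\big(\text{indefinite growth}\big)\;\le\;\exp\frac{-2\lambda+C\sqrt p\,(\log p^{-1})^3}{p}, $$ where now $\lambda=\pi^2/6$. Moreover, for the Froböse local model the upper bound can be improved to $\exp\big[(-2\lambda+C\sqrt p\,(\log p^{-1})^2)/p\big]$.
   Context: Each site of $\mathbb{Z}^2$ is at each time $t=0,1,2,\dots$ empty ($\circ$), occupied ($\bullet$) or active ($\star$). The initial configuration is random with law $\mathbb{P}_p$, $p\in(0,1)$: states of different sites are independent; the origin is $\star$ with probability $p$ and $\circ$ otherwise; every other site is $\bullet$ with probability $p$ and $\circ$ otherwise. Updates are deterministic and synchronous. In both models: each $\circ$ becomes $\star$ if it has at least two $\star$'s within $\ell^1$-distance $1$, and states not covered by the rules remain unchanged. In the modified local model, each $\bullet$ becomes $\star$ if it has at least one $\star$ within $\ell^\infty$-distance $1$. In the Froböse local model, each $\bullet$ becomes $\star$ if it has at least one $\star$ within $\ell^1$-distance $1$. ''Indefinite growth'' is the event that every site of $\mathbb{Z}^2$ eventually becomes active. *)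

(* Defs.v *)
From HB Require Import structures.
From mathcomp Require Import all_boot all_order all_algebra.
From mathcomp Require Import all_classical all_reals all_analysis.
Set Implicit Arguments. Unset Strict Implicit. Unset Printing Implicit Defensive.
Import Order.TTheory GRing.Theory Num.Theory.
Local Open Scope ring_scope.
Local Open Scope classical_set_scope.

Inductive state := Empty | Occ | Act.

Definition is_act (s : state) : bool := if s is Act then true else false.

Definition site := (int * int)%type.
Definition config := site -> state.
Definition origin : site := (0%R, 0%R).

(** Sites at l^1-distance exactly 1 (the site itself is never active when
    a rule applies, so "within distance 1" counts only these). *)
Definition nbrs1 (x : site) : seq site :=
  [:: (x.1 + 1, x.2); (x.1 - 1, x.2); (x.1, x.2 + 1); (x.1, x.2 - 1)].

Definition nbrsinf (x : site) : seq site :=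
  nbrs1 x ++
  [:: (x.1 + 1, x.2 + 1); (x.1 + 1, x.2 - 1);
      (x.1 - 1, x.2 + 1); (x.1 - 1, x.2 - 1)].

Definition n_active (eta : config) (s : seq site) : nat :=
  count (fun y => is_act (eta y)) s.

Definition step_modified (eta : config) : config := fun x =>
  match eta x with
  | Empty => if (2 <= n_active eta (nbrs1 x))%N then Act else Empty
  | Occ => if (1 <= n_active eta (nbrsinf x))%N then Act else Occ
  | Act => Act
  end.

Definition step_frobose (eta : config) : config := fun x =>
  match eta x with
  | Empty => if (2 <= n_active eta (nbrs1 x))%N then Act else Empty
  | Occ => if (1 <= n_active eta (nbrs1 x))%N then Act else Occ
  | Act => Act
  end.

Definition indefinite_growth (step : config -> config) (eta0 : config) : Prop :=
  forall x : site, exists t : nat, is_act (iter t step eta0 x).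

Definition init_law {R : realType} (p : R) (x : site) (s : state) : R :=
  if x == origin then
    match s with Act => p | Empty => 1 - p | Occ => 0 end
  else
    match s with Occ => p | Empty => 1 - p | Act => 0 end.

(** [X] is a random configuration (on the probability space [P]) with law
    P_p: each site state is a measurable random variable, and the states of
    distinct sites are independent with the marginals [init_law p]
    (equivalently: all finite-dimensional cylinder probabilities are the
    products of the marginals). *)
Definition has_law_Pp {R : realType} {d : measure_display}
    {T : measurableType d} (P : probability T R) (p : R)
    (X : site -> T -> state) : Prop :=
  (forall (x : site) (s : state), measurable [set w | X x w = s]) /\
  (forall (S : seq site) (f : site -> state), uniq S ->
     P [set w | forall x, x \in S -> X x w = f x] =
     ((\prod_(x <- S) init_law p x (f x))%R)%:E).

Definition growth_event {T : Type} (step : config -> config)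
    (X : site -> T -> state) : set T :=
  [set w | indefinite_growth step (fun x => X x w)].

Definition lambda2 {R : realType} : R := pi ^+ 2 / 6%:R.

(* Main.v *)
(** Both bounds are about growing rectangles; write [u k = 1 - (1 - p) ^ k] for the
    probability that a line of [k] sites contains an occupied one.

    Upper bound, for the modified model, which dominates the Froböse model.  The active
    cluster stays inside a rectangle that grows only through an occupied site touching it,
    sides and corners included.  If the cluster fills a rectangle [R] of size [a * b], look
    back at an earlier rectangle [R'], of size [(a - s) * (b - t)], where [s] and [t] are
    about [sqrt p] times [min a (1/p)] and [min b (1/p)]: each of the [t] new rows and [s]
    new columns contains an occupied site.  Rows and columns interact only in the [s * t]
    corner sites, and there an occupied site spares at most one row and one column, so
    these strips cost at most a constant times [u a ^ t * u b ^ s]; for [s <= 1] or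
    [t <= 1] one drops the single column or row at the price of a factor [1/p].  The number
    of choices of [R'] is polynomial in [1/p] and there are [O(p ^ (-1/2) * log (1/p))]
    steps, whence a total error [exp (O(p ^ (-1/2) * log^2 (1/p)))].  Log-concavity of [u]
    shows that the cheapest path to a large square is the diagonal, of cost
    [2 \sum_k - ln (u k)], which is [2 lambda / p] up to [O(log (1/p))] by expanding the
    logarithm and [\sum_n 1 / n^2 = pi^2 / 6].

    Lower bound, for the Froböse model.  Growing along the diagonal gives
    [exp (- 2 lambda / p)].  At scale [1/p] one also counts detours: from the square of side
    [i] grow only upwards until column [i] is first hit, at height [n - 1], and then widen
    to the square of side [n].  Detours are mutually exclusive, and each costs a factor of
    order [p] compared with the diagonal as long as [n - i <= p ^ (-1/2)], so that every
    [p ^ (-1/2)] steps their [1/p] possibilities multiply the probability by a constant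
    factor; this happens [p ^ (-1/2)] times. *)

Require Import Defs.
From HB Require Import structures.
From mathcomp Require Import all_boot all_order all_algebra.
From mathcomp Require Import all_classical all_reals all_analysis.
From mathcomp Require Import zify ring lra.
Import Order.TTheory GRing.Theory Num.Theory.
Set Implicit Arguments. Unset Strict Implicit. Unset Printing Implicit Defensive.
Local Open Scope ring_scope.
Local Open Scope classical_set_scope.

(** * Expectations over finitely many independent sites *)

(** Probabilities of events that read finitely many sites are computed by a resampling operator:
    [E p s f] averages [f] over the sites of [s] and remains a function of the configuration
    elsewhere. Conditioning on a site means leaving it out of [s], independence is the condition
    [indep_of], and measure theory enters only through [occ_law]. Under the law the origin is never
    occupied, yet it is averaged over like any other site of a box; this is harmless because no
    event in play reads it. Looking back over many lines at once is forced: a union bound over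
    line-by-line histories loses a constant factor per line, and over [1/p] lines this would change
    the leading constant. In the lower bound the obstacle is overlap: probabilities of different
    histories may be added only if the histories exclude each other, which is what the renewal
    inequality for [square_prob] rests on. *)

Definition upd (w : site -> bool) (x : site) (b : bool) : site -> bool :=
  fun y => if y == x then b else w y.

Definition indic (R : realType) (P : Prop) : R := (`[< P >])%:R.

Definition local_on (T : Type) (s : seq site) (f : (site -> bool) -> T) :=
  forall w w', {in s, w =1 w'} -> f w = f w'.

Definition hit (s : seq site) (w : site -> bool) := has w s.

Definition indep_of (T : Type) (s : seq site) (f : (site -> bool) -> T) :=
  forall w x b, x \in s -> f (upd w x b) = f w.

Section Expectation.
Context {R : realType}.
Variable p : R.
Hypothesis p01 : 0 <= p <= 1.
Implicit Types (s : seq site) (f g h : (site -> bool) -> R) (w : site -> bool).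

Definition resample1 (x : site) f : (site -> bool) -> R :=
  fun w => p * f (upd w x true) + (1 - p) * f (upd w x false).

(** Order and repetitions in [s] do not matter, by [resample1C] and [resample1_idem], so lists serve
    as finite sets. *)
Definition E s f := foldr resample1 f s.

Lemma E_cat s1 s2 f : E (s1 ++ s2) f = E s1 (E s2 f).
Proof. by rewrite /E foldr_cat. Qed.

Lemma updC w x y a b : x != y ->
  upd (upd w x a) y b = upd (upd w y b) x a.
Proof.
move=> xy; apply/funext => z; rewrite /upd.
by case: eqP => // ->; rewrite eq_sym (negbTE xy).
Qed.

Lemma updU w x a b : upd (upd w x a) x b = upd w x b.
Proof. by apply/funext => z; rewrite /upd; case: eqP. Qed.

Lemma resample1C x y f : resample1 x (resample1 y f) = resample1 y (resample1 x f).
Proof.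
have [->//|xy] := eqVneq x y.
apply/funext => w; rewrite /resample1 !(updC _ _ _ xy); ring.
Qed.

Lemma resample1_idem x f : resample1 x (resample1 x f) = resample1 x f.
Proof. apply/funext => w; rewrite /resample1 !updU; ring. Qed.

Lemma E_resample1 x s f : E s (resample1 x f) = resample1 x (E s f).
Proof. by elim: s => //= y s ->; rewrite resample1C. Qed.

Lemma E_rem x s f : x \in s -> E s f = resample1 x (E s f).
Proof.
elim: s => //= y s IH; rewrite inE => /predU1P[<-|/IH e].
  by rewrite resample1_idem.
by rewrite resample1C -e.
Qed.

Lemma EC s1 s2 f : E s1 (E s2 f) = E s2 (E s1 f).
Proof. by elim: s1 => //= x s1 ->; rewrite E_resample1. Qed.

(** Together with [EC] this inserts an average over a sub-box inside an average over a larger box,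
    so that an event is integrated over just the sites it reads. *)
Lemma E_absorb s1 s2 f : {subset s1 <= s2} -> E s1 (E s2 f) = E s2 f.
Proof.
elim: s1 => //= x s1 IH sub; rewrite IH; last first.
  by move=> y ys; apply: sub; rewrite inE ys orbT.
by rewrite -E_rem// sub// mem_head.
Qed.

Lemma eq_mem_E s1 s2 f : s1 =i s2 -> E s1 f = E s2 f.
Proof.
move=> eq12; rewrite -(@E_absorb s2 s1) 1?EC ?E_absorb//.
  by move=> x; rewrite eq12.
by move=> x; rewrite eq12.
Qed.

Lemma E_le s f g : (forall w, f w <= g w) -> forall w, E s f w <= E s g w.
Proof.
move=> fg; elim: s => //= x s IH w; case/andP: p01 => p0 p1.
by rewrite lerD// ler_wpM2l// subr_ge0.
Qed.

Lemma E_cst s (c : R) : E s (fun=> c) = fun=> c.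
Proof.
by elim: s => //= x s ->; apply/funext => w; rewrite /resample1; ring.
Qed.

Lemma E_ge0 s f : (forall w, 0 <= f w) -> forall w, 0 <= E s f w.
Proof. by move=> f0 w; have := @E_le s _ _ f0 w; rewrite E_cst. Qed.

Lemma E_le_cst s f (c : R) : (forall w, f w <= c) -> forall w, E s f w <= c.
Proof. by move=> f0 w; have := @E_le s _ _ f0 w; rewrite E_cst. Qed.

Lemma E_mulr s f h : indep_of s h ->
  E s (fun w => h w * f w) = fun w => h w * E s f w.
Proof.
elim: s => //= x s IH hs; rewrite IH; last first.
  by move=> w y b ys; apply: hs; rewrite inE ys orbT.
apply/funext => w; rewrite /resample1 !hs ?mem_head//; ring.
Qed.

Lemma E_id s h : indep_of s h -> E s h = h.
Proof.
move=> /(E_mulr (fun=> 1)); rewrite E_cst => e.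
by have -> : h = (fun w => h w * 1) by apply/funext => w; rewrite mulr1.
Qed.

Lemma ED s f g : E s (fun w => f w + g w) = fun w => E s f w + E s g w.
Proof.
by elim: s => //= x s ->; apply/funext => w; rewrite /resample1; ring.
Qed.

Lemma E_sum (I : Type) (r : seq I) (P : pred I) s (F : I -> (site -> bool) -> R) :
  E s (fun w => \sum_(i <- r | P i) F i w) = fun w => \sum_(i <- r | P i) E s (F i) w.
Proof.
elim: r => [|i r IH].
  by under eq_fun do rewrite big_nil; rewrite E_cst; apply/funext => w; rewrite big_nil.
apply/funext => w; rewrite big_cons; under eq_fun do rewrite big_cons.
case: (P i); last by rewrite IH.
by rewrite ED IH.
Qed.

Lemma indep_of_E s t f : indep_of t f -> indep_of t (E s f).
Proof.
move=> ft; elim: s => //= x s IH w y b yt; rewrite /resample1.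
have [->|xy] := eqVneq x y; first by rewrite !updU.
by rewrite -!(updC _ _ _ xy) !(IH _ _ _ yt).
Qed.

(** The factors may still share sites outside all blocks; these stay parameters on both sides, as
    conditioning on a corner requires. *)
Lemma E_prod_blocks (J : eqType) (r : seq J) (B : J -> seq site)
    (F : J -> (site -> bool) -> R) :
  uniq r -> (forall j k, j \in r -> k \in r -> j != k -> indep_of (B j) (F k)) ->
  E (flatten [seq B j | j <- r]) (fun w => \prod_(j <- r) F j w) =
  fun w => \prod_(j <- r) E (B j) (F j) w.
Proof.
elim: r => [|j r IH] /=.
  by move=> _ _; apply/funext => w; rewrite !big_nil.
move=> /andP[jr ur] H; rewrite E_cat.
have jk k : k \in r -> j != k by move=> kr; apply: contraNneq jr => ->.
have Hj k : k \in r -> indep_of (B j) (F k).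
  by move=> kr; apply: H; rewrite ?inE ?eqxx ?kr ?orbT ?jk.
have Hk k : k \in r -> indep_of (B k) (F j).
  by move=> kr; apply: H; rewrite ?inE ?eqxx ?kr ?orbT// eq_sym jk.
under [X in E _ (E _ X)]eq_fun do rewrite big_cons.
rewrite (@E_mulr _ (fun w => \prod_(j <- r) F j w) (F j)); last first.
  by move=> w x b /flattenP[/= u /mapP[k kr ->]]; exact: Hk.
rewrite IH//; last by move=> a b ar br; apply: H; rewrite inE ?ar ?br orbT.
under [in LHS]eq_fun do rewrite mulrC.
rewrite (@E_mulr _ (F j) (fun w => \prod_(j <- r) E (B j) (F j) w)); last first.
  move=> w x b xj; apply: eq_big_seq => k kr.
  by apply: indep_of_E xj; exact: Hj.
by apply/funext => w; rewrite big_cons mulrC.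
Qed.

Lemma E_prod_sites s (F : site -> bool -> R) : uniq s ->
  E s (fun w => \prod_(x <- s) F x (w x)) =
  fun=> \prod_(x <- s) (p * F x true + (1 - p) * F x false).
Proof.
move=> us; have {1}-> : s = flatten [seq [:: x] | x <- s].
  by elim: (s) => //= x r {1}->.
rewrite (@E_prod_blocks _ s (fun x => [:: x]) (fun x w => F x (w x)))//.
  apply/funext => w; apply: eq_bigr => x _ /=.
  by rewrite /resample1 /upd eqxx.
move=> x y xs ys xy w z b; rewrite inE => /eqP ->.
by rewrite /upd eq_sym (negbTE xy).
Qed.

Lemma E_miss s : uniq s -> E s (fun w => (~~ hit s w)%:R) = fun=> (1 - p) ^+ size s.
Proof.
move=> us; have -> : (fun w => (~~ hit s w)%:R) =
    (fun w => \prod_(x <- s) (~~ w x)%:R) :> (_ -> R).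
  apply/funext => w; rewrite /hit; elim: (s) => [|x r IH]; rewrite ?big_nil//=.
  by rewrite big_cons -IH; case: (w x); rewrite /= ?mul0r ?mul1r.
rewrite (@E_prod_sites s (fun _ b => (~~ b)%:R))//; apply/funext => w /=.
rewrite mulr0 add0r mulr1.
by elim: (s) => [|x r IH]; rewrite ?big_nil ?expr0// big_cons IH exprS.
Qed.

Lemma E_hit s : uniq s -> E s (fun w => (hit s w)%:R) = fun=> 1 - (1 - p) ^+ size s.
Proof.
move=> us; have -> : (fun w => (hit s w)%:R) =
    (fun w => 1 + (-1) * (~~ hit s w)%:R) :> (_ -> R).
  by apply/funext => w; case: (hit s w) => /=; ring.
rewrite ED E_cst (@E_mulr s (fun w => (~~ hit s w)%:R) (fun=> -1))// E_miss//.
by apply/funext => w; ring.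
Qed.

End Expectation.

Arguments E : simpl never.

Lemma local_indep (T : Type) (s t : seq site) (f : (site -> bool) -> T) :
  local_on s f -> (forall x, x \in t -> x \notin s) -> indep_of t f.
Proof.
move=> fs ts w x b xt; apply: fs => y ys; rewrite /upd.
by case: eqP => // yx; move: (ts _ xt); rewrite -yx ys.
Qed.

Lemma local_hit s : local_on s (hit s).
Proof. by move=> w w' ww'; apply: eq_in_has. Qed.

Lemma indicT (R : realType) (P : Prop) : P -> indic R P = 1.
Proof. by move=> h; rewrite /indic asboolT. Qed.

Lemma indicF (R : realType) (P : Prop) : ~ P -> indic R P = 0.
Proof. by move=> h; rewrite /indic asboolF. Qed.

Lemma indic_ge0 (R : realType) (P : Prop) : 0 <= indic R P.
Proof. exact: ler0n. Qed.

Lemma indic_le1 (R : realType) (P : Prop) : indic R P <= 1.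
Proof. by rewrite /indic; case: asbool. Qed.

Lemma indic_and (R : realType) (P Q : Prop) : indic R (P /\ Q) = indic R P * indic R Q.
Proof. by rewrite /indic asbool_and; case: asbool; case: asbool; rewrite /= ?mulr0 ?mulr1. Qed.

Lemma indic_bool (R : realType) (b : bool) : indic R b = b%:R.
Proof. by rewrite /indic asboolb. Qed.

(** * Strips between two nested rectangles *)

Definition rowl (X : seq int) (y : int) : seq site := [seq (x, y) | x <- X].
Definition coll (x : int) (Y : seq int) : seq site := [seq (x, y) | y <- Y].
Definition box (X Y : seq int) : seq site := [seq (x, y) | x <- X, y <- Y].

(** [X'] and [Y'] span the inner rectangle, [X''] and [Y''] are the new lines. A new line is tested
    across the whole outer rectangle, so a site of the corner [box X'' Y''] can serve one row and
    one column at once. *)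
Definition strips (X' X'' Y' Y'' : seq int) (w : site -> bool) :=
  all (fun y => hit (rowl (X' ++ X'') y) w) Y'' &&
  all (fun x => hit (coll x (Y' ++ Y'')) w) X''.

Arguments rowl : simpl never.
Arguments coll : simpl never.
Arguments box : simpl never.

Lemma mem_rowl X y z : (z \in rowl X y) = (z.1 \in X) && (z.2 == y).
Proof.
case: z => a b /=; apply/mapP/andP => [[x xX [-> ->]]|[aX /eqP ->]] //.
by exists a.
Qed.

Lemma mem_coll x Y z : (z \in coll x Y) = (z.1 == x) && (z.2 \in Y).
Proof.
case: z => a b /=; apply/mapP/andP => [[y yY [-> ->]]|[/eqP -> bY]] //.
by exists b.
Qed.

Lemma mem_box X Y z : (z \in box X Y) = (z.1 \in X) && (z.2 \in Y).
Proof.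
case: z => a b /=; apply/allpairsP/andP => [[[x y]] /= [xX yY [-> ->]]//|[aX bY]].
by exists (a, b).
Qed.

Lemma uniq_rowl X y : uniq X -> uniq (rowl X y).
Proof. by move=> uX; rewrite map_inj_uniq// => a b []. Qed.

Lemma uniq_coll x Y : uniq Y -> uniq (coll x Y).
Proof. by move=> uY; rewrite map_inj_uniq// => a b []. Qed.

Lemma uniq_box X Y : uniq X -> uniq Y -> uniq (box X Y).
Proof. by move=> uX uY; apply: allpairs_uniq => // -[a b] [c d]. Qed.

Lemma mem_rows X Y : flatten [seq rowl X y | y <- Y] =i box X Y.
Proof.
move=> z; rewrite mem_box; apply/idP/andP.
  by case/flatten_mapP => y yY; rewrite mem_rowl => /andP[-> /eqP ->].
move=> [zX zY]; apply/flatten_mapP; exists z.2 => //.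
by rewrite mem_rowl zX eqxx.
Qed.

Lemma mem_cols X Y : flatten [seq coll x Y | x <- X] =i box X Y.
Proof. by []. Qed.

Lemma prodr_ge1 (R : realType) (I : Type) (r : seq I) (F : I -> R) :
  (forall i, 1 <= F i) -> 1 <= \prod_(i <- r) F i.
Proof.
move=> F1; elim: r => [|i r IH]; rewrite ?big_nil// big_cons.
by rewrite (le_trans IH)// ler_peMl// (le_trans ler01 IH).
Qed.

Lemma prodr_const_seq (R : comNzRingType) (I : Type) (r : seq I) (c : R) :
  \prod_(i <- r) c = c ^+ size r.
Proof. by elim: r => [|i r IH]; rewrite ?big_nil// big_cons IH exprS. Qed.

Lemma indep_hit (s t : seq site) :
  (forall x, x \in t -> x \notin s) -> indep_of t (hit s).
Proof. by move=> H; apply: local_indep (@local_hit s) H. Qed.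

Lemma indep_hit2 (R : realType) (s1 s2 t : seq site) :
  (forall x, x \in t -> x \notin s1) -> (forall x, x \in t -> x \notin s2) ->
  indep_of t (fun w => (hit s1 w || hit s2 w)%:R : R).
Proof. by move=> H1 H2 w x b xt; rewrite (indep_hit H1)// (indep_hit H2). Qed.

Section StripBound.
Context {R : realType}.
Variable p : R.
Hypotheses (p0 : 0 < p) (p1 : p < 1).

Let p01 : 0 <= p <= 1. Proof. by rewrite !ltW. Qed.

Lemma uniq_dis (T : eqType) (s t : seq T) x : uniq (s ++ t) -> x \in s -> x \notin t.
Proof.
by rewrite cat_uniq => /and3P[_ /hasPn H _] xs; apply: contraL xs => /H.
Qed.

(* Conditioning on the corner [c]: each of its occupied sites contributes a factor [1/u],
   which compensates for the line [s] no longer having to be hit. *)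
Lemma E_hit_assisted (s c : seq site) (u : R) w :
  uniq (s ++ c) -> 1 - (1 - p) ^+ size s <= u -> 0 < u -> u <= 1 ->
  E p s (fun w => (hit c w || hit s w)%:R) w <=
  u * \prod_(z <- c) (if w z then u^-1 else 1).
Proof.
move=> uq su u0 u1.
have us : uniq s by move: uq; rewrite cat_uniq => /andP[].
have rc : indep_of s (hit c).
  apply: local_indep (@local_hit c) _ => x; exact: uniq_dis uq.
have fac z : 1 <= (if w z then u^-1 else 1).
  by case: (w z) => //; rewrite invf_ge1.
have [hc|hc] := boolP (hit c w).
  apply: (@le_trans _ _ 1); first by apply: (E_le_cst p01) => w'; case: (_ || _).
  suff : u^-1 <= \prod_(z <- c) (if w z then u^-1 else 1).
    by rewrite -ler_pdivrMl ?mulr1.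
  elim: (c) hc => //= z r IH; rewrite big_cons; case/orP => [->|/IH h].
    rewrite ler_peMr ?invr_ge0 ?(ltW u0)//.
    by apply: prodr_ge1 => i; exact: fac.
  by apply: le_trans h _; rewrite ler_peMl ?fac// prodr_ge0// => i _; apply: le_trans (fac i).
have -> : E p s (fun w0 => (hit c w0 || hit s w0)%:R) w = E p s (fun w => (hit s w)%:R) w.
  have e : (fun w0 => (hit c w0 || hit s w0)%:R) =
     fun w0 => (hit c w0)%:R + (~~ hit c w0)%:R * (hit s w0)%:R :> R.
    by apply/funext => w0; case: (hit c w0); case: (hit s w0); rewrite /=; ring.
  rewrite e ED E_mulr; last by move=> w0 x b xs; rewrite rc.
  rewrite E_id ?(negbTE hc) /=; last by move=> w0 x b xs; rewrite rc.
  by rewrite add0r mul1r.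
rewrite E_hit// (le_trans su)// ler_peMr ?(ltW u0)//.
by apply: prodr_ge1 => i; exact: fac.
Qed.

(** Given the corner, different lines read disjoint sites. An occupied corner site raises the
    product of the bounds by at most [(u * v)^-1], and averaging over the independent corner sites
    gives the last factor. *)
Lemma strips_bound (X' X'' Y' Y'' : seq int) (u v : R) w :
  uniq (X' ++ X'') -> uniq (Y' ++ Y'') ->
  u = 1 - (1 - p) ^+ size (X' ++ X'') -> v = 1 - (1 - p) ^+ size (Y' ++ Y'') ->
  0 < u -> 0 < v ->
  E p (box X'' Y'' ++ box X' Y'' ++ box X'' Y') (fun w => (strips X' X'' Y' Y'' w)%:R) w
  <= u ^+ size Y'' * v ^+ size X'' *
     (1 - p + p * (u * v)^-1) ^+ (size X'' * size Y'').
Proof.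
move=> uX uY eu ev u0 v0.
have [uX' uX''] : uniq X' /\ uniq X'' by move: uX; rewrite cat_uniq => /and3P[].
have [uY' uY''] : uniq Y' /\ uniq Y'' by move: uY; rewrite cat_uniq => /and3P[].
have q0 : 0 <= 1 - p by rewrite subr_ge0 ltW.
have q1 : 1 - p <= 1 by rewrite gerBl ltW.
have ule1 : u <= 1 by rewrite eu gerBl exprn_ge0.
have vle1 : v <= 1 by rewrite ev gerBl exprn_ge0.
have uge : 1 - (1 - p) ^+ size X' <= u.
  by rewrite eu lerD2l lerN2 ler_wiXn2l// ?size_cat ?leq_addr.
have vge : 1 - (1 - p) ^+ size Y' <= v.
  by rewrite ev lerD2l lerN2 ler_wiXn2l// ?size_cat ?leq_addr.
pose A y w : R := (hit (rowl X'' y) w || hit (rowl X' y) w)%:R.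
pose B x w : R := (hit (coll x Y'') w || hit (coll x Y') w)%:R.
have eqs : (fun w => (strips X' X'' Y' Y'' w)%:R) =
   fun w => (\prod_(y <- Y'') A y w) * \prod_(x <- X'') B x w.
  apply/funext => w0; rewrite /strips -mulnb natrM; congr (_ * _).
    elim: (Y'') => [|y r IH]; rewrite ?big_nil// big_cons -IH /= -mulnb natrM.
    by rewrite /A /hit /rowl map_cat has_cat orbC.
  elim: (X'') => [|y r IH]; rewrite ?big_nil// big_cons -IH /= -mulnb natrM.
  by rewrite /B /hit /coll map_cat has_cat orbC.
have boundA y : y \in Y'' -> forall w, E p (rowl X' y) (A y) w <=
    u * \prod_(x <- X'') (if w (x, y) then u^-1 else 1).
  move=> yY w0; apply: le_trans (E_hit_assisted _ _ _ u0 ule1) _.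
  - by rewrite -map_cat uniq_rowl.
  - by rewrite size_map.
  - by rewrite big_map.
have boundB x : x \in X'' -> forall w, E p (coll x Y') (B x) w <=
    v * \prod_(y <- Y'') (if w (x, y) then v^-1 else 1).
  move=> xX w0; apply: le_trans (E_hit_assisted _ _ _ v0 vle1) _.
  - by rewrite -map_cat uniq_coll.
  - by rewrite size_map.
  - by rewrite big_map.
(* With the corner frozen, row tests read only [box X' Y''] and column tests only [box X'' Y']. *)
have inner w0 : E p (box X' Y'' ++ box X'' Y') (fun w => (strips X' X'' Y' Y'' w)%:R) w0
   <= u ^+ size Y'' * v ^+ size X'' *
      \prod_(z <- box X'' Y'') (if w0 z then (u * v)^-1 else 1).
  rewrite eqs E_cat (eq_mem_E _ _ (fsym (mem_rows X' Y''))).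
  rewrite (eq_mem_E _ _ (fsym (mem_cols X'' Y'))).
  have disX x : x \in X' -> x \notin X'' by exact: uniq_dis.
  have disY y : y \in Y' -> y \notin Y'' by exact: uniq_dis.
  have rA y x : y \in Y'' -> x \in X'' -> indep_of (coll x Y') (A y).
    move=> yY xX; apply: indep_hit2 => z; rewrite mem_coll !mem_rowl => /andP[_ zY];
      by rewrite negb_and; apply/orP; right; apply: contraTneq yY => <-; exact: disY.
  have rB y x : y \in Y'' -> x \in X'' -> indep_of (rowl X' y) (B x).
    move=> yY xX; apply: indep_hit2 => z; rewrite mem_rowl !mem_coll => /andP[zX _];
      by rewrite negb_and; apply/orP; left; apply: contraTneq xX => <-; exact: disX.
  rewrite E_mulr; last first.
    move=> w1 z b; rewrite mem_cols mem_box => /andP[zX zY].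
    by apply: eq_big_seq => y yY; apply: (rA y z.1) => //; rewrite mem_coll zY eqxx.
  rewrite [X in E _ _ X](_ : _ = fun w1 => E p (flatten [seq coll x Y' | x <- X''])
    (fun w => \prod_(x <- X'') B x w) w1 * \prod_(y <- Y'') A y w1); last first.
    by apply/funext => w1; rewrite mulrC.
  rewrite E_mulr; last first.
    apply: indep_of_E => w1 z b; rewrite mem_rows mem_box => /andP[zX zY].
    by apply: eq_big_seq => x xX; apply: (rB z.2) => //; rewrite mem_rowl zX eqxx.
  rewrite !E_prod_blocks//; first last.
  - move=> x1 x2 x1X x2X n12; apply: indep_hit2 => z; rewrite !mem_coll => /andP[/eqP -> _];
      by rewrite (negbTE n12).
  - move=> x1 x2 x1X x2X n12; apply: indep_hit2 => z; rewrite !mem_rowl => /andP[_ /eqP ->];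
      by rewrite (negbTE n12) andbF.
  have -> : u ^+ size Y'' * v ^+ size X'' *
      \prod_(z <- box X'' Y'') (if w0 z then (u * v)^-1 else 1) =
    (\prod_(x <- X'') (v * \prod_(y <- Y'') (if w0 (x, y) then v^-1 else 1))) *
    (\prod_(y <- Y'') (u * \prod_(x <- X'') (if w0 (x, y) then u^-1 else 1))).
    rewrite !big_split /= !prodr_const_seq mulrACA [v ^+ _ * _]mulrC; congr (_ * _).
    rewrite (exchange_big _ _ Y'') /= -big_split /= /box big_allpairs [LHS]exchange_big /=.
    apply: eq_bigr => y _; rewrite -big_split /=; apply: eq_bigr => x _.
    by case: (w0 _); rewrite ?mulr1// invfM mulrC.
  apply: ler_pM.
  - by apply: prodr_ge0 => x _; apply: E_ge0.
  - by apply: prodr_ge0 => x _; apply: E_ge0.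
  - rewrite big_seq [leRHS]big_seq; apply: ler_prod => x xX.
    by rewrite boundB// andbT; apply: E_ge0.
  - rewrite big_seq [leRHS]big_seq; apply: ler_prod => x xX.
    by rewrite boundA// andbT; apply: E_ge0.
rewrite E_cat.
apply: (@le_trans _ _ (E p (box X'' Y'') (fun w0 => u ^+ size Y'' * v ^+ size X'' *
      \prod_(z <- box X'' Y'') (if w0 z then (u * v)^-1 else 1)) w)).
  exact: (E_le p01).
rewrite E_mulr// (E_prod_sites _ (fun _ b => if b then (u * v)^-1 else 1)) ?uniq_box//.
by rewrite prodr_const_seq mulr1 addrC size_allpairs.
Qed.

(** The column tests are discarded, and full rows are independent. Meant for at most one new column,
    where [stepsize_hitp] does not control the corner factor. *)
Lemma strips_bound_rows (X' X'' Y' Y'' : seq int) w :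
  uniq (X' ++ X'') -> uniq (Y' ++ Y'') ->
  E p (box X'' Y'' ++ box X' Y'' ++ box X'' Y') (fun w => (strips X' X'' Y' Y'' w)%:R) w
  <= (1 - (1 - p) ^+ size (X' ++ X'')) ^+ size Y''.
Proof.
move=> uX uY.
have uY'' : uniq Y'' by move: uY; rewrite cat_uniq => /and3P[].
have -> : E p (box X'' Y'' ++ box X' Y'' ++ box X'' Y') =
    E p (box X'' Y' ++ flatten [seq rowl (X' ++ X'') y | y <- Y'']).
  apply/funext => f; apply: eq_mem_E => z; rewrite !mem_cat mem_rows !mem_box mem_cat.
  by case: (_ \in X'); case: (_ \in X''); case: (_ \in Y'); case: (_ \in Y'').
rewrite E_cat; apply: (E_le_cst p01) => w1.
apply: (@le_trans _ _ (E p (flatten [seq rowl (X' ++ X'') y | y <- Y''])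
   (fun w => \prod_(y <- Y'') (hit (rowl (X' ++ X'') y) w)%:R) w1)).
  apply: (E_le p01) => w2; rewrite /strips.
  apply: (@le_trans _ _ (all (fun y => hit (rowl (X' ++ X'') y) w2) Y'')%:R).
    by case: all => //; case: all.
  elim: (Y'') => [|y r IH]; rewrite ?big_nil// big_cons /= -mulnb natrM.
  by apply: ler_wpM2l IH.
rewrite E_prod_blocks//.
  under eq_bigr do rewrite E_hit ?uniq_rowl// size_map.
  by rewrite prodr_const_seq.
move=> x1 x2 x1X x2X n12 w2 z b zr; rewrite (@indep_hit (rowl (X' ++ X'') x2) _ _ w2 z b zr)//.
by move=> z'; rewrite !mem_rowl => /andP[_ /eqP ->]; rewrite (negbTE n12) andbF.
Qed.

Lemma strips_bound_cols (X' X'' Y' Y'' : seq int) w :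
  uniq (X' ++ X'') -> uniq (Y' ++ Y'') ->
  E p (box X'' Y'' ++ box X' Y'' ++ box X'' Y') (fun w => (strips X' X'' Y' Y'' w)%:R) w
  <= (1 - (1 - p) ^+ size (Y' ++ Y'')) ^+ size X''.
Proof.
move=> uX uY.
have uX'' : uniq X'' by move: uX; rewrite cat_uniq => /and3P[].
have -> : E p (box X'' Y'' ++ box X' Y'' ++ box X'' Y') =
    E p (box X' Y'' ++ flatten [seq coll x (Y' ++ Y'') | x <- X'']).
  apply/funext => f; apply: eq_mem_E => z; rewrite !mem_cat mem_cols !mem_box mem_cat.
  by case: (_ \in X'); case: (_ \in X''); case: (_ \in Y'); case: (_ \in Y'').
rewrite E_cat; apply: (E_le_cst p01) => w1.
apply: (@le_trans _ _ (E p (flatten [seq coll x (Y' ++ Y'') | x <- X''])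
   (fun w => \prod_(x <- X'') (hit (coll x (Y' ++ Y'')) w)%:R) w1)).
  apply: (E_le p01) => w2; rewrite /strips.
  apply: (@le_trans _ _ (all (fun x => hit (coll x (Y' ++ Y'')) w2) X'')%:R).
    by case: all => //; case: all.
  elim: (X'') => [|y r IH]; rewrite ?big_nil// big_cons /= -mulnb natrM.
  by apply: ler_wpM2l IH.
rewrite E_prod_blocks//.
  under eq_bigr do rewrite E_hit ?uniq_coll// size_map.
  by rewrite prodr_const_seq.
move=> x1 x2 x1X x2X n12 w2 z b zr; rewrite (@indep_hit (coll x2 (Y' ++ Y'')) _ _ w2 z b zr)//.
by move=> z'; rewrite !mem_coll => /andP[/eqP -> _]; rewrite (negbTE n12).
Qed.
End StripBound.

(** * Growth of the active rectangle in the modified model *)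

Definition is_occ (s : state) : bool := if s is Occ then true else false.

(** The extents are distances from the origin, so the sides have [l + r + 1] and [d + u + 1]
    sites. *)
Definition in_rect (l r d u : nat) (z : site) : bool :=
  [&& - l%:Z <= z.1, z.1 <= r%:Z, - d%:Z <= z.2 & z.2 <= u%:Z].

(** A new line in both directions at once corresponds to an occupied site touching a corner. In the
    first case [c] is left free here and confined by [in_rect] in [reach_step]. *)
Definition adds_side (l r l' r' : nat) (c : int) : Prop :=
  [\/ l' = l /\ r' = r,
      [/\ l' = l.+1, r' = r & c = - (l.+1)%:Z] |
      [/\ l' = l, r' = r.+1 & c = (r.+1)%:Z]].

Inductive reach (w : site -> bool) : nat -> nat -> nat -> nat -> Prop :=
| reach_origin : reach w 0 0 0 0
| reach_step l r d u l' r' d' u' z :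
    reach w l r d u -> w z -> z != origin ->
    adds_side l r l' r' z.1 -> adds_side d u d' u' z.2 ->
    in_rect l' r' d' u' z -> reach w l' r' d' u'.

Lemma adds_side_le (l r l1 r1 : nat) (c : int) : adds_side l r l1 r1 c ->
  (l <= l1)%N /\ (r <= r1)%N /\ (l1 + r1 <= (l + r).+1)%N.
Proof. by case=> [[-> ->]|[-> -> _]|[-> -> _]]; lia. Qed.

Lemma reach_extend w l r d u z :
  reach w l r d u -> w z -> z != origin -> ~~ in_rect l r d u z ->
  in_rect l.+1 r.+1 d.+1 u.+1 z ->
  exists l' r' d' u', [/\ reach w l' r' d' u', (l + r + d + u < l' + r' + d' + u')%N,
    (l' + r' <= (l + r).+1)%N & (d' + u' <= (d + u).+1)%N].
Proof.
move=> rR wz zo out inn.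
have [l' [r' [a1 a2 a3]]] : exists l' r', [/\ adds_side l r l' r' z.1,
    (- l'%:Z <= z.1) /\ (z.1 <= r'%:Z), (l + r <= l' + r' <= (l + r).+1)%N &
    ~~ ((- l%:Z <= z.1) && (z.1 <= r%:Z)) -> (l + r < l' + r')%N].
  move: inn; rewrite /in_rect => /and4P[h1 h2 _ _].
  have [e|e] := eqVneq z.1 (- (l.+1)%:Z).
    exists l.+1, r; split; [by apply: Or32; split|lia|lia|lia].
  have [e'|e'] := eqVneq z.1 ((r.+1)%:Z).
    exists l, r.+1; split; [by apply: Or33; split|lia|lia|lia].
  exists l, r; split; [by apply: Or31|lia|lia|lia].
have [d' [u' [b1 b2 b3]]] : exists d' u', [/\ adds_side d u d' u' z.2,
    (- d'%:Z <= z.2) /\ (z.2 <= u'%:Z), (d + u <= d' + u' <= (d + u).+1)%N &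
    ~~ ((- d%:Z <= z.2) && (z.2 <= u%:Z)) -> (d + u < d' + u')%N].
  move: inn; rewrite /in_rect => /and4P[_ _ h1 h2].
  have [e|e] := eqVneq z.2 (- (d.+1)%:Z).
    exists d.+1, u; split; [by apply: Or32; split|lia|lia|lia].
  have [e'|e'] := eqVneq z.2 ((u.+1)%:Z).
    exists d, u.+1; split; [by apply: Or33; split|lia|lia|lia].
  exists d, u; split; [by apply: Or31|lia|lia|lia].
move=> b4 a4; exists l', r', d', u'; split.
- apply: reach_step rR wz zo a1 b1 _.
  by rewrite /in_rect; case: a2 => -> ->; case: b2 => -> ->.
- move: out; rewrite /in_rect !negb_and; lia.
- lia.
- lia.
Qed.

(** A site outside a rectangle has at most one [nbrs1] neighbour inside, so an empty site never
    activates, and an occupied one can only do so from the surrounding ring. *)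
Lemma confinement (eta0 : config) (l r d u : nat) :
  (forall x, x != origin -> ~~ is_act (eta0 x)) ->
  (forall z, ~~ in_rect l r d u z -> in_rect l.+1 r.+1 d.+1 u.+1 z -> ~~ is_occ (eta0 z)) ->
  forall t x, ~~ in_rect l r d u x -> iter t step_modified eta0 x = eta0 x.
Proof.
move=> act0 occ0; elim => //= t IH x xR.
have inA y : is_act (iter t step_modified eta0 y) -> in_rect l r d u y.
  apply: contraTT => yR; rewrite IH//; apply: act0.
  by apply: contraNneq yR => ->; rewrite /in_rect /origin /=; lia.
rewrite /step_modified IH//; case E0 : (eta0 x) => //.
- case: ifP => //; rewrite /n_active /nbrs1 /=.
  do 4! (case: (boolP (is_act _)) => [/inA|_]); rewrite ?addn0 ?add0n//;
  by move: xR; rewrite /in_rect /=; lia.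
- case: ifP => //; rewrite /n_active -has_count => /hasP[y yx /inA yR].
  suff /(occ0 _ xR) : in_rect l.+1 r.+1 d.+1 u.+1 x by rewrite E0.
  move: yx yR; rewrite /nbrsinf /nbrs1 /= !inE.
  by case: y => y1 y2; rewrite !xpair_eqE /in_rect /=; lia.
Qed.

(** No value of the longer extent is skipped, because an attachment raises each extent by at most
    one. If the value stayed at [n] forever, attachments would still increase the half-perimeter
    without bound. *)
Lemma growth_reach (eta0 : config) :
  is_act (eta0 origin) ->
  (forall x, x != origin -> ~~ is_act (eta0 x)) ->
  indefinite_growth step_modified eta0 ->
  forall n, exists l r d u, reach (fun z => is_occ (eta0 z)) l r d u /\
    maxn (l + r) (d + u) = n.
Proof.
move=> o0 act0 grow; elim => [|n [l0 [r0 [d0 [u0 [R0 m0]]]]]].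
  by exists 0%N, 0%N, 0%N, 0%N; split => //; exact: reach_origin.
apply: contrapT => no.
(* [k] bounds the half-perimeter from below; for [k = 2 n + 1] it exceeds twice the longer
   extent. *)
suff H k : exists l r d u, [/\ reach (fun z => is_occ (eta0 z)) l r d u,
    maxn (l + r) (d + u) = n & (k <= l + r + d + u)%N].
  by have [l [r [d [u [_ h1 h2]]]]] := H (n + n).+1; lia.
elim: k => [|k [l [r [d [u [R mR kR]]]]]].
  by exists l0, r0, d0, u0.
have [/existsNP[z hz]|noz] := pselect (~ forall z, ~~ in_rect l r d u z ->
    in_rect l.+1 r.+1 d.+1 u.+1 z -> ~~ is_occ (eta0 z)).
  move: hz; rewrite !not_implyE => -[zR [zR1 /negP]]; rewrite negbK => zo.
  have zno : z != origin.
    by apply: contraNneq zR => ->; rewrite /in_rect /origin /=; lia.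
  have [l' [r' [d' [u' [R' h1 h2 h3]]]]] := reach_extend R zo zno zR zR1.
  have [e|e] := eqVneq (maxn (l' + r') (d' + u')) n.
    by exists l', r', d', u'; split => //; lia.
  by exfalso; apply: no; exists l', r', d', u'; split => //; lia.
have /contrapT conf := noz.
have [t] := grow ((r.+1)%:Z, 0).
have out : ~~ in_rect l r d u ((r.+1)%:Z, 0) by rewrite /in_rect /=; lia.
rewrite (confinement act0 conf)// => h; exfalso.
by move: (act0 ((r.+1)%:Z, 0)); rewrite h => /(_ isT).
Qed.

(* The rectangles in a reach derivation grow by at most one in each dimension,
   so one of them is the first to be within the prescribed size of the last. *)
Lemma reach_coarse w l r d u (A B : nat) :
  reach w l r d u -> (A <= l + r)%N -> (B <= d + u)%N ->
  exists l' r' d' u',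
  [/\ reach w l' r' d' u',
      [/\ l' <= l, r' <= r, d' <= d & u' <= u]%N,
      [/\ (A <= l' + r')%N, (B <= d' + u')%N &
         [\/ (0 < A)%N && (l' + r' <= A)%N, (0 < B)%N && (d' + u' <= B)%N | l' + r' + d' + u' = 0%N]],
      (forall x, - l%:Z <= x <= r%:Z -> ~~ (- l'%:Z <= x <= r'%:Z) ->
        exists z, [/\ w z, in_rect l r d u z & z.1 = x]) &
      (forall y, - d%:Z <= y <= u%:Z -> ~~ (- d'%:Z <= y <= u'%:Z) ->
        exists z, [/\ w z, in_rect l r d u z & z.2 = y])].
Proof.
move=> R; elim: R A B => {l r d u} [A B|l r d u l1 r1 d1 u1 z R IH wz zno ax ay inz A B hA hB].
  rewrite !leqn0 => /eqP -> /eqP ->; exists 0%N, 0%N, 0%N, 0%N; split => //.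
  - exact: reach_origin.
  - by split => //; apply: Or33.
  - by move=> x ->.
  - by move=> x ->.
have [gl [gr glr]] := adds_side_le ax; have [gd [gu gdu]] := adds_side_le ay.
have self : (0 < A)%N && (l1 + r1 <= A)%N || (0 < B)%N && (d1 + u1 <= B)%N -> exists l' r' d' u',
  [/\ reach w l' r' d' u',
      [/\ l' <= l1, r' <= r1, d' <= d1 & u' <= u1]%N,
      [/\ (A <= l' + r')%N, (B <= d' + u')%N &
         [\/ (0 < A)%N && (l' + r' <= A)%N, (0 < B)%N && (d' + u' <= B)%N | l' + r' + d' + u' = 0%N]],
      (forall x, - l1%:Z <= x <= r1%:Z -> ~~ (- l'%:Z <= x <= r'%:Z) ->
        exists z, [/\ w z, in_rect l1 r1 d1 u1 z & z.1 = x]) &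
      (forall y, - d1%:Z <= y <= u1%:Z -> ~~ (- d'%:Z <= y <= u'%:Z) ->
        exists z, [/\ w z, in_rect l1 r1 d1 u1 z & z.2 = y])].
  move=> AB; exists l1, r1, d1, u1; split => //.
  - by apply: reach_step R wz zno ax ay inz.
  - by split => //; case/orP: AB => h; [apply: Or31|apply: Or32].
  - by move=> x ->.
  - by move=> x ->.
have [hA'|hA'] := leqP A (l + r); last by apply: self; lia.
have [hB'|hB'] := leqP B (d + u); last by apply: self; lia.
have [l' [r' [d' [u' [R' [s1 s2 s3 s4] s5 cx cy]]]]] := IH A B hA' hB'.
have incl z' : in_rect l r d u z' -> in_rect l1 r1 d1 u1 z'.
  by rewrite /in_rect; lia.
exists l', r', d', u'; split => //.
- by split; lia.
- move=> x xr1 xr'; have [xr|xr] := boolP (- l%:Z <= x <= r%:Z).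
    by have [z' [wz' /incl iz' <-]] := cx x xr xr'; exists z'; split.
  exists z; split => //; case: ax => [[e1 e2]|[e1 e2 ->]|[e1 e2 ->]]; lia.
- move=> x xr1 xr'; have [xr|xr] := boolP (- d%:Z <= x <= u%:Z).
    by have [z' [wz' /incl iz' <-]] := cy x xr xr'; exists z'; split.
  exists z; split => //; case: ay => [[e1 e2]|[e1 e2 ->]|[e1 e2 ->]]; lia.
Qed.

Lemma reach_local (l r d u : nat) (w w' : site -> bool) :
  (forall z, z != origin -> in_rect l r d u z -> w z = w' z) ->
  reach w l r d u -> reach w' l r d u.
Proof.
move=> + R; elim: R => {l r d u} [|l r d u l1 r1 d1 u1 z R IH wz zno ax ay inz] ww'.
  exact: reach_origin.
have wz' : w' z by rewrite -(ww' z).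
apply: (reach_step (IH _) wz' zno ax ay inz) => z' z'o h.
apply: ww' => //.
by move: h (adds_side_le ax) (adds_side_le ay); rewrite /in_rect; lia.
Qed.

(** * The coarse-grained recursion *)

Definition irange (l r : nat) : seq int := [seq i%:Z - l%:Z | i <- iota 0 (l + r).+1].

Arguments irange : simpl never.

Lemma mem_irange l r x : (x \in irange l r) = (- l%:Z <= x <= r%:Z).
Proof.
apply/mapP/idP => [[i]|]; first by rewrite mem_iota => ? ->; lia.
move=> h; exists (absz (x + l%:Z)); last by lia.
by rewrite mem_iota; lia.
Qed.

Lemma uniq_irange l r : uniq (irange l r).
Proof. by rewrite map_inj_uniq ?iota_uniq// => i j; lia. Qed.

Lemma size_irange l r : size (irange l r) = (l + r).+1.
Proof. by rewrite size_map size_iota. Qed.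

Definition rect_sites (l r d u : nat) : seq site := box (irange l r) (irange d u).

Lemma mem_rect_sites l r d u z : (z \in rect_sites l r d u) = in_rect l r d u z.
Proof. by rewrite mem_box !mem_irange /in_rect -!andbA. Qed.

Definition new_range (l r l' r' : nat) : seq int :=
  [seq x <- irange l r | x \notin irange l' r'].

Lemma perm_new_range l r l' r' : (l' <= l)%N -> (r' <= r)%N ->
  perm_eq (irange l' r' ++ new_range l r l' r') (irange l r).
Proof.
move=> hl hr; apply: uniq_perm; rewrite ?uniq_irange//.
  rewrite cat_uniq uniq_irange filter_uniq ?uniq_irange// andbT.
  by apply/hasPn => x; rewrite mem_filter => /andP[].
move=> x; rewrite mem_cat mem_filter !mem_irange; lia.
Qed.

Lemma size_new_range l r l' r' : (l' <= l)%N -> (r' <= r)%N ->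
  size (new_range l r l' r') = (l + r - (l' + r'))%N.
Proof.
move=> hl hr; have := perm_size (perm_new_range hl hr).
by rewrite size_cat !size_irange; move=> /(canRL (addKn _)) ->; lia.
Qed.

Definition new_strips (l r d u l' r' d' u' : nat) :=
  strips (irange l' r') (new_range l r l' r') (irange d' u') (new_range d u d' u').

Definition strip_sites (l r d u l' r' d' u' : nat) : seq site :=
  box (new_range l r l' r') (new_range d u d' u') ++
  box (irange l' r') (new_range d u d' u') ++
  box (new_range l r l' r') (irange d' u').

Lemma mem_strip_sites l r d u l' r' d' u' z :
  (z \in strip_sites l r d u l' r' d' u') =
  [|| (z.1 \in new_range l r l' r') && (z.2 \in new_range d u d' u'),
      (z.1 \in irange l' r') && (z.2 \in new_range d u d' u') |
      (z.1 \in new_range l r l' r') && (z.2 \in irange d' u')].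
Proof.
rewrite /strip_sites mem_cat mem_box; congr (_ || _).
by rewrite mem_cat !mem_box.
Qed.

Lemma ler_sum_mem (R : realType) (T : eqType) (r : seq T) (P : pred T) (F : T -> R) x :
  x \in r -> P x -> (forall y, 0 <= F y) -> F x <= \sum_(y <- r | P y) F y.
Proof.
move=> xr Px F0; rewrite (big_rem x)//= Px lerDl.
by apply: sumr_ge0.
Qed.

Section Recursion.
Context {R : realType}.
Variable p : R.
Hypotheses (p0 : 0 < p) (p1 : p < 1).

Let p01 : 0 <= p <= 1. Proof. by rewrite !ltW. Qed.

(** Union bound over the inner rectangle supplied by [reach_coarse]; the prefactor counts its
    possible extents. The guards [0 < A] and [0 < B] matter when [A] and [B] come from truncated
    subtractions: a zero target need not mean that a full step back was made, and then the history
    is followed down to the origin. *)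
Lemma reach_recursion l r d u A B (M : R) :
  (A <= l + r)%N -> (B <= d + u)%N -> 0 <= M ->
  (forall l' r' d' u', (l' <= l)%N -> (r' <= r)%N -> (d' <= d)%N -> (u' <= u)%N ->
    (A <= l' + r')%N -> (B <= d' + u')%N ->
    [\/ (0 < A)%N && (l' + r' <= A)%N, (0 < B)%N && (d' + u' <= B)%N | l' + r' + d' + u' = 0%N] ->
    exists beta gamma : R,
      [/\ forall w, E p (rect_sites l' r' d' u') (fun w => indic R (reach w l' r' d' u')) w <= beta,
          forall w, E p (strip_sites l r d u l' r' d' u')
             (fun w => (new_strips l r d u l' r' d' u' w)%:R) w <= gamma,
          0 <= gamma & beta * gamma <= M]) ->
  forall w, E p (rect_sites l r d u) (fun w => indic R (reach w l r d u)) w <=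
    ((l.+1 * r.+1) * (d.+1 * u.+1))%:R * M.
Proof.
move=> hA hB M0 H w.
pose L := [seq (a, b) | a <- [seq (i, j) | i <- iota 0 l.+1, j <- iota 0 r.+1],
                        b <- [seq (i, j) | i <- iota 0 d.+1, j <- iota 0 u.+1]].
pose ok (t : nat * nat * (nat * nat)) := [&& (t.1.1 <= l)%N, (t.1.2 <= r)%N, (t.2.1 <= d)%N, (t.2.2 <= u)%N,
  (A <= t.1.1 + t.1.2)%N, (B <= t.2.1 + t.2.2)%N &
  [|| (0 < A)%N && (t.1.1 + t.1.2 <= A)%N, (0 < B)%N && (t.2.1 + t.2.2 <= B)%N | t.1.1 + t.1.2 + t.2.1 + t.2.2 == 0%N]].
pose F t w := indic R (reach w t.1.1 t.1.2 t.2.1 t.2.2) *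
  (new_strips l r d u t.1.1 t.1.2 t.2.1 t.2.2 w)%:R.
have F0 t w' : 0 <= F t w' by rewrite mulr_ge0// indic_ge0.
apply: (@le_trans _ _ (E p (rect_sites l r d u) (fun w => \sum_(t <- L | ok t) F t w) w)).
  apply: (E_le p01) => w'.
  have [rR|nR] := pselect (reach w' l r d u); last first.
    by rewrite (indicF _ nR) sumr_ge0.
  rewrite indicT//.
  have [l' [r' [d' [u' [R' [s1 s2 s3 s4] [t1 t2 t3] cx cy]]]]] := reach_coarse rR hA hB.
  pose t := ((l', r'), (d', u')).
  have tL : t \in L.
    by apply/allpairsP; exists t; split => //; apply/allpairsP; [exists (l', r')|exists (d', u')];
      split => //; rewrite mem_iota /=; lia.
  have okt : ok t by rewrite /ok /t /= s1 s2 s3 s4 t1 t2 /=; case: t3 => [->|->|/eqP ->]; rewrite ?orbT.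
  apply: le_trans (@ler_sum_mem _ _ L ok (F^~ w') t tL okt _) => //.
  rewrite /F /= indicT// mul1r; suff -> : new_strips l r d u l' r' d' u' w' by [].
  have memx := perm_mem (perm_new_range s1 s2).
  have memy := perm_mem (perm_new_range s3 s4).
  apply/andP; split; apply/allP => x; rewrite mem_filter !mem_irange => /andP[xn xi].
    have [z [wz zin zx]] := cy x xi xn.
    apply/hasP; exists z => //; rewrite mem_rowl memx mem_irange zx eqxx andbT.
    by case/and4P: zin => -> -> _ _.
  have [z [wz zin zx]] := cx x xi xn.
  apply/hasP; exists z => //; rewrite mem_coll memy mem_irange zx eqxx /=.
  by case/and4P: zin => _ _ -> ->.
rewrite E_sum.
have szL : size L = ((l.+1 * r.+1) * (d.+1 * u.+1))%N.
  by rewrite !size_allpairs !size_iota.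
rewrite -szL -sum1_size natr_sum mulr_suml big_mkcond /=.
apply: ler_sum => -[[l' r'] [d' u']] _; rewrite mul1r.
case: ifP => // /and5P[/= s1 s2 s3 s4 /and3P[t1 t2 t3]].
have [|beta [gamma [hb hg g0 bg]]] := H l' r' d' u' s1 s2 s3 s4 t1 t2.
  by case/or3P: t3 => [h|h|/eqP h]; [apply: Or31|apply: Or32|apply: Or33].
rewrite /F /=.
have memx := perm_mem (perm_new_range s1 s2).
have memy := perm_mem (perm_new_range s3 s4).
have memR : rect_sites l r d u =i rect_sites l' r' d' u' ++ strip_sites l r d u l' r' d' u'.
  move=> z; rewrite (mem_cat z (rect_sites l' r' d' u')) mem_strip_sites /rect_sites !mem_box -memx -memy !mem_cat.
  by case: (z.1 \in irange _ _); case: (z.2 \in irange _ _);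
     case: (z.1 \in new_range _ _ _ _); case: (z.2 \in new_range _ _ _ _).
rewrite (eq_mem_E _ _ memR).
rewrite E_cat; apply: le_trans bg.
(* Hence the inner event does not read the strips and leaves the average over them as a factor. *)
have out z : z \in strip_sites l r d u l' r' d' u' -> ~~ in_rect l' r' d' u' z.
  rewrite mem_strip_sites !mem_filter -mem_rect_sites /rect_sites mem_box.
  by case: (z.1 \in irange l' r'); case: (z.2 \in irange d' u').
apply: (@le_trans _ _ (E p (rect_sites l' r' d' u')
   (fun w => gamma * indic R (reach w l' r' d' u')) w)).
  apply: (E_le p01) => w'; rewrite E_mulr.
    by rewrite mulrC ler_wpM2r ?indic_ge0.
  move=> w1 z b /out zout; congr (_%:R); congr (nat_of_bool _); apply: asbool_equiv_eq.
  by split; apply: reach_local => y _ yin; rewrite /upd; case: eqP => // yz;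
    move: zout; rewrite -yz yin.
rewrite E_mulr// mulrC ler_wpM2r//.
Qed.

End Recursion.

(** * Weight of the cheapest growth path *)

Section Cost.
Context {R : realType}.
Variable p : R.
Hypotheses (p0 : 0 < p) (p1 : p < 1).

Let q0 : 0 < 1 - p. Proof. by rewrite subr_gt0. Qed.
Let q0' : 0 <= 1 - p. Proof. exact: ltW. Qed.
Let q1 : 1 - p <= 1. Proof. by rewrite gerBl ltW. Qed.

Definition hitp (k : nat) : R := 1 - (1 - p) ^+ k.

Lemma hitp_le1 k : hitp k <= 1.
Proof. by rewrite gerBl exprn_ge0. Qed.

Lemma hitp_homo j k : (j <= k)%N -> hitp j <= hitp k.
Proof. by move=> jk; rewrite lerD2l lerN2 ler_wiXn2l. Qed.

Lemma hitp1 : hitp 1 = p.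
Proof. by rewrite /hitp expr1; ring. Qed.

Lemma hitp_ge_p k : (0 < k)%N -> p <= hitp k.
Proof. by move=> k0; rewrite -{1}hitp1 hitp_homo. Qed.

Lemma hitp_gt0 k : (0 < k)%N -> 0 < hitp k.
Proof. by move=> k0; rewrite (lt_le_trans p0)// hitp_ge_p. Qed.

Lemma hitp_ge0 k : 0 <= hitp k.
Proof. by rewrite subr_ge0 exprn_ile1. Qed.

(** Log-concavity of [hitp]: the two sides differ by [x * p * (1 - y)] with [x] and [y] as in the
    proof. *)
Lemma hitp_cross b n : hitp b * hitp (b + n).+1 <= hitp (b + n) * hitp b.+1.
Proof.
rewrite /hitp !exprS exprD; set x := (1 - p) ^+ b; set y := (1 - p) ^+ n.
have x0 : 0 <= x by exact: exprn_ge0.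
have y1 : y <= 1 by exact: exprn_ile1.
have : 0 <= x * p * (1 - y) by rewrite !mulr_ge0 ?subr_ge0// ltW.
lra.
Qed.

Lemma bernoulli (x : R) n : 0 <= x -> x <= 1 -> 1 - n%:R * x <= (1 - x) ^+ n.
Proof.
move=> x0 x1; elim: n => [|n IH]; first by rewrite expr0 mul0r subr0.
rewrite exprS -natr1.
have h : (1 - n%:R * x) * (1 - x) <= (1 - x) * (1 - x) ^+ n.
  by rewrite mulrC ler_wpM2l// subr_ge0.
have : 0 <= n%:R * x * x by rewrite !mulr_ge0.
by nra.
Qed.

Lemma expr_1B_le n : (1 - p) ^+ n <= (1 + n%:R * p)^-1.
Proof.
have d0 : 0 < 1 + n%:R * p by rewrite ltr_pwDl// mulr_ge0// ltW.
rewrite -[leRHS]mul1r ler_pdivlMr// mulrC.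
elim: n d0 => [|n IH] d0; first by rewrite mul0r addr0 mul1r expr0.
have dn : 0 < 1 + n%:R * p by rewrite ltr_pwDl// mulr_ge0// ltW.
apply: le_trans (IH dn); rewrite exprS mulrA ler_wpM2r ?exprn_ge0// -natr1.
have : 0 <= n%:R * p * p by rewrite !mulr_ge0// ltW.
have : 0 <= p * p by rewrite mulr_ge0// ltW.
by lra.
Qed.

Lemma hitp_lower n : n%:R * p <= 1 -> n%:R * p / 2 <= hitp n.
Proof.
move=> np; have := expr_1B_le n; rewrite /hitp.
have np0 : 0 <= n%:R * p by rewrite mulr_ge0// ltW.
move: np np0; set x := n%:R * p => x1 x0 h.
have : (1 + x)^-1 <= 1 - x / 2.
  rewrite -[leLHS]mul1r ler_pdivrMr; last by lra.
  nra.
lra.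
Qed.

Lemma hitp_sub a s : hitp (a + s) - s%:R * p <= hitp a.
Proof.
rewrite /hitp exprD.
have h := bernoulli s (ltW p0) (ltW p1).
have x0 : 0 <= (1 - p) ^+ a by exact: exprn_ge0.
have x1 : (1 - p) ^+ a <= 1 by exact: exprn_ile1.
have sp : 0 <= s%:R * p by rewrite mulr_ge0// ltW.
by nra.
Qed.

(* The probability weight of the cheapest growth path to an [a * b] rectangle:
   along the diagonal first, then straight. *)
Definition diag_weight (a b : nat) : R :=
  (\prod_(1 <= k < (minn a b).+1) hitp k) ^+ 2 * hitp (minn a b) ^+ (maxn a b - minn a b).

Lemma diag_weightC a b : diag_weight a b = diag_weight b a.
Proof. by rewrite /diag_weight minnC maxnC. Qed.

Lemma diag_weight_ge0 a b : 0 <= diag_weight a b.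
Proof. by rewrite mulr_ge0 ?exprn_ge0 ?hitp_ge0// prodr_ge0// => k _; exact: hitp_ge0. Qed.

Lemma diag_weight_gt0 a b : (0 < a)%N -> (0 < b)%N -> 0 < diag_weight a b.
Proof.
move=> a0 b0; rewrite mulr_gt0 ?exprn_gt0 ?hitp_gt0 ?leq_min ?a0//.
by rewrite big_nat; apply: prodr_gt0 => k /andP[k0 _]; exact: hitp_gt0.
Qed.

(** The case of a long side [b + n.+1] and a short side [b] in [diag_weight_step]: adding the long
    row late is no more likely than raising the short side along the diagonal. Each increment of [n]
    uses log-concavity once. *)
Lemma hitp_power b n : hitp b ^+ n.+1 * hitp (b + n.+1) <= hitp b.+1 ^+ n.+2.
Proof.
elim: n => [|n IH].
  by rewrite expr1 addn1 expr2; have := hitp_cross b 0; rewrite addn0 mulrC [leRHS]mulrC;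
    have := hitp_homo (leqnSn b); have := hitp_ge0 b.+1; nra.
rewrite exprS [leRHS]exprS.
apply: (@le_trans _ _ (hitp b.+1 * (hitp b ^+ n.+1 * hitp (b + n.+1)))); last first.
  by rewrite ler_wpM2l ?hitp_ge0.
have h : hitp b * hitp (b + n.+2) <= hitp (b + n.+1) * hitp b.+1.
  by have := hitp_cross b n.+1; rewrite -addnS.
have := ler_wpM2l (exprn_ge0 n.+1 (hitp_ge0 b)) h.
set x := hitp b ^+ n.+1 => h'.
rewrite [leLHS](_ : _ = x * (hitp b * hitp (b + n.+2))); last by ring.
by rewrite (le_trans h')// le_eqVlt; apply/orP; left; apply/eqP; ring.
Qed.

(** Optimality of the diagonal in local form: iterated, it says that no order of adding rows and
    columns beats [diag_weight]. For [a <= b] it is an equality. *)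
Lemma diag_weight_step a b : (0 < a)%N -> (0 < b)%N ->
  diag_weight a b * hitp a <= diag_weight a b.+1.
Proof.
move=> a0 b0; rewrite /diag_weight.
have [ab|ba] := boolP (a <= b)%N.
  have -> : minn a b = a by lia.
  have -> : minn a b.+1 = a by lia.
  have -> : maxn a b = b by lia.
  have -> : maxn a b.+1 = b.+1 by lia.
  by rewrite -mulrA -exprSr subSn.
have -> : minn a b = b by lia.
have -> : minn a b.+1 = b.+1 by lia.
have -> : maxn a b = a by lia.
have -> : maxn a b.+1 = a by lia.
rewrite (@big_nat_recr _ _ _ b.+1)//=.
set P := \prod_(_ <= _ < _) _.
have [n e] : exists n, a = (b + n.+1)%N by exists (a - b.+1)%N; lia.
rewrite e addKn addnS -addSn addKn.
have := ler_wpM2l (sqr_ge0 P) (hitp_power b n); rewrite addnS -addSn !exprS expr0 mulr1.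
set x := hitp b ^+ n; set y := hitp b.+1 ^+ n => h.
rewrite [leLHS](_ : _ = P * P * (hitp b * x * hitp (b.+1 + n))); last by ring.
by rewrite (le_trans h)// le_eqVlt; apply/orP; left; apply/eqP; ring.
Qed.

Lemma diag_weight_rows a b t : (0 < a)%N -> (0 < b)%N ->
  diag_weight a b * hitp a ^+ t <= diag_weight a (b + t).
Proof.
move=> a0 b0; elim: t => [|t IH]; first by rewrite addn0 expr0 mulr1.
rewrite exprSr mulrA addnS; apply: le_trans (diag_weight_step _ _) => //.
  by rewrite ler_wpM2r ?hitp_ge0.
by rewrite addn_gt0 b0.
Qed.

Lemma diag_weight_cols a b s : (0 < a)%N -> (0 < b)%N ->
  diag_weight a b * hitp b ^+ s <= diag_weight (a + s) b.
Proof. by move=> a0 b0; rewrite diag_weightC [leRHS]diag_weightC diag_weight_rows. Qed.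

End Cost.

(* With [m] about [p ^ (-1/2)] this is [sqrt p * min k (1/p) / 2]: small enough for the
   corner of two strips to matter only by a constant, large enough for [nsteps] to be
   [O(p ^ (-1/2) * log (1/p))]. *)
Definition stepsize (m k : nat) : nat := maxn 1 (minn k (m ^ 2) %/ (2 * m)).

(** A smoothed count of look-back steps. Since [stepsize] is nondecreasing, going down from [b] by
    [stepsize m b] removes terms of total at least one. *)
Definition nsteps (R : realType) (m a : nat) : R :=
  \sum_(1 <= k < a.+1) (stepsize m k)%:R^-1.

(** * Induction over look-back steps *)

Section UpperInduction.
Context {R : realType}.
Variables (p : R) (m : nat).
Hypotheses (p0 : 0 < p) (p1 : p < 1) (m0 : (0 < m)%N)
  (mp : (m ^ 2)%:R * p <= 1) (pm : 1 <= 4 * (m ^ 2)%:R * p)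
  (psmall : 2 * expR 4 * p <= 1).

Let p01 : 0 <= p <= 1. Proof. by rewrite !ltW. Qed.

Lemma stepsize_gt0 k : (0 < stepsize m k)%N.
Proof. by rewrite leq_maxl. Qed.

Lemma stepsize_homo j k : (j <= k)%N -> (stepsize m j <= stepsize m k)%N.
Proof.
move=> jk; rewrite geq_max leq_maxl /= leq_max; apply/orP; right.
by apply: leq_div2r; rewrite leq_min geq_minr (leq_trans (geq_minl _ _) jk).
Qed.

Lemma stepsize_le s k : (1 < s)%N -> (s <= stepsize m k)%N ->
  (s * (2 * m) <= k)%N /\ (s * (2 * m) <= m ^ 2)%N.
Proof.
move=> s1 sk; suff : (s * (2 * m) <= minn k (m ^ 2))%N by rewrite leq_min => /andP[].
rewrite -leq_divRL; last by lia.
by move: sk; rewrite leq_max; case/orP => //; lia.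
Qed.

(** This dictates [stepsize]. Applied to both strips it gives [s * t * p / (u * v) <= 1 / (m ^ 2 *
    p) <= 4], so the corner costs at most [expR 4]; applied to one it says that removing [s] lines
    lowers [u] by at most the fraction [1 / m]. *)
Lemma stepsize_hitp s k : (1 < s)%N -> (s <= stepsize m k)%N ->
  s%:R * m%:R * p <= hitp p k.
Proof.
move=> s1 /(stepsize_le s1) [sk sm].
apply: (@le_trans _ _ (hitp p (s * (2 * m)))); last exact: hitp_homo.
have h : (s * (2 * m))%:R * p <= 1.
  by apply: le_trans mp; rewrite (ler_wpM2r (ltW p0))// ler_nat.
apply: le_trans (hitp_lower p0 p1 h).
by rewrite !natrM; lra.
Qed.

(** [diag_weight] can be extended by [t] rows of length [a] and then [s] columns of length [b + t],
    whereas the strips give rows of length [a + s]. For [s, t >= 2] the mismatch costs a factor 2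
    and the corner [expR 4], both absorbed in [p^-1]. If [s <= 1] or [t <= 1], the [p^-1] pays for
    the dropped line, which is hit with probability at least [p]. *)
Lemma strip_cost a b s t (X : R) : (0 < a)%N -> (0 < b)%N ->
  (s <= stepsize m (a + s))%N -> (t <= stepsize m (b + t))%N ->
  0 <= X -> X <= hitp p (a + s) ^+ t -> X <= hitp p (b + t) ^+ s ->
  X <= hitp p (a + s) ^+ t * hitp p (b + t) ^+ s *
     (1 - p + p * (hitp p (a + s) * hitp p (b + t))^-1) ^+ (s * t) ->
  X * diag_weight p a b <= p^-1 * diag_weight p (a + s) (b + t).
Proof.
move=> a0 b0 hs ht X0 X1 X2 X3.
have as0 : (0 < a + s)%N by rewrite addn_gt0 a0.
have bt0 : (0 < b + t)%N by rewrite addn_gt0 b0.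
have w0 := diag_weight_ge0 p0 p1.
rewrite ler_pdivlMl//.
have [s1|s1] := leqP s 1.
  have h1 := diag_weight_cols p0 p1 s a0 b0.
  have h2 := diag_weight_rows p0 p1 t as0 b0.
  apply: le_trans h2.
  apply: (@le_trans _ _ (diag_weight p a b * hitp p b ^+ s * hitp p (a + s) ^+ t)); last first.
    by rewrite ler_wpM2r// exprn_ge0// hitp_ge0.
  rewrite [leLHS](_ : _ = diag_weight p a b * (p * X)); last by ring.
  rewrite -mulrA ler_wpM2l//.
  apply: ler_pM => //; first exact: ltW.
  case: s s1 {hs X1 X2 X3 h1 as0} => [|[|]]// _; first by rewrite expr0 ltW.
  by rewrite expr1 hitp_ge_p.
have [t1|t1] := leqP t 1.
  have h1 := diag_weight_rows p0 p1 t a0 b0.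
  have h2 := diag_weight_cols p0 p1 s a0 bt0.
  apply: le_trans h2.
  apply: (@le_trans _ _ (diag_weight p a b * hitp p a ^+ t * hitp p (b + t) ^+ s)); last first.
    by rewrite ler_wpM2r// exprn_ge0// hitp_ge0.
  rewrite [leLHS](_ : _ = diag_weight p a b * (p * X)); last by ring.
  rewrite -mulrA ler_wpM2l//.
  apply: ler_pM => //; first exact: ltW.
  case: t t1 {ht X1 X2 X3 h1 bt0} => [|[|]]// _; first by rewrite expr0 ltW.
  by rewrite expr1 hitp_ge_p.
have su := stepsize_hitp s1 hs; have tv := stepsize_hitp t1 ht.
have [_ tm] := stepsize_le t1 ht.
move: X3 su tv; have u0 := hitp_gt0 p0 p1 as0; have v0 := hitp_gt0 p0 p1 bt0.
set u := hitp p (a + s) in u0 *; set v := hitp p (b + t) in v0 * => X3 su tv.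
have mR : 0 < m%:R :> R by rewrite ltr0n.
have corner0 : 0 < 1 - p + p * (u * v)^-1.
  by rewrite addr_gt0 ?subr_gt0// mulr_gt0// invr_gt0 mulr_gt0.
have corner : (1 - p + p * (u * v)^-1) ^+ (s * t) <= expR 4.
  apply: (@le_trans _ _ (expR (p * (u * v)^-1) ^+ (s * t))).
    rewrite lerXn2r ?nnegrE ?expR_ge0//; first exact: ltW corner0.
    apply: le_trans (expR_ge1Dx _).
    by rewrite lerD2r gerBl ltW.
  rewrite -expRM_natl ler_expR mulrA ler_pdivrMr ?mulr_gt0//.
  have h : (s%:R * m%:R * p) * (t%:R * m%:R * p) <= u * v.
    by apply: ler_pM => //; rewrite !mulr_ge0// ltW.
  have st0 : 0 <= (s * t)%:R * p by rewrite mulr_ge0// ltW.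
  apply: (@le_trans _ _ (4 * (s%:R * m%:R * p * (t%:R * m%:R * p)))).
    have := ler_wpM2l st0 pm; rewrite mulr1 natrX natrM.
    by set sR : R := s%:R; set tR : R := t%:R; set mR' : R := m%:R; nra.
  by rewrite ler_wpM2l.
have t2 : (2 * t <= m)%N.
  by move: tm; rewrite mulnCA mulnA -mulnn leq_pmul2r.
(* Each of the [t] rows loses at most the fraction [1 / m], and [t <= m / 2], so Bernoulli's
   inequality leaves one half. *)
have ratio : u ^+ t <= 2 * hitp p a ^+ t.
  have h1 : u * (1 - m%:R^-1) <= hitp p a.
    apply: le_trans (hitp_sub p0 p1 a s); rewrite mulrBr mulr1 lerD2l lerN2.
    by rewrite ler_pdivlMr// mulrAC.
  have im0 : 0 <= m%:R^-1 :> R by rewrite invr_ge0 ltW.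
  have im1 : m%:R^-1 <= 1 :> R by rewrite invf_le1// ler1n.
  have half : 2^-1 <= (1 - m%:R^-1) ^+ t :> R.
    apply: le_trans (bernoulli _ im0 im1).
    have : t%:R / m%:R <= 2^-1 :> R.
      rewrite ler_pdivrMr// -(ler_pM2l (ltr0n R 2)) mulrA divff// mul1r -natrM ler_nat.
      exact: t2.
    by lra.
  have h2 : (u * (1 - m%:R^-1)) ^+ t <= hitp p a ^+ t.
    have um0 : 0 <= u * (1 - m%:R^-1) by apply: mulr_ge0; [exact: ltW|rewrite subr_ge0].
    by rewrite lerXn2r ?nnegrE// hitp_ge0.
  rewrite -ler_pdivrMl//; apply: le_trans h2; rewrite exprMn mulrC.
  by rewrite ler_wpM2l ?exprn_ge0// ltW.
have h1 := diag_weight_rows p0 p1 t a0 b0.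
have h2 := diag_weight_cols p0 p1 s a0 bt0.
have big : diag_weight p a b * hitp p a ^+ t * v ^+ s <= diag_weight p (a + s) (b + t).
  by apply: le_trans h2; rewrite ler_wpM2r// exprn_ge0// hitp_ge0.
apply: le_trans big.
have vs0 : 0 <= v ^+ s by rewrite exprn_ge0// ltW.
have ht0 : 0 <= hitp p a ^+ t by rewrite exprn_ge0// hitp_ge0.
have e0 : 0 <= expR 4 :> R := expR_ge0 _.
have X4 : X <= (2 * hitp p a ^+ t) * v ^+ s * expR 4.
  apply: (le_trans X3); apply: ler_pM => //.
  - by rewrite mulr_ge0// exprn_ge0// ltW.
  - by rewrite exprn_ge0// ltW.
  - by rewrite ler_wpM2r.
apply: (@le_trans _ _ (p * ((2 * hitp p a ^+ t) * v ^+ s * expR 4 * diag_weight p a b))).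
  by rewrite ler_wpM2l ?(ltW p0)// ler_wpM2r// w0.
rewrite [leLHS](_ : _ = (2 * expR 4 * p) * (diag_weight p a b * hitp p a ^+ t * v ^+ s)); last by ring.
apply: ler_piMl => //; apply: mulr_ge0 => //; apply: mulr_ge0 => //; exact: w0.
Qed.

Lemma nsteps_homo a b : (a <= b)%N -> nsteps R m a <= nsteps R m b.
Proof.
move=> ab; rewrite /nsteps (@big_cat_nat _ _ _ a.+1 1 b.+1)//= lerDl sumr_ge0//.
Qed.

Lemma nsteps_ge1 a : (0 < a)%N -> 1 <= nsteps R m a.
Proof.
move=> a0; apply: le_trans (nsteps_homo a0); rewrite /nsteps big_nat1.
suff -> : stepsize m 1 = 1%N by rewrite invr1.
rewrite /stepsize; apply/maxn_idPl.
have h : (minn 1 (m ^ 2) <= 1)%N by rewrite geq_minl.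
by apply: leq_trans (leq_div2r _ h) _; apply: leq_trans (leq_div _ _) _.
Qed.

Lemma nsteps_add a b : (a + stepsize m b <= b)%N -> nsteps R m a + 1 <= nsteps R m b.
Proof.
move=> ab.
rewrite /nsteps (@big_cat_nat _ _ _ (b - stepsize m b).+1 1 b.+1)//=; last by rewrite ltnS leq_subr.
apply: lerD; first by apply: nsteps_homo; lia.
have s0 := stepsize_gt0 b.
have sR : 0 < (stepsize m b)%:R :> R by rewrite ltr0n.
rewrite -[leLHS](divff (lt0r_neq0 sR)) -[X in X / _]mulr1n.
apply: (@le_trans _ _ (\sum_((b - stepsize m b).+1 <= k < b.+1) (stepsize m b)%:R^-1)).
  rewrite sumr_const_nat subSS subKn; last by lia.
  by rewrite mulr1n mulrC mulr_natr.
rewrite [leLHS]big_nat [leRHS]big_nat; apply: ler_sum => k /andP[_ kb].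
by rewrite lef_pV2 ?posrE ?ltr0n ?stepsize_gt0// ler_nat stepsize_homo.
Qed.

(** Every look-back costs a choice among at most [Lm ^ 4] rectangles and a factor [p^-1], together
    at most [expR kappa], and lowers the sum of the two [nsteps] by at least one. The factor
    [p^-1 ^+ 2] makes up for the weight [p ^ 2] of the single site from which growth starts. *)
Lemma reach_bound (kappa : R) (Lm : nat) : 0 <= kappa ->
  (Lm ^ 4)%:R * p^-1 <= expR kappa ->
  forall l r d u, (l + r < Lm)%N -> (d + u < Lm)%N ->
  forall w, E p (rect_sites l r d u) (fun w => indic R (reach w l r d u)) w <=
    p^-1 ^+ 2 * expR (kappa * (nsteps R m (l + r).+1 + nsteps R m (d + u).+1)) *
    diag_weight p (l + r).+1 (d + u).+1.
Proof.
move=> k0 hk l r d u.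
have [n] := ubnP (l + r + d + u); elim: n => // n IH in l r d u *; rewrite ltnS => hn hl hd.
set a := (l + r).+1; set b := (d + u).+1.
(* The target before the union bound: the third [p^-1] comes from [strip_cost], and one step of the
   budget is already spent. *)
pose M := p^-1 ^+ 3 * expR (kappa * (nsteps R m a + nsteps R m b - 1)) * diag_weight p a b.
have ip0 : 0 <= p^-1 by rewrite invr_ge0 ltW.
have w0 := diag_weight_ge0 p0 p1.
have M0 : 0 <= M by apply: mulr_ge0 => //; apply: mulr_ge0; [exact: exprn_ge0|exact: expR_ge0].
move=> w; apply: le_trans (@reach_recursion _ p p0 p1 l r d u
   (l + r - stepsize m a) (d + u - stepsize m b) M _ _ M0 _ w) _.
- exact: leq_subr.
- exact: leq_subr.
- move=> l' r' d' u' sl sr sd su hA hB prog.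
  set a' := (l' + r').+1; set b' := (d' + u').+1.
  have w0' : 0 < diag_weight p a' b' by apply: diag_weight_gt0.
  (* The strip bound is a quotient of weights, so the weight of the inner rectangle cancels in the
     product. *)
  exists (p^-1 ^+ 2 * expR (kappa * (nsteps R m a + nsteps R m b - 1)) * diag_weight p a' b'),
    (p^-1 * diag_weight p a b / diag_weight p a' b'); split.
  + have fin : (l' + r' + d' + u' < l + r + d + u)%N ->
       nsteps R m a' + nsteps R m b' <= nsteps R m a + nsteps R m b - 1 ->
       forall w, E p (rect_sites l' r' d' u') (fun w => indic R (reach w l' r' d' u')) w <=
       p^-1 ^+ 2 * expR (kappa * (nsteps R m a + nsteps R m b - 1)) * diag_weight p a' b'.
      move=> lt ns w'.
      have i1 := leq_ltn_trans (leq_add sl sr) hl.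
      have i2 := leq_ltn_trans (leq_add sd su) hd.
      apply: le_trans (IH l' r' d' u' (leq_trans lt hn) i1 i2 w') _.
      by rewrite ler_wpM2r ?w0// ler_wpM2l ?exprn_ge0// ler_expR ler_wpM2l.
    case: prog => [/andP[A0 hA']|/andP[B0 hB']|z0].
    * have s0 := stepsize_gt0 a.
      apply: fin; first by clear -A0 hA' s0 sl sr sd su; lia.
      have h1 : nsteps R m a' + 1 <= nsteps R m a.
        by apply: nsteps_add; rewrite /a'; clear -A0 hA'; rewrite /a in A0 hA' *; lia.
      have h2 : nsteps R m b' <= nsteps R m b.
        by apply: nsteps_homo; rewrite /b' /b ltnS leq_add.
      by lra.
    * have s0 := stepsize_gt0 b.
      apply: fin; first by clear -B0 hB' s0 sl sr sd su; lia.
      have h1 : nsteps R m b' + 1 <= nsteps R m b.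
        by apply: nsteps_add; rewrite /b'; clear -B0 hB'; rewrite /b in B0 hB' *; lia.
      have h2 : nsteps R m a' <= nsteps R m a.
        by apply: nsteps_homo; rewrite /a' /a ltnS leq_add.
      by lra.
    (* The history went back to the origin, where the trivial bound 1 suffices. *)
    * have -> : a' = 1%N by rewrite /a'; clear -z0; lia.
      have -> : b' = 1%N by rewrite /b'; clear -z0; lia.
      move=> w'; apply: (@le_trans _ _ 1).
        by apply: (E_le_cst p01) => w2; exact: indic_le1.
      rewrite /diag_weight minnn maxnn subnn expr0 mulr1 big_nat1 hitp1.
      rewrite mulrAC -exprMn mulVf ?gt_eqF// expr1n mul1r.
      rewrite -[leLHS]expR0 ler_expR mulr_ge0//.
      by have := nsteps_ge1 (ltn0Sn (l + r)); have := nsteps_ge1 (ltn0Sn (d + u)); rewrite -/a -/b; lra.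
  + move=> w'; rewrite ler_pdivlMr//.
    have ea : a = (a' + (l + r - (l' + r')))%N by rewrite /a /a'; clear -sl sr; lia.
    have eb : b = (b' + (d + u - (d' + u')))%N by rewrite /b /b'; clear -sd su; lia.
    have ux : uniq (irange l' r' ++ new_range l r l' r').
      by rewrite (perm_uniq (perm_new_range sl sr)) uniq_irange.
    have uy : uniq (irange d' u' ++ new_range d u d' u').
      by rewrite (perm_uniq (perm_new_range sd su)) uniq_irange.
    have sx : size (irange l' r' ++ new_range l r l' r') = a.
      by rewrite (perm_size (perm_new_range sl sr)) size_irange.
    have sy : size (irange d' u' ++ new_range d u d' u') = b.
      by rewrite (perm_size (perm_new_range sd su)) size_irange.
    rewrite ea eb; apply: strip_cost => //.
    * by rewrite -ea; clear -hA; lia.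
    * by rewrite -eb; clear -hB; lia.
    * by apply: (E_ge0 p01) => w2; exact: ler0n.
    * rewrite -ea -(size_new_range sd su) -sx.
      exact: strips_bound_rows.
    * rewrite -eb -(size_new_range sl sr) -sy.
      exact: strips_bound_cols.
    * rewrite -ea -eb -(size_new_range sd su) -(size_new_range sl sr).
      by apply: strips_bound => //; rewrite ?sx ?sy// hitp_gt0.
  + by apply: divr_ge0 => //; apply: mulr_ge0.
  + rewrite /M le_eqVlt; apply/orP; left; apply/eqP.
    have pn : p != 0 by rewrite gt_eqF.
    have wn : diag_weight p a' b' != 0 by rewrite gt_eqF.
    by field; rewrite pn wn.
rewrite /M.
have -> : kappa * (nsteps R m a + nsteps R m b - 1) =
  kappa * (nsteps R m a + nsteps R m b) - kappa by ring.
rewrite expRB mulrA ler_wpM2r ?w0//.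
set X := expR (kappa * _); have X0 : 0 <= X := expR_ge0 _.
have K0 : 0 < expR kappa := expR_gt0 _.
rewrite [leLHS](_ : _ = (((l.+1 * r.+1) * (d.+1 * u.+1))%:R * p^-1 / expR kappa) * (p^-1 ^+ 2 * X)); last first.
  by field; rewrite !gt_eqF.
rewrite ler_piMl ?mulr_ge0 ?exprn_ge0// ler_pdivrMr// mul1r.
apply: le_trans hk; rewrite ler_wpM2r// ler_nat.
rewrite (_ : (Lm ^ 4 = (Lm * Lm) * (Lm * Lm))%N); last by rewrite !expnS expn0 muln1 !mulnA.
by apply: leq_mul; apply: leq_mul; clear -hl hd; lia.
Qed.

End UpperInduction.

(** * The Basel sum *)

Section Basel.
Import numFieldNormedType.Exports.
Context {R : realType}.
Local Notation pi := (@pi R).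

Lemma sin_bounds (y : R) : 0 < y -> y < pi / 2 ->
  0 < sin y /\ (sin y <= y /\ y * cos y <= sin y).
Proof.
move=> y0 ypi.
have pi0 : 0 < pi := pi_gt0 R.
have cont : {within `[0, y], continuous (@sin R)}.
  by apply: continuous_subspaceT; exact: continuous_sin.
have [c cin e] := MVT y0 (fun x _ => is_derive_sin x) cont.
have /andP[c0 cy] : 0 < c < y by move: cin; rewrite in_itv.
rewrite sin0 !subr0 in e.
split; first by apply: sin_gt0_pihalf; rewrite y0.
rewrite e; split; first by rewrite ler_piMl ?cos_le1// ltW.
rewrite mulrC; apply: (ler_wpM2r (ltW y0)); apply: ltW.
by rewrite ltr_cos// in_itv /=; apply/andP; split; lra.
Qed.

Lemma csc2_half (x : R) : 0 < x -> x < pi / 2 ->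
  (sin x ^+ 2)^-1 = 4^-1 * ((sin (x / 2) ^+ 2)^-1 + (sin (pi / 2 - x / 2) ^+ 2)^-1).
Proof.
move=> x0 xpi; have pi0 : 0 < pi := pi_gt0 R.
have -> : sin (pi / 2 - x / 2) = cos (x / 2).
  by rewrite sinB sin_pihalf cos_pihalf mul0r subr0 mul1r.
have -> : sin x = 2 * (cos (x / 2) * sin (x / 2)).
  by rewrite mulr_natl -sin_mulr2n; congr sin; rewrite mulr2n; lra.
have s0 : 0 < sin (x / 2) by apply: sin_gt0_pihalf; lra.
have c0 : 0 < cos (x / 2) by apply: cos_gt0_pihalf; lra.
have := cos2Dsin2 (x / 2); set s := sin _ in s0 *; set c := cos _ in c0 *.
move=> e; rewrite -[X in _ = _ * X](_ : (c ^+ 2 + s ^+ 2) / (c ^+ 2 * s ^+ 2) = _); last first.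
  by field; rewrite !gt_eqF.
by rewrite e; field; rewrite !gt_eqF.
Qed.

Let ang (n k : nat) : R := (k.*2.+1)%:R * pi / (2 ^ n.+2)%:R.

Let ang_itv n k : (k < 2 ^ n)%N -> 0 < ang n k /\ ang n k < pi / 2.
Proof.
move=> kn; have pi0 : 0 < pi := pi_gt0 R.
have d0 : 0 < (2 ^ n.+2)%:R :> R by rewrite ltr0n expn_gt0.
split; first by rewrite divr_gt0 ?mulr_gt0// ltr0n.
rewrite ltr_pdivrMr// mulrC -mulrA ltr_pM2l// mulrC -ltr_pdivrMr// ?invr_gt0//.
rewrite invrK -natrM ltr_nat !expnS; lia.
Qed.

(* Iterating the half-angle formula from [1 / sin (pi / 4) ^ 2 = 2]; comparing each term
   with [1 / y ^ 2] then gives the sum over odd integers. *)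
Lemma csc2_sum n : \sum_(0 <= k < 2 ^ n) (sin (ang n k) ^+ 2)^-1 = 2 * (4 ^ n)%:R.
Proof.
elim: n => [|n IH].
  rewrite expn0 big_nat1 /ang /= mul1r expn0 mulr1.
  have pi0 : 0 < pi := pi_gt0 R.
  rewrite (_ : (2 ^ 2)%:R = 4 :> R)//.
  have := cos2Dsin2 (pi / 4).
  have -> : sin (pi / 4) = cos (pi / 4).
    rewrite -[in RHS](_ : pi / 2 - pi / 4 = pi / 4); last by lra.
    by rewrite cosB cos_pihalf sin_pihalf mul0r add0r mul1r.
  move=> e; have -> : cos (pi / 4) ^+ 2 = 2^-1 by lra.
  by rewrite invrK.
have h2 : (2 ^ n.+1 = 2 ^ n + 2 ^ n)%N by rewrite expnS mul2n addnn.
rewrite (@big_cat_nat _ _ _ (2 ^ n) 0 (2 ^ n.+1))//=; last by rewrite h2 leq_addr.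
(* The second half of the sum is read backwards: if [x] is the angle of index [k] at level [n], then
   [pi / 2 - x / 2] has index [2 ^ n.+1 - 1 - k] at level [n.+1]. *)
have shift (N : nat) (G : nat -> R) :
    \sum_(N <= k < N + N) G k = \sum_(0 <= k < N) G (N + N - k.+1)%N.
  rewrite big_nat_rev /= -{1}[N]add0n big_addn addnK big_nat [RHS]big_nat.
  by apply: eq_bigr => k kN; congr (G _); lia.
rewrite [X in _ + X](_ : _ = \sum_(0 <= k < 2 ^ n) (sin (ang n.+1 (2 ^ n + 2 ^ n - k.+1)) ^+ 2)^-1);
  last by rewrite h2 (shift _ (fun k => (sin (ang n.+1 k) ^+ 2)^-1)).
rewrite -big_split /=.
rewrite expnS natrM mulrCA -IH mulr_sumr big_nat [RHS]big_nat; apply: eq_bigr => k /andP[_ kn].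
have [a0 a1] := ang_itv kn.
rewrite (csc2_half a0 a1) mulrA divff// mul1r; congr (_^-1 + _^-1); congr (sin _ ^+ 2).
  by rewrite /ang (expnS 2 n.+2) natrM invfM; lra.
have d0 : 0 < (2 ^ n)%:R :> R by rewrite ltr0n expn_gt0.
rewrite /ang.
have -> : ((2 ^ n + 2 ^ n - k.+1).*2.+1)%:R = 4 * (2 ^ n)%:R - (k.*2.+1)%:R :> R.
  have -> : ((2 ^ n + 2 ^ n - k.+1).*2.+1 = 4 * 2 ^ n - k.*2.+1)%N by lia.
  by rewrite natrB ?natrM//; lia.
rewrite !expnS !natrM.
by field; rewrite gt_eqF.
Qed.

Definition odd_sum (N : nat) : R := \sum_(0 <= k < N) ((k.*2.+1)%:R ^+ 2)^-1.
Definition inv_sq_sum (N : nat) : R := \sum_(1 <= k < N.+1) (k%:R ^+ 2)^-1.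

(** From [y * cos y <= sin y <= y], the term [1 / y ^ 2] lies between [1 / sin y ^ 2 - 1] and
    [1 / sin y ^ 2]. An error of at most one per term is small against the total [2 * 4 ^ n]. *)
Lemma odd_sum_bounds n : pi ^+ 2 / 8 - pi ^+ 2 / 16 / (2 ^ n)%:R <= odd_sum (2 ^ n) /\
  odd_sum (2 ^ n) <= pi ^+ 2 / 8.
Proof.
have pi0 : 0 < pi := pi_gt0 R.
have d0 : 0 < (2 ^ n)%:R :> R by rewrite ltr0n expn_gt0.
have e k : (ang n k ^+ 2)^-1 = 16 * (2 ^ n)%:R ^+ 2 / pi ^+ 2 * ((k.*2.+1)%:R ^+ 2)^-1.
  have k0 : (k.*2.+1)%:R != 0 :> R by rewrite pnatr_eq0.
  rewrite /ang !expnS !natrM; move: (k.*2.+1)%:R k0 (pi) pi0 => x k0 P P0; field.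
  by rewrite k0 !gt_eqF.
have c0 : 0 < 16 * (2 ^ n)%:R ^+ 2 / pi ^+ 2 by rewrite divr_gt0 ?mulr_gt0 ?exprn_gt0.
have e4 : (4 ^ n)%:R = (2 ^ n)%:R ^+ 2 :> R.
  by rewrite (_ : 4 = 2 ^ 2)%N// -expnM mulnC expnM natrX.
have sums : 16 * (2 ^ n)%:R ^+ 2 / pi ^+ 2 * odd_sum (2 ^ n) =
   \sum_(0 <= k < 2 ^ n) (ang n k ^+ 2)^-1.
  by rewrite mulr_sumr; apply: eq_bigr => k _.
have up : \sum_(0 <= k < 2 ^ n) (ang n k ^+ 2)^-1 <= 2 * (2 ^ n)%:R ^+ 2.
  rewrite -e4 -csc2_sum big_nat [leRHS]big_nat; apply: ler_sum => k /andP[_ kn].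
  have [a0 a1] := ang_itv kn; have [s0 [s1 _]] := sin_bounds a0 a1.
  rewrite lef_pV2 ?posrE ?exprn_gt0//.
  by rewrite lerXn2r// ?nnegrE ltW.
have lo : 2 * (2 ^ n)%:R ^+ 2 - (2 ^ n)%:R <= \sum_(0 <= k < 2 ^ n) (ang n k ^+ 2)^-1.
  rewrite -e4 -csc2_sum.
  have -> : (2 ^ n)%:R = \sum_(0 <= k < 2 ^ n) 1 :> R.
    by rewrite sumr_const_nat subn0.
  rewrite -sumrB big_nat [leRHS]big_nat; apply: ler_sum => k /andP[_ kn].
  have [a0 a1] := ang_itv kn; have [s0 [_ s1]] := sin_bounds a0 a1.
  have c1 : 0 < cos (ang n k) by apply: cos_gt0_pihalf; lra.
  have -> : (sin (ang n k) ^+ 2)^-1 - 1 = (cos (ang n k) / sin (ang n k)) ^+ 2.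
    rewrite expr_div_n cos2sin2; field; by rewrite gt_eqF.
  have i0 : 0 <= (ang n k)^-1 by rewrite invr_ge0 ltW.
  have q0 : 0 <= cos (ang n k) / sin (ang n k) by rewrite divr_ge0// ltW.
  rewrite -exprVn lerXn2r ?nnegrE//.
  by rewrite ler_pdivrMr// mulrC ler_pdivlMr// mulrC.
rewrite -sums in up lo.
split; rewrite -(ler_pM2l c0).
  apply: le_trans lo; rewrite le_eqVlt; apply/orP; left; apply/eqP.
  by move: (pi) pi0 => P P0; field; rewrite !gt_eqF.
apply: (le_trans up); rewrite le_eqVlt; apply/orP; left; apply/eqP.
by move: (pi) pi0 => P P0; field; rewrite !gt_eqF.
Qed.

(** Odd and even denominators are separated. In the limit [S = pi ^ 2 / 8 + S / 4], whence
    [S = pi ^ 2 / 6]. *)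
Lemma inv_sq_sum_double N : inv_sq_sum (N + N) = odd_sum N + inv_sq_sum N / 4.
Proof.
elim: N => [|N IH]; first by rewrite /inv_sq_sum /odd_sum !big_geq// mul0r addr0.
have r k : inv_sq_sum k.+1 = inv_sq_sum k + (k.+1%:R ^+ 2)^-1.
  by rewrite /inv_sq_sum big_nat_recr.
have r' : odd_sum N.+1 = odd_sum N + (N.*2.+1%:R ^+ 2)^-1.
  by rewrite /odd_sum big_nat_recr.
rewrite addnS addSn !r r' IH addnn.
have h1 : (N.*2.+1)%:R != 0 :> R by rewrite pnatr_eq0.
have h2 : (N.+1)%:R != 0 :> R by rewrite pnatr_eq0.
have -> : (N.*2.+2)%:R = 2 * (N.+1)%:R :> R by rewrite -natrM; congr (_%:R); lia.
by move: (N.*2.+1)%:R (N.+1)%:R h1 h2 => x y h1 h2; field; rewrite h1 h2.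
Qed.

Lemma inv_sq_sum_homo M N : (M <= N)%N -> inv_sq_sum M <= inv_sq_sum N.
Proof.
move=> MN; rewrite /inv_sq_sum (@big_cat_nat _ _ _ M.+1 1 N.+1)//= lerDl.
by rewrite sumr_ge0// => i _; rewrite invr_ge0 exprn_ge0.
Qed.

Lemma inv_sq_sum_le M : inv_sq_sum M <= lambda2.
Proof.
have [n Mn] : exists n, (M <= 2 ^ n)%N by exists M; apply/ltnW/ltn_expl.
apply: le_trans (inv_sq_sum_homo Mn) _.
have h1 : inv_sq_sum (2 ^ n) <= inv_sq_sum (2 ^ n + 2 ^ n) by apply: inv_sq_sum_homo; lia.
have [_ h2] := odd_sum_bounds n; have h3 := inv_sq_sum_double (2 ^ n).
rewrite /lambda2; lra.
Qed.

(** The terms between [2 ^ n] and [2 ^ n.+1] add at most [1 / 2 ^ n], so the doubling identity can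
    be solved for the partial sum. The constant 4 is generous and uses only [pi <= 4]. *)
Lemma inv_sq_sum_ge n : lambda2 - 4 / (2 ^ n)%:R <= inv_sq_sum (2 ^ n).
Proof.
have d0 : 0 < (2 ^ n)%:R :> R by rewrite ltr0n expn_gt0.
have i0 : 0 < ((2 ^ n)%:R : R)^-1 by rewrite invr_gt0.
have h1 : inv_sq_sum (2 ^ n + 2 ^ n) <= inv_sq_sum (2 ^ n) + ((2 ^ n)%:R)^-1.
  rewrite {1}/inv_sq_sum (@big_cat_nat _ _ _ (2 ^ n).+1 1)//=; last by lia.
  rewrite lerD2l.
  apply: (@le_trans _ _ (\sum_((2 ^ n).+1 <= i < (2 ^ n + 2 ^ n).+1) ((2 ^ n)%:R ^+ 2)^-1)).
    rewrite big_nat [leRHS]big_nat; apply: ler_sum => k /andP[kn _].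
    have k0 : (0 < k)%N by apply: leq_ltn_trans kn.
    rewrite lef_pV2 ?posrE ?exprn_gt0 ?ltr0n ?expn_gt0//.
    by rewrite lerXn2r ?nnegrE// ler_nat ltnW.
  rewrite sumr_const_nat subSS addnK -[leLHS]mulr_natr.
  rewrite le_eqVlt; apply/orP; left; apply/eqP; field.
  by rewrite gt_eqF.
have [h2 _] := odd_sum_bounds n; have h3 := inv_sq_sum_double (2 ^ n).
have pi4 : pi <= 4 by have := pihalf_lt2 R; lra.
have pi0 : 0 < pi := pi_gt0 R.
have pi16 : pi ^+ 2 <= 16 by nra.
rewrite /lambda2; move: i0 h1 h2; set x := _^-1 => i0 h1 h2.
have h4 : pi ^+ 2 / 16 * x <= 1 * x by rewrite ler_wpM2r//; lra.
by lra.
Qed.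

End Basel.

(** * Products of hitting probabilities *)

Section Products.
Context {R : realType}.
Import numFieldNormedType.Exports.

(** Mean value theorem for [ln (1 - y) + S y], whose derivative is [- y ^ M / (1 - y)]; no infinite
    series is involved. *)
Lemma ln_1B_series (x : R) (M : nat) : 0 <= x -> x < 1 ->
  \sum_(1 <= n < M.+1) x ^+ n / n%:R <= - ln (1 - x) /\
  - ln (1 - x) <= \sum_(1 <= n < M.+1) x ^+ n / n%:R + x ^+ M * x / (1 - x).
Proof.
move=> x0 x1.
pose S (y : R) : R := \sum_(1 <= n < M.+1) y ^+ n / n%:R.
pose f (y : R) : R := ln (1 - y) + S y.
pose df (y : R) : R := - (y ^+ M / (1 - y)).
have dS (y : R) : is_derive y 1 S (\sum_(0 <= n < M) y ^+ n).
  rewrite /S; elim: (M) => [|N IH].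
    rewrite [X in is_derive _ _ X](_ : _ = cst 0); last first.
      by apply/funext => z; rewrite big_geq.
    by rewrite big_geq//; exact: is_derive_cst.
  rewrite [X in is_derive _ _ X](_ : _ =
     (fun y => \sum_(1 <= n < N.+1) y ^+ n / n%:R) + (fun y => N.+1%:R^-1 * y ^+ N.+1)).
    rewrite big_nat_recr//=; apply: is_deriveD.
    have -> : y ^+ N = N.+1%:R^-1 *: (N.+1%:R * y ^+ N).
      by rewrite -[RHS]/(_ * _) mulrA mulVf ?mul1r// pnatr_eq0.
    apply: is_deriveZ.
    have := is_deriveX N.+1 (is_derive_id y 1); rewrite exprfctE.
    by rewrite /GRing.scale /= mulr1.
  by apply/funext => z; rewrite big_nat_recr//= mulrC.
have dsum (y : R) : y < 1 -> \sum_(0 <= n < M) y ^+ n - (1 - y)^-1 = df y.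
  move=> y1; have y10 : 1 - y != 0 by rewrite subr_eq0 gt_eqF.
  have : (1 - y) * \sum_(0 <= n < M) y ^+ n = 1 - y ^+ M.
    elim: (M) => [|N IH]; first by rewrite big_geq// mulr0 expr0 subrr.
    by rewrite big_nat_recr//= mulrDr IH exprS; ring.
  move=> e; apply: (mulfI y10); rewrite mulrBr e /df; field.
  by rewrite subr_eq0 gt_eqF.
have dfP (y : R) : y < 1 -> is_derive y 1 f (df y).
  move=> y1; have y10 : 0 < 1 - y by rewrite subr_gt0.
  rewrite -dsum// addrC /f.
  apply: is_deriveD.
  have d1 : is_derive y 1 (fun z : R => 1 - z) (- 1).
    rewrite -[X in is_derive _ _ _ X]add0r.
    by apply: is_deriveB.
  have d2 := is_derive1_ln y10.
  have := @is_derive1_comp _ _ (fun z : R => 1 - z) _ _ _ d2 d1.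
  by rewrite mulrN1.
have cont : {within `[0, x], continuous f}.
  apply: derivable_within_continuous => y; rewrite in_itv /= => /andP[_ yx].
  by have [] := dfP y (le_lt_trans yx x1).
have dfI (y : R) : y \in `]0, x[%R -> is_derive y 1 f (df y).
  by rewrite in_itv /= => /andP[_ yx]; apply: dfP; exact: lt_trans x1.
have [c cin e] := MVT_segment x0 dfI cont.
have /andP[c0 cx] : 0 <= c <= x by move: cin; rewrite in_itv.
have f0 : f 0 = 0.
  rewrite /f subr0 ln1 add0r /S big_nat big1// => n /andP[n0 _].
  by rewrite expr0n; case: n n0 => //= n _; rewrite mul0r.
rewrite f0 !subr0 in e.
have c1 : 0 < 1 - c by lra.
have x10 : 0 < 1 - x by lra.
have low : 0 <= c ^+ M / (1 - c) * x by rewrite !mulr_ge0 ?exprn_ge0 ?invr_ge0// ltW.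
have up : c ^+ M / (1 - c) * x <= x ^+ M * x / (1 - x).
  rewrite mulrAC -!mulrA; apply: ler_pM.
  - exact: exprn_ge0.
  - by rewrite mulr_ge0 ?invr_ge0// ltW.
  - by rewrite lerXn2r ?nnegrE.
  - by rewrite ler_wpM2l// lef_pV2 ?posrE//; lra.
move: e; rewrite /f /df -/(S x) mulNr => e.
by split; lra.
Qed.

Lemma geom_sum (r : R) L : (1 - r) * \sum_(1 <= k < L.+1) r ^+ k = r * (1 - r ^+ L).
Proof.
elim: L => [|N IH]; first by rewrite big_geq// mulr0 expr0 subrr mulr0.
by rewrite big_nat_recr//= mulrDr IH exprS; ring.
Qed.

Variable p : R.
Hypotheses (p0 : 0 < p) (p1 : p < 1).
Let q0 : 0 < 1 - p. Proof. by rewrite subr_gt0. Qed.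
Let q0' : 0 <= 1 - p. Proof. exact: ltW. Qed.
Let q1 : 1 - p <= 1. Proof. by rewrite gerBl ltW. Qed.

Lemma prod_hitp_exp L : \prod_(1 <= k < L.+1) hitp p k =
  expR (- \sum_(1 <= k < L.+1) - ln (hitp p k)).
Proof.
rewrite -sumrN expR_sum big_nat [RHS]big_nat; apply: eq_bigr => k /andP[k0 _].
by rewrite opprK lnK// posrE hitp_gt0.
Qed.

(** With the logarithms expanded and the sums exchanged, the sum over [k] is geometric and at most
    [1 / (n * p)], so the total is at most [\sum_n 1 / (n ^ 2 * p)]. The extra 1 covers the
    truncation. *)
Lemma prod_hitp_ge L : expR (- (lambda2 / p) - 1) <= \prod_(1 <= k < L.+1) hitp p k.
Proof.
(* Each of the [L] remainders is at most [(1 - p) ^ M / p]; this [M] keeps their total below 1. *)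
have [M hM] : exists M : nat, L%:R / p ^+ 2 <= M%:R.
  exists (Num.bound (L%:R / p ^+ 2)).
  by apply/ltW/(le_lt_trans _ (archi_boundP _)); rewrite ?divr_ge0 ?exprn_ge0// ltW.
rewrite prod_hitp_exp ler_expR -opprD lerN2.
apply: (@le_trans _ _ (\sum_(1 <= k < L.+1) (\sum_(1 <= n < M.+1) (1 - p) ^+ (k * n) / n%:R
      + (1 - p) ^+ M / p))).
  rewrite big_nat [leRHS]big_nat; apply: ler_sum => k /andP[k0 _].
  have qk0 : 0 <= (1 - p) ^+ k by exact: exprn_ge0.
  have qkq : (1 - p) ^+ k <= 1 - p by apply: ler_iXnr.
  have qk1 : (1 - p) ^+ k < 1 by rewrite (le_lt_trans qkq)// gtrBl.
  have [_ h] := ln_1B_series M qk0 qk1.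
  apply: (le_trans h); apply: lerD.
    by apply: ler_sum => n _; rewrite exprM.
  rewrite -mulrA; apply: ler_pM.
  - exact: exprn_ge0.
  - by rewrite divr_ge0//; lra.
  - by rewrite lerXn2r ?nnegrE.
  - by rewrite ler_pdivrMr; [rewrite mulrC ler_pdivlMr//; nra|lra].
rewrite big_split /=; apply: lerD.
  rewrite exchange_big /=.
  apply: (@le_trans _ _ (inv_sq_sum M / p)); last first.
    by rewrite ler_wpM2r ?invr_ge0 ?(ltW p0)// inv_sq_sum_le.
  rewrite /inv_sq_sum mulr_suml big_nat [leRHS]big_nat; apply: ler_sum => n /andP[n0 _].
  rewrite -mulr_suml -invfM [_ ^+ 2]expr2 -mulrA invfM mulrC ler_wpM2l ?invr_ge0//.
  under eq_bigr do rewrite mulnC exprM.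
  have qn := expr_1B_le p0 p1 n.
  have np : 0 < n%:R * p by rewrite mulr_gt0// ltr0n.
  have r1 : (1 - p) ^+ n < 1.
    by apply: (le_lt_trans qn); rewrite invf_lt1; lra.
  have r0 : 0 <= (1 - p) ^+ n by exact: exprn_ge0.
  have [r er] : exists r : R, r = (1 - p) ^+ n by eexists.
  rewrite -?er in qn r1 r0 *.
  have rL : 0 <= r ^+ L by exact: exprn_ge0.
  have d0 : 0 < 1 + n%:R * p by rewrite addr_gt0.
  have h1 : r * (1 + n%:R * p) <= 1 by rewrite -ler_pdivlMr// mul1r.
  have := geom_sum r L; set T := \sum_(_ <= _ < _) _ => e.
  rewrite -[leRHS]mul1r ler_pdivlMr//.
  have h2 : 0 <= r * r ^+ L * (n%:R * p) by rewrite !mulr_ge0// ltW.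
  have : (1 - r) * T * (n%:R * p) <= 1 - r.
    by rewrite e; nra.
  by rewrite -mulrA -[X in _ <= X]mulr1 ler_pM2l// subr_gt0.
rewrite sumr_const_nat subn1 /= -mulr_natr -[leLHS]mulrA.
have qM := expr_1B_le p0 p1 M.
have d0 : 0 < 1 + M%:R * p by rewrite ltr_pwDl// mulr_ge0// ltW.
apply: (@le_trans _ _ ((1 + M%:R * p)^-1 * (p^-1 * L%:R))).
  by rewrite ler_wpM2r// mulr_ge0// invr_ge0 ltW.
rewrite mulrC ler_pdivrMr// mul1r mulrC ler_pdivrMr//.
have hM' : L%:R <= M%:R * p ^+ 2 by rewrite -ler_pdivrMr ?exprn_gt0.
by rewrite (le_trans hM')// mulrDl mul1r -mulrA -expr2 lerDr ltW.
Qed.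

Definition harmonic_sum (M : nat) : R := \sum_(1 <= n < M.+1) n%:R^-1.

Lemma harmonic_sum_le M : (0 < M)%N -> harmonic_sum M <= 1 + ln M%:R.
Proof.
case: M => // M _; elim: M => [|M IH].
  by rewrite /harmonic_sum big_nat1 invr1 ln1 addr0.
rewrite /harmonic_sum big_nat_recr//= -/(harmonic_sum M.+1).
have a0 : 0 < M.+1%:R :> R by rewrite ltr0n.
have b0 : 0 < M.+2%:R :> R by rewrite ltr0n.
have h : ln (1 + - (M.+2%:R)^-1) <= - (M.+2%:R)^-1 :> R.
  by apply: le_ln1Dx; rewrite ltrN2 invf_lt1// ltr1n.
have e : 1 + - (M.+2%:R)^-1 = M.+1%:R / M.+2%:R :> R.
  by rewrite -[M.+2%:R]natr1 -[in RHS]natr1; field; rewrite natr1 gt_eqF// natr1.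
rewrite e ln_div ?posrE// in h.
move: IH h; move: (ln M.+1%:R) (ln M.+2%:R) (M.+2%:R^-1) => x y z; lra.
Qed.

(** The same exchange of sums, now with the geometric sum bounded below by [1 / (n * p) - 2]; the
    losses [2 / n] add up to the harmonic sum. The 4 is the error of [inv_sq_sum_ge] divided by [p],
    and [hL] makes the cut at [L] negligible. *)
Lemma prod_hitp_le L j : (1 - p) ^+ L <= p -> 1 <= p * (2 ^ j)%:R ->
  \prod_(1 <= k < L.+1) hitp p k <=
  expR (- (lambda2 / p) + 4 + 2 * harmonic_sum (2 ^ j)).
Proof.
move=> hL hM; set M := (2 ^ j)%N in hM *.
rewrite prod_hitp_exp ler_expR.
suff : lambda2 / p - 4 - 2 * harmonic_sum M <= \sum_(1 <= k < L.+1) - ln (hitp p k) by lra.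
apply: (@le_trans _ _ (\sum_(1 <= k < L.+1) \sum_(1 <= n < M.+1) (1 - p) ^+ (k * n) / n%:R)); last first.
  rewrite big_nat [leRHS]big_nat; apply: ler_sum => k /andP[k0 _].
  have qk0 : 0 <= (1 - p) ^+ k by exact: exprn_ge0.
  have qkq : (1 - p) ^+ k <= 1 - p by apply: ler_iXnr.
  have qk1 : (1 - p) ^+ k < 1 by rewrite (le_lt_trans qkq)// gtrBl.
  have [h _] := ln_1B_series M qk0 qk1.
  by apply: le_trans h; apply: ler_sum => n _; rewrite exprM.
rewrite exchange_big /=.
apply: (@le_trans _ _ (inv_sq_sum M / p - 2 * harmonic_sum M)).
  rewrite lerD2r -[X in _ - X](mulfK (lt0r_neq0 p0)) -mulrBl ler_wpM2r ?invr_ge0 ?(ltW p0)//.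
  apply: le_trans (inv_sq_sum_ge j); rewrite -/M lerD2l lerN2 ler_wpM2l//.
  have M0 : 0 < M%:R :> R by rewrite ltr0n expn_gt0.
  by rewrite -[leLHS]mul1r ler_pdivrMr.
rewrite /inv_sq_sum /harmonic_sum mulr_suml mulr_sumr -sumrB.
rewrite [leLHS]big_nat [leRHS]big_nat.
apply: ler_sum => n /andP[n0 _].
rewrite -mulr_suml; under eq_bigr do rewrite mulnC exprM.
have nR : 1 <= n%:R :> R by rewrite ler1n.
have nR0 : 0 < n%:R :> R by rewrite ltr0n.
have qn : 1 - n%:R * p <= (1 - p) ^+ n by apply: bernoulli => //; exact: ltW.
have rL : ((1 - p) ^+ n) ^+ L <= p.
  rewrite -exprM mulnC exprM; apply: le_trans hL; apply: ler_iXnr => //.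
    exact: exprn_ge0.
  exact: exprn_ile1.
have rL0 : 0 <= ((1 - p) ^+ n) ^+ L by rewrite !exprn_ge0.
have r0 : 0 <= (1 - p) ^+ n by exact: exprn_ge0.
have r1 : (1 - p) ^+ n <= 1 by exact: exprn_ile1.
have := geom_sum ((1 - p) ^+ n) L.
have [r er] : exists r : R, r = (1 - p) ^+ n by eexists.
rewrite -?er in qn rL rL0 r0 r1 *.
set T := \sum_(_ <= _ < _) _ => e.
have T0 : 0 <= T by apply: sumr_ge0 => k _; exact: exprn_ge0.
have main : 1 <= n%:R * p * (T + 2).
  have h1 : (1 - r) * T <= n%:R * p * T by rewrite ler_wpM2r//; lra.
  have h2 : r * (1 - r ^+ L) >= 1 - n%:R * p - p by nra.
  have h3 : p <= n%:R * p by rewrite ler_peMl// ltW.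
  by nra.
rewrite [leLHS](_ : _ = (1 - 2 * (n%:R * p)) / (n%:R ^+ 2 * p)); last first.
  by field; rewrite !gt_eqF.
rewrite ler_pdivrMr ?mulr_gt0 ?exprn_gt0//.
rewrite [leRHS](_ : _ = n%:R * p * T); last by field; rewrite gt_eqF.
by lra.
Qed.

End Products.

(** * The law of the initial configuration *)

Definition depends_on (T : Type) (s : seq site) (B : config -> T) :=
  forall eta eta', (forall x, x \in s -> eta x = eta' x) -> B eta = B eta'.

Lemma depends_sub (T : Type) (s t : seq site) (B : config -> T) :
  {subset s <= t} -> depends_on s B -> depends_on t B.
Proof. by move=> st Bs eta eta' h; apply: Bs => x /st; exact: h. Qed.

(** Finite range: the state of a site at a fixed time reads finitely many initial states. This is
    what makes growth measurable. *)
Lemma iter_depends (step : config -> config) :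
  (forall x, exists s, depends_on s (fun eta => step eta x)) ->
  forall t x, exists s, depends_on s (fun eta => iter t step eta x).
Proof.
move=> loc; elim=> [|t IH] x.
  by exists [:: x] => eta eta' h; apply: h; rewrite inE.
have [s hs] := loc x.
have [u hu] : exists u, forall y, y \in s -> depends_on u (fun eta => iter t step eta y).
  elim: (s) => [|y r [u hu]]; first by exists [::].
  have [v hv] := IH y; exists (v ++ u) => z; rewrite inE => /predU1P[->|/hu hz].
    by apply: depends_sub hv => a; rewrite mem_cat => ->.
  by apply: depends_sub hz => a; rewrite mem_cat orbC => ->.
by exists u => eta eta' h /=; apply: hs => y /hu hy; exact: hy.
Qed.

Lemma step_modified_depends x : exists s, depends_on s (fun eta => step_modified eta x).
Proof.
exists (x :: nbrsinf x) => eta eta' h; rewrite /step_modified.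
have hc s : {subset s <= nbrsinf x} -> n_active eta s = n_active eta' s.
  by move=> sub; apply: eq_in_count => y /sub yn; rewrite h// inE yn orbT.
rewrite h ?mem_head// !hc// => y; rewrite /nbrsinf mem_cat => ->//.
Qed.

Lemma step_frobose_depends x : exists s, depends_on s (fun eta => step_frobose eta x).
Proof.
exists (x :: nbrs1 x) => eta eta' h; rewrite /step_frobose.
have hc : n_active eta (nbrs1 x) = n_active eta' (nbrs1 x).
  by apply: eq_in_count => y yn; rewrite h// inE yn orbT.
by rewrite h ?mem_head// hc.
Qed.

Section Law.
Context {R : realType} {d : measure_display} {T : measurableType d}.
Variables (P : probability T R) (p : R) (X : site -> T -> state).
Hypothesis law : has_law_Pp P p X.

Let mX x s : measurable [set w | X x w = s].
Proof. by case: law => h _; exact: h. Qed.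

(** Only the level sets of each [X x] are known to be measurable, so the event is split according to
    the three possible states, one site at a time. *)
Lemma measurable_config (s : seq site) (B : config -> Prop) :
  depends_on s B -> measurable [set w | B (fun z => X z w)].
Proof.
elim: s B => [|x s IH] B hB.
  have [h|h] := pselect (B (fun=> Defs.Empty)).
    rewrite (_ : [set _ | _] = setT)//; apply/seteqP; split => // w _ /=.
    by rewrite (hB _ (fun=> Defs.Empty)).
  rewrite (_ : [set _ | _] = set0)//; apply/seteqP; split => // w /=.
  by rewrite (hB _ (fun=> Defs.Empty)).
pose B' st (eta : config) := B (fun y => if y == x then st else eta y).
have hB' st : depends_on s (B' st).
  move=> eta eta' h; apply: hB => y; case: eqP => // yx.
  by rewrite inE => /predU1P[//|]; exact: h.
have BE w st : X x w = st -> B (fun z => X z w) = B' st (fun z => X z w).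
  by move=> e; rewrite /B'; congr B; apply/funext => y; case: eqP => // ->.
rewrite (_ : [set _ | _] = \big[setU/set0]_(st <- [:: Defs.Empty; Occ; Act])
   ([set w | X x w = st] `&` [set w | B' st (fun z => X z w)])).
  by apply: bigsetU_measurable => st _; apply: measurableI; [exact: mX|exact: IH].
rewrite !big_cons big_nil setU0; apply/seteqP; split => w /=.
  case e : (X x w); rewrite (BE _ _ e) => h; [by left|by right; left|by right; right].
by case=> [[e]|[[e]|[e]]]; rewrite -BE.
Qed.

Definition occ_at (w : T) : site -> bool := fun z => is_occ (X z w).

Lemma measurable_occ (s : seq site) (b : (site -> bool) -> Prop) :
  local_on s b -> measurable [set w | b (occ_at w)].
Proof.
move=> hb; apply: (@measurable_config s (fun eta => b (is_occ \o eta))).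
by move=> eta eta' h; apply: hb => y ys /=; rewrite h.
Qed.

Lemma measurable_growth step :
  (forall x, exists s, depends_on s (fun eta => step eta x)) ->
  measurable (growth_event step X).
Proof.
(* [dec] enumerates all sites; the origin is the default for numbers that code no site. *)
move=> loc; pose dec n : site := odflt origin (unpickle n).
rewrite (_ : growth_event step X = \bigcap_n \bigcup_t
  [set w | is_act (iter t step (fun z => X z w) (dec n))]).
  apply: bigcapT_measurable => n; apply: bigcup_measurable => t _.
  have [s hs] := iter_depends loc t (dec n).
  by apply: (@measurable_config s (fun eta => is_act (iter t step eta (dec n)))) => eta eta' /hs ->.
apply/seteqP; split => w; rewrite /growth_event /indefinite_growth /=.
  by move=> h n _; have [t ht] := h (dec n); exists t.
move=> h x; have [t _ ht] := h (pickle x) I.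
by exists t; move: ht; rewrite /= /dec pickleK.
Qed.

Lemma Act_null x : x != origin -> P [set w | X x w = Act] = 0%E.
Proof.
move=> xo; case: law => _ /(_ [:: x] (fun=> Act) isT).
rewrite big_seq1 /init_law (negbTE xo) => e; rewrite -[RHS]e; congr (P _).
by apply/seteqP; split => w /=; [move=> h y; rewrite inE => /eqP ->|apply; rewrite inE].
Qed.

Definition st_of (b : bool) : state := if b then Occ else Defs.Empty.

(** The law speaks only of prescribed states on finite lists. In the induction a site moves from
    [s], where [E] averages over it, to [s0], where its state is pinned by [f0]. *)
Lemma occ_law_pattern (s s0 : seq site) (f0 : site -> bool) (b : (site -> bool) -> bool) :
  uniq (s0 ++ s) -> origin \notin s0 ++ s -> local_on s b ->
  P ([set w | X origin w = Act /\ (forall x, x \in s0 -> X x w = st_of (f0 x))] `&`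
     [set w | b (occ_at w)]) =
  (p * (\prod_(x <- s0) (if f0 x then p else 1 - p)) *
   E p s (fun w => (b w)%:R) (fun=> false))%:E.
Proof.
elim: s s0 f0 b => [|x s IH] s0 f0 b.
  rewrite cats0 => us os hb.
  have cb w : b w = b (fun=> false) by apply: hb.
  have [bt|bf] := boolP (b (fun=> false)).
    rewrite /E /= bt mulr1; case: law => _.
    move=> /(_ (origin :: s0) (fun y => if y == origin then Act else st_of (f0 y))).
    rewrite /= os us => /(_ isT) e.
    transitivity (P [set w | forall y, y \in origin :: s0 ->
        X y w = if y == origin then Act else st_of (f0 y)]).
      congr (P _); apply/seteqP; split => w /=.
        move=> [[h1 h2] _] y; rewrite inE => /predU1P[->|ys]; first by rewrite eqxx.
        by rewrite ifN ?h2//; apply: contraNneq os => <-.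
      move=> h; rewrite cb bt; split => //; split; first by rewrite h ?mem_head ?eqxx.
      move=> y ys; rewrite h ?inE ?ys ?orbT// ifN//.
      by apply: contraNneq os => <-.
    rewrite e big_cons {1}/init_law !eqxx; congr (_ * _)%:E.
    rewrite big_seq [RHS]big_seq; apply: eq_bigr => y ys.
    have yo : y != origin by apply: contraNneq os => <-.
    by rewrite /init_law (negbTE yo); case: (f0 y).
  rewrite /E /= (negbTE bf) mulr0 (_ : _ `&` _ = set0) ?measure0//.
  by apply/seteqP; split => w //= -[_]; rewrite cb (negbTE bf).
move=> us os hb.
have xs0 : x \notin s0 by move: us; rewrite cat_uniq /= negb_or => /and3P[_ /andP[]].
have xo : x != origin by apply: contraNneq os => <-; rewrite mem_cat mem_head orbT.
pose bc c (w : site -> bool) := b (upd w x c).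
have hbc c : local_on s (bc c).
  move=> w w' h; apply: hb => y; rewrite inE /upd; case: eqP => //= _; exact: h.
have us' : uniq ((x :: s0) ++ s) by move: us; rewrite -cat1s uniq_catCA.
have os' : origin \notin (x :: s0) ++ s.
  by move: os; rewrite !mem_cat !inE /= !negb_or; case/andP => -> /andP[-> ->].
pose fc c y := if y == x then c else f0 y.
pose Z c := [set w | X origin w = Act /\ (forall y, y \in x :: s0 -> X y w = st_of (fc c y))] `&`
     [set w | bc c (occ_at w)].
(* The site [x] might also be active; that part is null since [x] is not the origin. *)
pose Z0 := [set w | X origin w = Act /\ (forall y, y \in s0 -> X y w = st_of (f0 y))] `&`
     [set w | b (occ_at w)] `&` [set w | X x w = Act].
have mpat (g : site -> bool) (r : seq site) : measurable [set w | X origin w = Act /\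
    (forall y, y \in r -> X y w = st_of (g y))].
  apply: (@measurable_config (origin :: r) (fun eta => eta origin = Act /\
    (forall y, y \in r -> eta y = st_of (g y)))) => eta eta' h.
  apply/propext; split=> -[h1 h2]; split; rewrite -?h ?mem_head// ?h ?mem_head//;
    by move=> y yr; have := h2 y yr; rewrite h// inE yr orbT.
have mZ c : measurable (Z c).
  apply: measurableI; first exact: mpat.
  by apply: (@measurable_occ s (fun v => bc c v)) => w w' h; rewrite (hbc _ _ _ h).
have mZ0 : measurable Z0.
  apply: measurableI; last exact: mX.
  apply: measurableI; first exact: mpat.
  by apply: (@measurable_occ (x :: s) (fun v => b v)) => w w' h; rewrite (hb _ _ h).
have PZ0 : P Z0 = 0%E.
  apply/eqP; rewrite eq_le measure_ge0 andbT -(Act_null xo).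
  by apply: le_measure; rewrite ?inE//; move=> w [].
have updE w c : X x w = st_of c -> upd (occ_at w) x c = occ_at w.
  move=> e; apply/funext => y; rewrite /upd; case: eqP => // ->.
  by rewrite /occ_at e; case: c {e}.
have split3 : [set w | X origin w = Act /\ (forall y, y \in s0 -> X y w = st_of (f0 y))] `&`
     [set w | b (occ_at w)] = Z true `|` (Z false `|` Z0).
  apply/seteqP; split => w /=.
    move=> [[h1 h2] h3].
    have sub c : X x w = st_of c -> Z c w.
      move=> e; split => /=; last by rewrite /bc updE.
      split => // y; rewrite inE /fc; case: eqP => [-> //|_ /= ys0]; exact: h2.
    case e : (X x w); [right; left|left|right; right] => //; exact: sub.
  have sub c : Z c w -> (X origin w = Act /\
     (forall y, y \in s0 -> X y w = st_of (f0 y))) /\ b (occ_at w).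
    move=> [[h1 h2] h3]; have e := h2 x (mem_head _ _).
    rewrite /fc eqxx in e; split; last by rewrite -(updE _ _ e).
    split => // y ys; rewrite h2 ?inE ?ys ?orbT// /fc ifN//.
    by apply: contraNneq xs0 => <-.
  by case=> [/sub//|[/sub//|[]]].
have disj (c c' : bool) : c != c' -> Z c `&` Z c' = set0.
  move=> cc; apply/seteqP; split => // w [[[_ h] _] [[_ h'] _]].
  move: (h x (mem_head _ _)); rewrite (h' x (mem_head _ _)) /fc eqxx.
  by case: c cc {h h'}; case: c'.
have disj0 c : Z c `&` Z0 = set0.
  apply/seteqP; split => // w [[[_ h] _] [_ /= e]].
  by move: (h x (mem_head _ _)); rewrite e /fc eqxx; case: c {h}.
have U1 : P (Z false `|` Z0) = (P (Z false) + P Z0)%E :=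
  measureU P (mZ false) mZ0 (disj0 false).
have dU : Z true `&` (Z false `|` Z0) = set0 by rewrite setIUr disj// disj0 setU0.
have U2 : P (Z true `|` (Z false `|` Z0)) = (P (Z true) + P (Z false `|` Z0))%E :=
  measureU P (mZ true) (measurableU _ _ (mZ false) mZ0) dU.
rewrite split3 U2 U1 PZ0 adde0.
rewrite !(IH (x :: s0) _ (bc _))// -EFinD; congr (_%:E).
rewrite !big_cons /fc !eqxx.
have prod_eq c : \prod_(j <- s0) (if if j == x then c else f0 j then p else 1 - p) =
   \prod_(j <- s0) (if f0 j then p else 1 - p).
  rewrite big_seq [RHS]big_seq; apply: eq_bigr => y ys.
  have yx : y != x by apply: contraNneq xs0 => <-.
  by rewrite (negbTE yx).
rewrite !prod_eq.
have -> : E p (x :: s) (fun w => (b w)%:R) = fun w0 =>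
   p * E p s (fun w => (bc true w)%:R) w0 + (1 - p) * E p s (fun w => (bc false w)%:R) w0.
  rewrite -[LHS]/(resample1 p x (E p s (fun w => (b w)%:R))) -E_resample1 /resample1.
  rewrite ED (@E_mulr _ p s _ (fun=> p))//.
  by rewrite (@E_mulr _ p s _ (fun=> 1 - p)).
by ring.
Qed.

Lemma occ_law (s : seq site) (b : (site -> bool) -> bool) :
  uniq s -> origin \notin s -> local_on s b ->
  P ([set w | X origin w = Act] `&` [set w | b (occ_at w)]) =
  (p * E p s (fun w => (b w)%:R) (fun=> false))%:E.
Proof.
move=> us os hb; have := @occ_law_pattern s [::] (fun=> false) b us os hb.
rewrite big_nil mulr1 => <-; congr (P (_ `&` _)).
by apply/seteqP; split => w /= => [h|[]//]; split.
Qed.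

Lemma no_act_no_growth (eta : config) : (forall x, ~~ is_act (eta x)) ->
  ~ indefinite_growth step_modified eta.
Proof.
move=> h grow; have [t] := grow origin.
suff -> : iter t step_modified eta = eta by rewrite (negbTE (h _)).
elim: t => //= t ->; apply/funext => x; rewrite /step_modified /n_active.
have c s : count (fun y => is_act (eta y)) s = 0%N.
  by apply/eqP; rewrite -leqn0 leqNgt -has_count; apply/hasPn => y _; exact: h.
by rewrite !c; case: (eta x).
Qed.

(** The deterministic implication fails only where some site other than the origin starts active, a
    countable union of null events; with no active site at all there is no growth. *)
Lemma growth_le (s : seq site) (b : (site -> bool) -> bool) :
  uniq s -> origin \notin s -> local_on s b ->
  (forall eta : config, is_act (eta origin) ->
     (forall x, x != origin -> ~~ is_act (eta x)) ->
     indefinite_growth step_modified eta -> b (fun z => is_occ (eta z))) ->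
  (P (growth_event step_modified X) <= (p * E p s (fun w => (b w)%:R) (fun=> false))%:E)%E.
Proof.
move=> us os hb hgrow; rewrite -(occ_law us os hb).
pose dec n : site := odflt origin (unpickle n).
pose N n := [set w | dec n != origin /\ X (dec n) w = Act].
have NN : P.-negligible (\bigcup_n N n).
  apply: negligible_bigcup => n; have [e|e] := eqVneq (dec n) origin.
    rewrite (_ : N n = set0); first exact: negligible_set0.
    by apply/seteqP; split => w // []; rewrite e eqxx.
  exists [set w | X (dec n) w = Act].
  by split; [exact: mX|exact: Act_null|move=> w []].
case: NN => N' [mN' N'0 subN'].
have mA : measurable ([set w | X origin w = Act] `&` [set w | b (occ_at w)]).
  apply: measurableI; first exact: mX.
  by apply: (@measurable_occ s (fun v => b v)) => w w' h; rewrite (hb _ _ h).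
apply: (@le_trans _ _ (P (([set w | X origin w = Act] `&` [set w | b (occ_at w)]) `|` N'))).
  apply: le_measure; rewrite ?inE; [apply: measurable_growth; exact: step_modified_depends|exact: measurableU|].
  move=> w gw; have [h|h] := pselect ((\bigcup_n N n) w); first by right; exact: subN'.
  have na x : x != origin -> ~~ is_act (X x w).
    move=> xo; apply: contra_notN h => ax; exists (pickle x) => //.
    by rewrite /N /dec /= pickleK; split => //; case: (X x w) ax.
  have ao : X origin w = Act.
    case o : (X origin w) => //; exfalso; apply: (no_act_no_growth _ gw) => x;
      by have [->|/na//] := eqVneq x origin; rewrite o.
  left; split => //=; apply: (hgrow _ _ na gw); by rewrite ao.
apply: le_trans (measureU2 _ mA mN') _.
by rewrite [X in (_ + X)%E](_ : _ = 0%E) ?adde0.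
Qed.

(** Serves to bound [P G] from below: [A] forces [G] unless one of the countably many failures [F j]
    occurs. *)
Lemma union_bound (A G : set T) (F : nat -> set T) (y : R) :
  measurable A -> measurable G -> (forall j, measurable (F j)) ->
  A `<=` G `|` \bigcup_j F j ->
  (forall n, (\sum_(0 <= j < n) P (F j) <= y%:E)%E) ->
  (P A <= P G + y%:E)%E.
Proof.
move=> mA mG mF sub hy.
have mU : measurable (\bigcup_j F j) by apply: bigcup_measurable.
apply: (@le_trans _ _ (P (G `|` \bigcup_j F j))).
  by apply: le_measure; rewrite ?inE//; exact: measurableU.
apply: le_trans (measureU2 _ mG mU) _; rewrite leeD2l//.
have h : (P (\bigcup_j F j) <= \sum_(0 <= j <oo) P (F j))%E.
  exact: measure_sigma_subadditive.
apply: (le_trans h).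
apply: lime_le; first exact: is_cvg_nneseries.
by near=> n; exact: hy.
Unshelve. all: by end_near.
Qed.

End Law.

(** Comparing active sites alone is not inductive, because empty and occupied sites obey different
    rules; hence the stronger alternative of equal states. *)
Lemma frobose_le_modified (eta : config) t x :
  iter t step_modified eta x = Act \/
  iter t step_modified eta x = iter t step_frobose eta x.
Proof.
elim: t x => [|t IH] x /=; first by right.
set em := iter t step_modified eta in IH *; set ef := iter t step_frobose eta in IH *.
have act y : is_act (ef y) -> is_act (em y) by case: (IH y) => [->//|->].
have cnt s : (n_active ef s <= n_active em s)%N.
  by apply: sub_count => y; exact: act.
rewrite {1 2}/step_modified.
case: (IH x) => [->|e]; first by left.
have := cnt (nbrs1 x); have c2 := cnt (nbrsinf x).
have c3 : (n_active em (nbrs1 x) <= n_active em (nbrsinf x))%N.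
  by rewrite /n_active /nbrsinf count_cat leq_addr.
rewrite /step_frobose e; case: (ef x) => c1; last by left.
  case: ifP => h; first by left.
  by right; rewrite ifF//; apply/negbTE; rewrite -ltnNge; move/negbT: h; rewrite -ltnNge; lia.
case: ifP => h; first by left.
by right; rewrite ifF//; apply/negbTE; rewrite -ltnNge; move/negbT: h; rewrite -ltnNge; lia.
Qed.

Lemma growth_frobose_modified (T : Type) (X : site -> T -> state) :
  growth_event step_frobose X `<=` growth_event step_modified X.
Proof.
move=> w h x; have [t ht] := h x; exists t.
by case: (frobose_le_modified (fun z => X z w) t x) => ->.
Qed.

(** * The upper bound *)

(** Links the boxes, which contain the origin, to [occ_law], whose list excludes it. *)
Lemma E_skip_origin (R : realType) (p : R) (s : seq site) (f : (site -> bool) -> R) :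
  indep_of [:: origin] f -> E p [seq z <- s | z != origin] f = E p s f.
Proof.
move=> ro; have [os|os] := boolP (origin \in s); last first.
  rewrite (_ : [seq z <- s | _] = s)//; apply/all_filterP/allP => z zs.
  by apply: contraNneq os => <-.
rewrite -{1}(E_id p ro) -E_cat; apply: eq_mem_E => z.
rewrite (mem_cat z [seq z <- s | z != origin]) mem_filter mem_seq1.
by have [->|] := eqVneq z origin; rewrite /= ?orbF ?os.
Qed.

Section UpperBound.
Context {R : realType}.

(** Termwise, [1 / stepsize m k] is at most [4 * m / minn k (m ^ 2)], and the reciprocal of a
    minimum is at most the sum of the reciprocals. *)
Lemma nsteps_le (m L : nat) : (0 < m)%N ->
  nsteps R m L <= 4 * m%:R * (harmonic_sum L + L%:R / (m ^ 2)%:R).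
Proof.
move=> m0; have mR : 0 < m%:R :> R by rewrite ltr0n.
have m2R : 0 < (m ^ 2)%:R :> R by rewrite ltr0n expn_gt0 m0.
have -> : L%:R / (m ^ 2)%:R = \sum_(1 <= k < L.+1) (m ^ 2)%:R^-1 :> R.
  by rewrite sumr_const_nat subn1 /= mulrC mulr_natr.
rewrite /nsteps /harmonic_sum -big_split /= mulr_sumr.
rewrite [leLHS]big_nat [leRHS]big_nat; apply: ler_sum => k /andP[k0 _].
have kR : 0 < k%:R :> R by rewrite ltr0n.
have sR : 0 < (stepsize m k)%:R :> R by rewrite ltr0n stepsize_gt0.
have h : (minn k (m ^ 2) <= 4 * m * stepsize m k)%N.
  have m20 : (0 < 2 * m)%N by lia.
  have := ltn_ceil (minn k (m ^ 2)) m20.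
  have : (minn k (m ^ 2) %/ (2 * m) <= stepsize m k)%N by rewrite leq_maxr.
  have := stepsize_gt0 m k; nia.
have hR : (minn k (m ^ 2))%:R <= 4 * m%:R * (stepsize m k)%:R :> R.
  by rewrite -!natrM ler_nat.
have min0 : 0 < (minn k (m ^ 2))%:R :> R by rewrite ltr0n leq_min k0 expn_gt0 m0.
apply: (@le_trans _ _ (4 * m%:R * ((minn k (m ^ 2))%:R)^-1)).
  by rewrite ler_pdivlMr// mulrC ler_pdivrMr.
rewrite ler_wpM2l ?mulr_ge0//.
rewrite /minn; case: ifP => _; first by rewrite lerDl invr_ge0 ltW.
by rewrite lerDr invr_ge0 ltW.
Qed.

(** Completing the rectangle to a square of side [n] takes at most [n] lines of [n] sites, all hit
    with probability at least [1 - n * (1 - p) ^ n >= 1/2]. *)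
Lemma diag_weight_le (p : R) (a b n : nat) : 0 < p -> p < 1 ->
  (0 < a)%N -> (0 < b)%N -> maxn a b = n ->
  (1 - p) ^+ n * n%:R <= 2^-1 ->
  diag_weight p a b <= 2 * (\prod_(1 <= k < n.+1) hitp p k) ^+ 2.
Proof.
move=> p0 p1 a0 b0 hn small.
wlog ab : a b a0 b0 hn / (a <= b)%N.
  move=> H; have [ab|ba] := leqP a b; first exact: H.
  by rewrite diag_weightC; apply: H => //; [rewrite maxnC|exact: ltnW].
have en : n = b by rewrite -hn; apply/maxn_idPr.
have := diag_weight_cols p0 p1 (b - a) a0 b0; rewrite subnKC// -en.
have -> : diag_weight p n n = (\prod_(1 <= k < n.+1) hitp p k) ^+ 2.
  by rewrite /diag_weight minnn maxnn subnn expr0 mulr1.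
set D := diag_weight p a n => h.
have q0 : 0 <= 1 - p by rewrite subr_ge0 ltW.
have q1 : 1 - p <= 1 by rewrite gerBl ltW.
have half : 2^-1 <= hitp p n ^+ (n - a).
  apply: (@le_trans _ _ (hitp p n ^+ n)); last first.
    by apply: ler_wiXn2l; rewrite ?hitp_ge0 ?hitp_le1// leq_subr.
  apply: le_trans (bernoulli n _ _); rewrite ?exprn_ge0 ?exprn_ile1//.
  by rewrite mulrC; move: small; lra.
have D0 : 0 <= D by apply: diag_weight_ge0.
have : D * 2^-1 <= D * hitp p n ^+ (n - a) by rewrite ler_wpM2l.
lra.
Qed.

Definition spanned_max (n : nat) : seq (nat * nat * (nat * nat)) :=
  [seq t <- [seq (a, b) | a <- [seq (i, j) | i <- iota 0 n.+1, j <- iota 0 n.+1],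
                b <- [seq (i, j) | i <- iota 0 n.+1, j <- iota 0 n.+1]] |
   maxn (t.1.1 + t.1.2) (t.2.1 + t.2.2) == n].

Definition reach_max (n : nat) (w : site -> bool) : bool :=
  has (fun t => `[< reach w t.1.1 t.1.2 t.2.1 t.2.2 >]) (spanned_max n).

Lemma mem_spanned_max n t : t \in spanned_max n ->
  [/\ (t.1.1 + t.1.2 <= n)%N, (t.2.1 + t.2.2 <= n)%N &
     maxn (t.1.1 + t.1.2) (t.2.1 + t.2.2) = n].
Proof. by rewrite mem_filter => /andP[/eqP h _]; split => //; rewrite -h ?leq_maxl ?leq_maxr. Qed.

Lemma in_rect_sum l r d u n z : (l + r <= n)%N -> (d + u <= n)%N ->
  in_rect l r d u z -> in_rect n n n n z.
Proof. by rewrite /in_rect; lia. Qed.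

Lemma size_spanned_max n : (size (spanned_max n) <= n.+1 ^ 4)%N.
Proof.
rewrite size_filter (leq_trans (count_size _ _))// !size_allpairs !size_iota.
by rewrite !expnS expn0 muln1 !mulnA.
Qed.

Lemma reach_max_growth n (eta : config) :
  is_act (eta origin) -> (forall x, x != origin -> ~~ is_act (eta x)) ->
  indefinite_growth step_modified eta -> reach_max n (fun z => is_occ (eta z)).
Proof.
move=> o0 act0 grow.
have [l [r [d [u [rR hm]]]]] := growth_reach o0 act0 grow n.
apply/hasP; exists ((l, r), (d, u)); last exact/asboolP.
rewrite mem_filter; apply/andP; split; first by rewrite /= hm.
by apply/allpairsP; exists ((l, r), (d, u)); split => //; apply/allpairsP;
  [exists (l, r)|exists (d, u)]; split => //; rewrite mem_iota /=; clear -hm; lia.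
Qed.

Lemma growth_modified_le (p : R) (m n : nat) (kappa : R) :
  0 < p -> p < 1 -> (0 < m)%N -> (m ^ 2)%:R * p <= 1 -> 1 <= 4 * (m ^ 2)%:R * p ->
  2 * expR 4 * p <= 1 -> 0 <= kappa -> (n.+1 ^ 4)%:R * p^-1 <= expR kappa ->
  (1 - p) ^+ n.+1 * n.+1%:R <= 2^-1 ->
  forall (d : measure_display) (T : measurableType d)
    (P : probability T R) (X : site -> T -> state), has_law_Pp P p X ->
  (P (growth_event step_modified X) <=
    ((n.+1 ^ 4)%:R * (p^-1 ^+ 2 * expR (kappa * (2 * nsteps R m n.+1)) *
      (2 * (\prod_(1 <= k < n.+2) hitp p k) ^+ 2)))%:E)%E.
Proof.
move=> p0 p1 m0 mp pm ps k0 hk small d T P X law.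
have p01 : 0 <= p <= 1 by rewrite !ltW.
set M := p^-1 ^+ 2 * _ * _.
have M0 : 0 <= M.
  by rewrite !mulr_ge0 ?exprn_ge0 ?expR_ge0 ?invr_ge0 ?(ltW p0)// prodr_ge0// => k _; exact: hitp_ge0.
pose s := [seq z <- rect_sites n n n n | z != origin].
have us : uniq s by rewrite filter_uniq// uniq_box// uniq_irange.
have os : origin \notin s by rewrite mem_filter eqxx.
have loc t : t \in spanned_max n -> local_on s (fun w => `[< reach w t.1.1 t.1.2 t.2.1 t.2.2 >]).
  move=> /mem_spanned_max [h1 h2 _] w w' ww'.
  have sub z : z != origin -> in_rect t.1.1 t.1.2 t.2.1 t.2.2 z -> w z = w' z.
    move=> zo zin; apply: ww'; rewrite mem_filter zo mem_rect_sites.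
    exact: in_rect_sum zin.
  by apply: asbool_equiv_eq; split; apply: reach_local => z zo zin; rewrite sub.
have lb : local_on s (reach_max n).
  by move=> w w' ww'; apply: eq_in_has => t /loc ht; exact: ht.
have H := growth_le law us os lb (@reach_max_growth n).
apply: (le_trans H).
rewrite lee_fin.
(* The probability [p] of an active origin is given away. *)
apply: (@le_trans _ _ (E p s (fun w => (reach_max n w)%:R) (fun=> false))).
  by rewrite ler_piMl ?(E_ge0 p01)// ltW.
apply: (@le_trans _ _ (E p s (fun w => \sum_(t <- spanned_max n)
   indic R (reach w t.1.1 t.1.2 t.2.1 t.2.2)) (fun=> false))).
  apply: (E_le p01) => w; rewrite /reach_max.
  elim: (spanned_max n) => [|t r IH]; rewrite ?big_nil// big_cons /=.
  rewrite /indic; case: asboolP => _ /=; last by rewrite add0r.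
  by rewrite lerDl sumr_ge0.
rewrite E_sum.
apply: (@le_trans _ _ (\sum_(t <- spanned_max n) M)); last first.
  apply: (@le_trans _ _ ((size (spanned_max n))%:R * M)).
    by rewrite -sum1_size natr_sum mulr_suml; under [leRHS]eq_bigr do rewrite mul1r.
  by rewrite ler_wpM2r// ler_nat size_spanned_max.
rewrite big_seq [leRHS]big_seq; apply: ler_sum => t tin.
have [h1 h2 h3] := mem_spanned_max tin.
set f := fun w => indic R (reach w _ _ _ _).
have ro : indep_of [:: origin] f.
  apply: (@local_indep _ s); last by move=> x; rewrite inE => /eqP ->.
  by move=> w w' ww'; rewrite /f /indic (loc t tin w w' ww').
have sub : {subset rect_sites t.1.1 t.1.2 t.2.1 t.2.2 <= rect_sites n n n n}.
  by move=> z; rewrite !mem_rect_sites; exact: in_rect_sum.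
rewrite (E_skip_origin _ _ ro) -(E_absorb p f sub) EC.
apply: (E_le_cst p01) => w.
have n1 : (t.1.1 + t.1.2 < n.+1)%N by rewrite ltnS.
have n2 : (t.2.1 + t.2.2 < n.+1)%N by rewrite ltnS.
apply: le_trans (@reach_bound R p m p0 p1 m0 mp pm ps kappa n.+1 k0 hk _ _ _ _ n1 n2 w) _.
have ip0 : 0 <= p^-1 by rewrite invr_ge0 ltW.
apply: ler_pM.
- by rewrite mulr_ge0 ?exprn_ge0 ?expR_ge0.
- exact: diag_weight_ge0.
- rewrite ler_wpM2l ?exprn_ge0// ler_expR ler_wpM2l//.
  have e1 := @nsteps_homo R m _ _ n1; have e2 := @nsteps_homo R m _ _ n2; lra.
- by apply: diag_weight_le => //; rewrite maxnSS h3.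
Qed.

End UpperBound.

(** * Parameters of the upper bound *)

Section UpperAsymptotics.
Context {R : realType}.
Variable p : R.
Hypotheses (p0 : 0 < p) (psmall : 512 * expR 4 * p <= 1).

Local Notation r := (Num.sqrt p).
Local Notation ell := (ln p^-1).

Let e4 : 1 <= expR 4 :> R. Proof. by rewrite -expR0 ler_expR. Qed.
Let p512 : 512 * p <= 1.
Proof. by apply: le_trans psmall; rewrite ler_wpM2r ?(ltW p0)//; have := e4; lra. Qed.
Let p1 : p < 1. Proof. by have := p512; have := p0; lra. Qed.
Let ip0 : 0 < p^-1. Proof. by rewrite invr_gt0. Qed.
Let r0 : 0 < r. Proof. by rewrite sqrtr_gt0. Qed.
Let rr : r * r = p. Proof. by rewrite -expr2 sqr_sqrtr// ltW. Qed.
Let r12 : 12 * r <= 1.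
Proof.
have h := rr; have h0 := r0; have h5 := p512; rewrite leNgt; apply/negP => h1.
by nra.
Qed.

Lemma expR_ell : expR ell = p^-1. Proof. by rewrite lnK// posrE. Qed.

Lemma ell_ge4 : 4 <= ell.
Proof.
rewrite -[leLHS]expRK ler_ln ?posrE ?expR_gt0//.
rewrite -[leRHS]mul1r ler_pdivlMr//; apply: le_trans psmall.
by rewrite ler_wpM2r ?(ltW p0)//; have := e4; lra.
Qed.

Lemma ell_le : ell * p <= 2 * r.
Proof.
have ir0 : 0 < r^-1 by rewrite invr_gt0.
have h := ltW (ln_sublinear ir0).
have e : ell = 2 * ln r^-1.
  have -> : p^-1 = r^-1 ^+ 2 by rewrite exprVn expr2 rr.
  by rewrite lnXn// mulr2n; lra.
rewrite e -{2}rr.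
have : ln r^-1 * r <= 1 by rewrite -ler_pdivlMr// mul1r.
by have := r0; nra.
Qed.

Lemma upper_parameters_step :
  exists m : nat, [/\ (0 < m)%N, (m ^ 2)%:R * p <= 1, 1 <= 4 * (m ^ 2)%:R * p & m%:R * r <= 1].
Proof.
have ir0 : 0 <= r^-1 by rewrite invr_ge0 ltW.
pose m := Num.truncn r^-1; exists m.
have /andP[h1 h2] := truncn_itv ir0; rewrite -/m in h1 h2.
have mr : m%:R * r <= 1 by rewrite -ler_pdivlMr// mul1r.
have mr' : 1 < (m%:R + 1) * r by rewrite -ltr_pdivrMr// mul1r natr1.
have m0 : (0 < m)%N.
  rewrite lt0n; apply/eqP => m0; rewrite m0 add0r mul1r in mr'.
  by have := r12; lra.
have mR : 1 <= m%:R :> R by rewrite ler1n.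
have h0 := r0; have hr : m%:R * m%:R * p = (m%:R * r) * (m%:R * r) by rewrite mulrACA rr.
have rm : r <= m%:R * r by rewrite ler_peMl// ltW.
have x0 : 0 <= m%:R * r by rewrite mulr_ge0// ltW.
have x1 : 1 <= 2 * (m%:R * r) by rewrite mulrDl mul1r in mr'; lra.
split => //; rewrite natrX expr2.
  by rewrite hr mulr_ile1.
rewrite -mulrA hr; move: x0 x1; move: (m%:R * r) => x x0 x1; nra.
Qed.

(** The final side is about [2 * ell / p]: long enough for [diag_weight_le] and for the truncation
    in [prod_hitp_le], yet polynomial in [1/p], so that choosing a rectangle costs only a multiple
    of [ell] in the exponent. *)
Lemma upper_parameters_size :
  exists n : nat, n.+1%:R * p <= 3 * ell /\ (1 - p) ^+ n.+1 <= p ^+ 2.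
Proof.
have l4 := ell_ge4.
have x0 : 0 <= 2 * ell / p by rewrite divr_ge0 ?(ltW p0)//; lra.
exists (Num.truncn (2 * ell / p)); have /andP[h1 h2] := truncn_itv x0.
move: h1 h2; set n := Num.truncn _ => h1 h2.
rewrite ler_pdivlMr// in h1; rewrite ltr_pdivrMr// in h2.
split; first by rewrite -natr1; have := p1; lra.
have -> : p ^+ 2 = expR (- (2 * ell)).
  by rewrite expRN mulrC mulr_natr mulr2n expRD expR_ell -invfM invrK expr2.
apply: (@le_trans _ _ (expR (- p) ^+ n.+1)).
  rewrite lerXn2r ?nnegrE ?expR_ge0//; first by rewrite subr_ge0 ltW.
  exact: expR_ge1Dx.
by rewrite -expRM_natl ler_expR; lra.
Qed.

(** A power of two is needed because [inv_sq_sum_ge] is available only there. *)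
Lemma dyadic_approx :
  exists j : nat, 1 <= p * (2 ^ j)%:R /\ harmonic_sum (2 ^ j) <= 1 + 2 * ell.
Proof.
pose K := (Num.truncn p^-1).+1.
have /andP[h1 h2] := truncn_itv (ltW ip0).
have [h3 h4] : (2 ^ trunc_log 2 K <= K)%N /\ (K < 2 ^ (trunc_log 2 K).+1)%N.
  by have /andP[] := @trunc_log_bounds 2 K isT isT.
exists (trunc_log 2 K).+1; split.
  rewrite mulrC -ler_pdivrMr// mul1r; apply: le_trans (ltW h2) _.
  by rewrite ler_nat ltnW.
have d0 : (0 < 2 ^ (trunc_log 2 K).+1)%N by rewrite expn_gt0.
apply: le_trans (harmonic_sum_le d0) _; rewrite lerD2l.
have -> : 2 * ell = ln (p^-1 * p^-1) by rewrite lnM ?posrE//; lra.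
rewrite ler_ln ?posrE ?ltr0n ?mulr_gt0//.
apply: (@le_trans _ _ (2 * K%:R)).
  by rewrite -natrM ler_nat expnS leq_mul2l.
have ip : 512 <= p^-1 by rewrite -[leRHS]mul1r ler_pdivlMr.
rewrite /K -natr1.
by move: h1 ip; set x := p^-1; nra.
Qed.

(** [kappa = 9 * ell] covers [(n.+1 ^ 4) <= p^-8] and one [p^-1]. Each of the two [nsteps] is at
    most [4 * m * (3 + 12) * ell <= 60 * ell / r], so they contribute [1080 * ell ^ 2 / r]; raising
    1080 to 1200 absorbs all terms of order [ell]. *)
Lemma upper_exponent : forall (d : measure_display) (T : measurableType d)
    (P : probability T R) (X : site -> T -> state), has_law_Pp P p X ->
  (P (growth_event step_modified X) <=
    (expR ((- (2 * lambda2) + 1200 * r * ell ^+ 2) / p))%:E)%E.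
Proof.
move=> d T P X law.
have l4 := ell_ge4; have lp := ell_le; have h12 := r12.
have [m [m0 mp pm mr]] := upper_parameters_step.
have [n [np qn]] := upper_parameters_size.
have [j [hj Hj]] := dyadic_approx.
have ps : 2 * expR 4 * p <= 1.
  by apply: le_trans psmall; rewrite ler_wpM2r ?(ltW p0)//; have := e4; lra.
have Lp2 : n.+1%:R <= p^-1 ^+ 2.
  rewrite exprVn -[leRHS]mul1r ler_pdivlMr ?exprn_gt0// expr2 mulrA.
  apply: (@le_trans _ _ (3 * ell * p)); first by rewrite ler_wpM2r// ltW.
  by rewrite -mulrA; lra.
have Le : n.+1%:R <= expR (2 * ell).
  by rewrite expRM_natl expR_ell.
have L4 : (n.+1 ^ 4)%:R <= expR (8 * ell) :> R.
  rewrite natrX (_ : 8 * ell = 4%:R * (2 * ell)); last by ring.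
  by rewrite expRM_natl lerXn2r ?nnegrE ?expR_ge0.
have k0 : 0 <= 9 * ell by lra.
have hk : (n.+1 ^ 4)%:R * p^-1 <= expR (9 * ell).
  rewrite (_ : 9 * ell = 8 * ell + ell); last by ring.
  by rewrite expRD expR_ell ler_wpM2r// ltW.
have small : (1 - p) ^+ n.+1 * n.+1%:R <= 2^-1.
  apply: (@le_trans _ _ (p ^+ 2 * n.+1%:R)); first by rewrite ler_wpM2r.
  rewrite expr2 -mulrA; apply: (@le_trans _ _ (p * (3 * ell))).
    by rewrite ler_wpM2l ?(ltW p0)// mulrC.
  by rewrite mulrC -mulrA; lra.
apply: le_trans (growth_modified_le p0 p1 m0 mp pm ps k0 hk small law) _.
rewrite lee_fin.
have psi : nsteps R m n.+1 <= 60 * ell / r.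
  apply: le_trans (nsteps_le n.+1 m0) _.
  have H1 : harmonic_sum n.+1 <= 3 * ell :> R.
    apply: le_trans (harmonic_sum_le (ltn0Sn n)) _.
    have : ln n.+1%:R <= 2 * ell by rewrite -[leRHS]expRK ler_ln ?posrE ?expR_gt0 ?ltr0n.
    lra.
  have H2 : n.+1%:R / (m ^ 2)%:R <= 12 * ell.
    have m2 : 0 < (m ^ 2)%:R :> R by rewrite ltr0n expn_gt0 m0.
    rewrite ler_pdivrMr//.
    have : n.+1%:R * 1 <= n.+1%:R * (4 * (m ^ 2)%:R * p) by rewrite ler_wpM2l.
    have : n.+1%:R * p * (m ^ 2)%:R <= 3 * ell * (m ^ 2)%:R by rewrite ler_wpM2r// ltW.
    by nra.
  have mr' : m%:R <= r^-1 by rewrite -[leRHS]mul1r ler_pdivlMr.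
  apply: (@le_trans _ _ (4 * m%:R * (15 * ell))).
    by rewrite ler_wpM2l ?mulr_ge0//; lra.
  rewrite (_ : 4 * m%:R * (15 * ell) = 60 * ell * m%:R); last by ring.
  by rewrite ler_wpM2l//; lra.
have q2 : (1 - p) ^+ n.+1 <= p.
  by apply: (le_trans qn); rewrite expr2 ler_piMl// ltW.
have prodb := prod_hitp_le p0 p1 q2 hj.
have irl : 0 <= ell / r by rewrite divr_ge0 ?(ltW r0)//; lra.
apply: (@le_trans _ _ (expR (8 * ell) * (expR (2 * ell) * expR (1080 * (ell ^+ 2 / r)) *
   (expR 1 * expR (- (lambda2 / p) + 4 + 2 * (1 + 2 * ell)) ^+ 2)))).
  apply: ler_pM => //.
    by rewrite !mulr_ge0 ?exprn_ge0 ?expR_ge0 ?(ltW ip0)// prodr_ge0// => k _; exact: hitp_ge0.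
  apply: ler_pM.
  - by rewrite mulr_ge0 ?exprn_ge0 ?expR_ge0 ?(ltW ip0).
  - by rewrite mulr_ge0 ?exprn_ge0// prodr_ge0// => k _; exact: hitp_ge0.
  - have -> : p^-1 ^+ 2 = expR (2 * ell) by rewrite expRM_natl expR_ell.
    rewrite ler_wpM2l ?expR_ge0// ler_expR.
    rewrite (_ : 1080 * (ell ^+ 2 / r) = 9 * ell * (2 * (60 * ell / r))); last by rewrite expr2; ring.
    by rewrite ler_wpM2l// ler_wpM2l.
  - apply: ler_pM => //.
    + by rewrite exprn_ge0// prodr_ge0// => k _; exact: hitp_ge0.
    + by have := @expR_ge1Dx R 1; lra.
    + rewrite lerXn2r ?nnegrE ?expR_ge0//.
        by rewrite prodr_ge0// => k _; exact: hitp_ge0.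
      by apply: (le_trans prodb); rewrite ler_expR; lra.
rewrite -expRM_natl -!expRD ler_expR.
have -> : (- (2 * lambda2) + 1200 * r * ell ^+ 2) / p = - (2 * (lambda2 / p)) + 1200 * (ell ^+ 2 / r).
  have rp : r / p = r^-1.
    by rewrite -[X in _ / X]rr invfM mulrA divff ?mul1r// gt_eqF.
  by rewrite mulrDl mulrAC -(mulrA 1200) rp; ring.
have bigger : ell <= ell ^+ 2 / r.
  rewrite ler_pdivlMr// expr2 ler_wpM2l; [lra| lra|].
  lra.
lra.
Qed.

End UpperAsymptotics.

(** * Growth in the Froböse model *)

Definition zrange (lo : int) (n : nat) : seq int := [seq lo + i%:Z | i <- iota 0 n].

Lemma mem_zrange lo n x : (x \in zrange lo n) = (lo <= x < lo + n%:Z).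
Proof.
apply/mapP/idP => [[i]|]; first by rewrite mem_iota => ? ->; lia.
move=> h; exists (absz (x - lo)); last by lia.
by rewrite mem_iota; lia.
Qed.

Lemma uniq_zrange lo n : uniq (zrange lo n).
Proof. by rewrite map_inj_uniq ?iota_uniq// => i j; lia. Qed.

Lemma size_zrange lo n : size (zrange lo n) = n.
Proof. by rewrite size_map size_iota. Qed.

Arguments zrange : simpl never.

(** Growth is restricted to the right and upwards, so a filled rectangle is described by two side
    lengths and each stage has a single new row and a single new column. *)
Inductive reachF (w : site -> bool) : nat -> nat -> Prop :=
| reachF_origin : reachF w 1 1
| reachF_col a b : reachF w a b -> hit (coll a%:Z (zrange 0 b)) w -> reachF w a.+1 b
| reachF_row a b : reachF w a b -> hit (rowl (zrange 0 a) b%:Z) w -> reachF w a b.+1.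

Lemma reachF_pos w a b : reachF w a b -> (0 < a)%N && (0 < b)%N.
Proof. by elim => // a' b' _ /andP[a0 b0] _; rewrite /= ?a0 ?b0. Qed.

(** This clashes with the empty column of a detour, in [detour_excl]. *)
Lemma reachF_cols w a b : reachF w a b -> forall x : nat, (0 < x < a)%N ->
  hit (coll x%:Z (zrange 0 b)) w.
Proof.
elim => {a b} [x xa|a b R IH h x xa|a b R IH h x xa].
- by clear -xa; lia.
- by have [->//|xna] := eqVneq x a; apply: IH; clear -xa xna; lia.
- have /hasP[z] := IH x xa; rewrite mem_coll mem_zrange => /andP[e zi] wz.
  apply/hasP; exists z => //; rewrite mem_coll mem_zrange e /=.
  by clear -zi; move: zi; move: (z.2) => y; lia.
Qed.

Lemma reachF_local w w' a b :
  (forall z, z != origin -> z \in box (zrange 0 a) (zrange 0 b) -> w z = w' z) ->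
  reachF w a b -> reachF w' a b.
Proof.
move=> + R; elim: R => {a b} [|a b R IH h|a b R IH h] e.
- exact: reachF_origin.
- apply: reachF_col.
    apply: IH => z zo; rewrite mem_box => /andP[zx zy]; apply: e zo _.
    rewrite mem_box zy andbT; move: zx; rewrite !mem_zrange.
    by move: (z.1) => y; clear; lia.
  have /andP[a0 b0] := reachF_pos R.
  move: h => /hasP[z]; rewrite mem_coll => /andP[/eqP ez zi] wz.
  apply/hasP; exists z; first by rewrite mem_coll ez eqxx.
  rewrite -(e z)//; last by rewrite mem_box zi andbT ez mem_zrange; clear; lia.
  by apply: contraTneq a0 => zo; move: ez; rewrite zo /= => -[<-].
- apply: reachF_row.
    apply: IH => z zo; rewrite mem_box => /andP[zx zy]; apply: e zo _.
    rewrite mem_box zx /=; move: zy; rewrite !mem_zrange.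
    by move: (z.2) => y; clear; lia.
  have /andP[a0 b0] := reachF_pos R.
  move: h => /hasP[z]; rewrite mem_rowl => /andP[zi /eqP ez] wz.
  apply/hasP; exists z; first by rewrite mem_rowl ez eqxx zi.
  rewrite -(e z)//; last by rewrite mem_box zi /= ez mem_zrange; clear; lia.
  by apply: contraTneq b0 => zo; move: ez; rewrite zo /= => -[<-].
Qed.

Section FroboseGrowth.
Variable eta : config.

Definition ev_active (x : site) := exists t, is_act (iter t step_frobose eta x).

Lemma active_persists t k x : is_act (iter t step_frobose eta x) ->
  is_act (iter (k + t) step_frobose eta x).
Proof.
move=> h; elim: k => //= k; rewrite {2}/step_frobose.
by case: (iter (k + t) step_frobose eta x).
Qed.

Lemma state_frobose t x :
  iter t step_frobose eta x = Act \/ iter t step_frobose eta x = eta x.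
Proof.
elim: t => [|t [IH|IH]] /=; first by right.
  by left; rewrite {1}/step_frobose IH.
rewrite {1 3}/step_frobose IH; case E : (eta x).
- by case: ifP => _; [left|right].
- by case: ifP => _; [left|right].
- by left.
Qed.

Lemma ev_active_occ x y : is_occ (eta x) -> y \in nbrs1 x -> ev_active y -> ev_active x.
Proof.
move=> ox yx [t ht]; exists t.+1; rewrite /= /step_frobose.
case: (state_frobose t x) => ->//; case: (eta x) ox => // _.
suff -> : (1 <= n_active (iter t step_frobose eta) (nbrs1 x))%N by [].
by rewrite -has_count; apply/hasP; exists y.
Qed.

Lemma ev_active_two x y z : y \in nbrs1 x -> z \in nbrs1 x -> y != z ->
  ev_active y -> ev_active z -> ev_active x.
Proof.
move=> yx zx yz [t1 h1] [t2 h2].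
pose t := (t1 + t2)%N; exists t.+1.
have hz : is_act (iter t step_frobose eta z) by apply: active_persists.
have hy : is_act (iter t step_frobose eta y) by rewrite /t addnC; apply: active_persists.
have c2 : (2 <= n_active (iter t step_frobose eta) (nbrs1 x))%N.
  rewrite /n_active -size_filter.
  apply: (@uniq_leq_size _ [:: y; z]); first by rewrite /= inE yz.
  by move=> a; rewrite !inE mem_filter => /orP[] /eqP ->; rewrite ?hy ?hz ?yx ?zx.
rewrite /= /step_frobose.
by case: (iter t step_frobose eta x) => //; rewrite ?c2// (leq_trans _ c2).
Qed.

(** [L] is a line next to the active line [M]. An occupied site of [L] is activated from [M];
    activity then spreads both ways along [L], since the next site has one active neighbour on each
    line. Maps are used so that one proof covers rows and columns on either side. *)
Lemma line_fill (L M : int -> site) (lo : int) (n : nat) :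
  (forall i, M i \in nbrs1 (L i)) ->
  (forall i, L i \in nbrs1 (L (i + 1))) -> (forall i, L i \in nbrs1 (L (i - 1))) ->
  (forall i j, M i != L j) ->
  (forall i, i \in zrange lo n -> ev_active (M i)) ->
  (exists2 i, i \in zrange lo n & is_occ (eta (L i))) ->
  forall i, i \in zrange lo n -> ev_active (L i).
Proof.
move=> ML LU LD nML hM [i0 i0in occ].
have h0 : ev_active (L i0) := ev_active_occ occ (ML i0) (hM _ i0in).
have up (k : nat) : i0 + k%:Z \in zrange lo n -> ev_active (L (i0 + k%:Z)).
  elim: k => [|k IH] hk; first by rewrite addr0.
  have hk' : i0 + k%:Z \in zrange lo n.
    by move: hk i0in; rewrite !mem_zrange; clear; lia.
  apply: (ev_active_two (ML _) _ _ (hM _ hk) (IH hk')); last exact: nML.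
  by have := LU (i0 + k%:Z); rewrite (_ : i0 + k%:Z + 1 = i0 + k.+1%:Z)//; clear; lia.
have down (k : nat) : i0 - k%:Z \in zrange lo n -> ev_active (L (i0 - k%:Z)).
  elim: k => [|k IH] hk; first by rewrite subr0.
  have hk' : i0 - k%:Z \in zrange lo n.
    by move: hk i0in; rewrite !mem_zrange; clear; lia.
  apply: (ev_active_two (ML _) _ _ (hM _ hk) (IH hk')); last exact: nML.
  by have := LD (i0 - k%:Z); rewrite (_ : i0 - k%:Z - 1 = i0 - k.+1%:Z)//; clear; lia.
move=> i hi; have [le|lt] := lerP i0 i.
  have e : i = i0 + (absz (i - i0))%:Z by clear -le; lia.
  by rewrite e; apply: up; rewrite -e.
have e : i = i0 - (absz (i0 - i))%:Z by clear -lt; lia.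
by rewrite e; apply: down; rewrite -e.
Qed.

Lemma col_fill (c c' lo : int) (n : nat) :
  c' = c + 1 \/ c' = c - 1 ->
  (forall y, y \in zrange lo n -> ev_active (c', y)) ->
  hit (coll c (zrange lo n)) (fun z => is_occ (eta z)) ->
  forall y, y \in zrange lo n -> ev_active (c, y).
Proof.
move=> cc hM /hasP[z]; rewrite mem_coll => /andP[/eqP zc zy] oz.
apply: (@line_fill (fun i => (c, i)) (fun i => (c', i)) lo n).
- by move=> i; rewrite /nbrs1 !inE !xpair_eqE /=; case: cc => ->; rewrite !eqxx ?orbT.
- by move=> i; rewrite /nbrs1 !inE !xpair_eqE /=; clear; lia.
- by move=> i; rewrite /nbrs1 !inE !xpair_eqE /=; clear; lia.
- by move=> i j; rewrite xpair_eqE; case: cc => ->; clear; lia.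
- exact: hM.
- by exists z.2 => //; rewrite -zc -surjective_pairing.
Qed.

Lemma row_fill (c c' lo : int) (n : nat) :
  c' = c + 1 \/ c' = c - 1 ->
  (forall x, x \in zrange lo n -> ev_active (x, c')) ->
  hit (rowl (zrange lo n) c) (fun z => is_occ (eta z)) ->
  forall x, x \in zrange lo n -> ev_active (x, c).
Proof.
move=> cc hM /hasP[z]; rewrite mem_rowl => /andP[zx /eqP zc] oz.
apply: (@line_fill (fun i => (i, c)) (fun i => (i, c')) lo n).
- by move=> i; rewrite /nbrs1 !inE !xpair_eqE /=; case: cc => ->; rewrite !eqxx ?orbT.
- by move=> i; rewrite /nbrs1 !inE !xpair_eqE /=; clear; lia.
- by move=> i; rewrite /nbrs1 !inE !xpair_eqE /=; clear; lia.
- by move=> i j; rewrite xpair_eqE; case: cc => ->; clear; lia.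
- exact: hM.
- by exists z.1 => //; rewrite -zc -surjective_pairing.
Qed.

Hypothesis o0 : is_act (eta origin).
Let w : site -> bool := fun z => is_occ (eta z).

Lemma reachF_active a b : reachF w a b ->
  forall x y, x \in zrange 0 a -> y \in zrange 0 b -> ev_active (x, y).
Proof.
elim => {a b} [x y|a b R IH h x y|a b R IH h x y].
- rewrite !mem_zrange => h1 h2; exists 0%N.
  have -> : x = 0 by clear -h1; lia.
  by have -> : y = 0 by clear -h2; lia.
- move=> hx hy; have /andP[a0 _] := reachF_pos R.
  have [xa|xa] := boolP (x \in zrange 0 a); first exact: IH.
  have -> : x = a%:Z by move: hx xa; rewrite !mem_zrange; clear; lia.
  apply: (@col_fill a%:Z (a%:Z - 1) 0 b) hy => //; first by right.
  by move=> y' hy'; apply: IH => //; rewrite mem_zrange; clear -a0; lia.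
- move=> hx hy; have /andP[_ b0] := reachF_pos R.
  have [xa|xa] := boolP (y \in zrange 0 b); first exact: IH.
  have -> : y = b%:Z by move: hy xa; rewrite !mem_zrange; clear; lia.
  apply: (@row_fill b%:Z (b%:Z - 1) 0 a) hx => //; first by right.
  by move=> y' hy'; apply: IH => //; rewrite mem_zrange; clear -b0; lia.
Qed.

End FroboseGrowth.

(** The four lines bordering the square of side [N + 2 j], without its corners: those are filled
    afterwards from two adjacent sides. Growth must now go in all four directions, as [reachF]
    covers only a quadrant. *)
Definition sides (N j : nat) : seq (seq site) :=
  let rg := zrange (- j%:Z) (N + j.*2) in
  [:: coll (N + j)%:Z rg; coll (- (j.+1)%:Z) rg; rowl rg (N + j)%:Z; rowl rg (- (j.+1)%:Z)].

Lemma sides_growth (eta : config) (N : nat) : (0 < N)%N -> is_act (eta origin) ->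
  reachF (fun z => is_occ (eta z)) N N ->
  (forall j B, B \in sides N j -> hit B (fun z => is_occ (eta z))) ->
  indefinite_growth step_frobose eta.
Proof.
move=> N0 o0 R hs.
have sq j : forall x y, x \in zrange (- j%:Z) (N + j.*2) ->
    y \in zrange (- j%:Z) (N + j.*2) -> ev_active eta (x, y).
  elim: j => [|j IH].
    by rewrite oppr0 addn0; exact: reachF_active.
  have inr : (N + j)%:Z - 1 \in zrange (- j%:Z) (N + j.*2).
    by rewrite mem_zrange; clear -N0; lia.
  have inl : - j%:Z \in zrange (- j%:Z) (N + j.*2).
    by rewrite mem_zrange; clear -N0; lia.
  have er : - (j.+1)%:Z + 1 = - j%:Z by clear; lia.
  have right y : y \in zrange (- j%:Z) (N + j.*2) -> ev_active eta ((N + j)%:Z, y).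
    apply: (@col_fill _ _ ((N + j)%:Z - 1)); [by right|by move=> *; exact: IH|].
    by apply: (hs j); rewrite /sides !inE eqxx ?orbT.
  have left y : y \in zrange (- j%:Z) (N + j.*2) -> ev_active eta (- (j.+1)%:Z, y).
    apply: (@col_fill _ _ (- j%:Z)); [by left; rewrite er|by move=> *; exact: IH|].
    by apply: (hs j); rewrite /sides !inE eqxx ?orbT.
  have top x : x \in zrange (- j%:Z) (N + j.*2) -> ev_active eta (x, (N + j)%:Z).
    apply: (@row_fill _ _ ((N + j)%:Z - 1)); [by right|by move=> *; exact: IH|].
    by apply: (hs j); rewrite /sides !inE eqxx ?orbT.
  have bot x : x \in zrange (- j%:Z) (N + j.*2) -> ev_active eta (x, - (j.+1)%:Z).
    apply: (@row_fill _ _ (- j%:Z)); [by left; rewrite er|by move=> *; exact: IH|].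
    by apply: (hs j); rewrite /sides !inE eqxx ?orbT.
  have corner (a b a' b' : int) : (a' = a + 1 \/ a' = a - 1) -> (b' = b + 1 \/ b' = b - 1) ->
     ev_active eta (a', b) -> ev_active eta (a, b') -> ev_active eta (a, b).
    move=> ha hb; apply: ev_active_two.
    - by rewrite /nbrs1 !inE !xpair_eqE /=; case: ha => ->; rewrite !eqxx ?orbT.
    - by rewrite /nbrs1 !inE !xpair_eqE /=; case: hb => ->; rewrite !eqxx ?orbT.
    - by rewrite xpair_eqE; case: ha => ->; clear; lia.
  have cases (z : int) : z \in zrange (- (j.+1)%:Z) (N + j.+1.*2) ->
    [\/ z \in zrange (- j%:Z) (N + j.*2), z = (N + j)%:Z | z = - (j.+1)%:Z].
    have [->|n1] := eqVneq z (N + j)%:Z; first by move=> _; apply: Or32.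
    have [->|n2] := eqVneq z (- (j.+1)%:Z); first by move=> _; apply: Or33.
    by move=> h; apply: Or31; move: h; rewrite !mem_zrange; clear -n1 n2; lia.
  move=> x y /cases[xi|->|->] /cases[yi|->|->].
  - exact: IH.
  - exact: top.
  - exact: bot.
  - exact: right.
  - by apply: (corner _ _ ((N + j)%:Z - 1) ((N + j)%:Z - 1)); [right|right|exact: top|exact: right].
  - by apply: (corner _ _ ((N + j)%:Z - 1) (- j%:Z)); [right|left; rewrite er|exact: bot|exact: right].
  - exact: left.
  - by apply: (corner _ _ (- j%:Z) ((N + j)%:Z - 1)); [left; rewrite er|right|exact: top|exact: left].
  - by apply: (corner _ _ (- j%:Z) (- j%:Z)); [left; rewrite er|left; rewrite er|exact: bot|exact: left].
move=> [x y]; apply: (sq (absz x + absz y)%N); rewrite mem_zrange; clear -N0; lia.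
Qed.

(** * Detours *)

Lemma indep_ofM (R : realType) (s : seq site) (f g : (site -> bool) -> R) :
  indep_of s f -> indep_of s g -> indep_of s (fun w => f w * g w).
Proof. by move=> fs gs w x b xs; rewrite fs// gs. Qed.

Lemma indep_of_prod (R : realType) (J : eqType) (r : seq J) (s : seq site)
    (F : J -> (site -> bool) -> R) :
  (forall j, j \in r -> indep_of s (F j)) -> indep_of s (fun w => \prod_(j <- r) F j w).
Proof. by move=> h w x b xs; apply: eq_big_seq => j jr; exact: h. Qed.

Lemma indep_of_bool (R : realType) (s : seq site) (b : (site -> bool) -> bool) :
  indep_of s b -> indep_of s (fun w => (b w)%:R : R).
Proof. by move=> h w x c xs; rewrite h. Qed.

(** * Factorisation of averages *)

Section Factor.
Context {R : realType}.
Variable p : R.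
Hypothesis p01 : 0 <= p <= 1.

Lemma E_agree (s t : seq site) (f : (site -> bool) -> R) w w' :
  local_on (s ++ t) f -> {in t, w =1 w'} -> E p s f w = E p s f w'.
Proof.
elim: s t w w' => [|x s IH] t w w' hf ww'; first exact: hf.
have hf' : local_on (s ++ x :: t) f.
  move=> v v' h; apply: hf => y yin; apply: h; move: yin.
  by rewrite cat_cons inE !mem_cat inE orbCA.
rewrite -[LHS]/(p * E p s f (upd w x true) + (1 - p) * E p s f (upd w x false)).
rewrite -[RHS]/(p * E p s f (upd w' x true) + (1 - p) * E p s f (upd w' x false)).
have agree b : {in x :: t, upd w x b =1 upd w' x b}.
  by move=> y; rewrite inE /upd; case: eqP => //= _; exact: ww'.
by rewrite !(IH _ _ _ hf' (agree _)).
Qed.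

Lemma E_local (s : seq site) (f : (site -> bool) -> R) w w' :
  local_on s f -> E p s f w = E p s f w'.
Proof. by move=> hf; apply: (@E_agree s [::]) => //; rewrite cats0. Qed.

Lemma E_factor (s B : seq site) (g h : (site -> bool) -> R) (c : R) w :
  {subset B <= s} -> indep_of B g -> E p B h = (fun=> c) ->
  E p s (fun w => g w * h w) w = E p s g w * c.
Proof.
move=> Bs gB hB; rewrite -{1}(E_absorb p _ Bs) EC E_mulr// hB.
have -> : (fun w => g w * c) = (fun w => c * g w) by apply/funext => v; rewrite mulrC.
by rewrite (@E_mulr _ p s g (fun=> c))// mulrC.
Qed.

Lemma E_factor_rows (s : seq site) (X Y : seq int) (g : (site -> bool) -> R) w :
  uniq X -> uniq Y -> {subset box X Y <= s} -> indep_of (box X Y) g ->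
  E p s (fun w => g w * \prod_(y <- Y) (hit (rowl X y) w)%:R) w =
  E p s g w * hitp p (size X) ^+ size Y.
Proof.
move=> uX uY sub gB; apply: (E_factor _ sub gB).
rewrite -(eq_mem_E _ _ (mem_rows X Y)) E_prod_blocks//.
  apply/funext => v; under eq_bigr do rewrite E_hit ?uniq_rowl// size_map.
  by rewrite prodr_const_seq.
move=> y1 y2 y1Y y2Y n12; apply: indep_of_bool; apply: indep_hit => z.
by rewrite !mem_rowl => /andP[_ /eqP ->]; rewrite (negbTE n12) andbF.
Qed.

Lemma E_factor_cols (s : seq site) (X Y : seq int) (g : (site -> bool) -> R) w :
  uniq X -> uniq Y -> {subset box X Y <= s} -> indep_of (box X Y) g ->
  E p s (fun w => g w * \prod_(x <- X) (hit (coll x Y) w)%:R) w =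
  E p s g w * hitp p (size Y) ^+ size X.
Proof.
move=> uX uY sub gB; apply: (E_factor _ sub gB).
rewrite -(eq_mem_E _ _ (mem_cols X Y)) E_prod_blocks//.
  apply/funext => v; under eq_bigr do rewrite E_hit ?uniq_coll// size_map.
  by rewrite prodr_const_seq.
move=> y1 y2 y1Y y2Y n12; apply: indep_of_bool; apply: indep_hit => z.
by rewrite !mem_coll => /andP[/eqP -> _]; rewrite (negbTE n12).
Qed.

Lemma E_factor_hit (s B : seq site) (g : (site -> bool) -> R) w :
  uniq B -> {subset B <= s} -> indep_of B g ->
  E p s (fun w => g w * (hit B w)%:R) w = E p s g w * hitp p (size B).
Proof. by move=> uB sub gB; apply: (E_factor _ sub gB); exact: E_hit. Qed.

Lemma E_factor_miss (s B : seq site) (g : (site -> bool) -> R) w :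
  uniq B -> {subset B <= s} -> indep_of B g ->
  E p s (fun w => g w * (~~ hit B w)%:R) w = E p s g w * (1 - p) ^+ size B.
Proof. by move=> uB sub gB; apply: (E_factor _ sub gB); exact: E_miss. Qed.

Lemma E_factor_site (s : seq site) (z : site) (g : (site -> bool) -> R) w :
  z \in s -> indep_of [:: z] g ->
  E p s (fun w => g w * (w z)%:R) w = E p s g w * p.
Proof.
move=> zs gB; apply: (@E_factor s [:: z]) => //; first by move=> y; rewrite inE => /eqP ->.
by apply/funext => v; rewrite /E /= /resample1 /upd !eqxx /=; ring.
Qed.

End Factor.

Lemma sum_indic_excl (R : realType) (I : eqType) (r : seq I) (Q : I -> Prop) (Z : Prop) :
  uniq r -> {in r &, forall i j, i != j -> Q i -> ~ Q j} -> {in r, forall i, Q i -> Z} ->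
  \sum_(i <- r) indic R (Q i) <= indic R Z.
Proof.
move=> ur ex imp; have [[i [ir Qi]]|no] := pselect (exists i, i \in r /\ Q i).
  rewrite (indicT _ (imp i ir Qi)) (bigD1_seq i)//= indicT// big_seq_cond big1 ?addr0//.
  move=> j /andP[jr ji]; rewrite indicF//; apply: ex Qi => //.
  by rewrite eq_sym.
rewrite big_seq big1 ?indic_ge0// => i ir; rewrite indicF// => Qi.
by apply: no; exists i.
Qed.

Definition square (n : nat) : seq site := box (zrange 0 n) (zrange 0 n).

Lemma mem_square n z : (z \in square n) = (0 <= z.1 < n%:Z) && (0 <= z.2 < n%:Z).
Proof. by rewrite mem_box !mem_zrange !add0r. Qed.

(* Emptiness of column [i] below height [n - 1] makes detours from different [i]
   exclusive; [i = n - 1] is the ordinary diagonal step. *)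
Definition detour (i n : nat) (w : site -> bool) : bool :=
  if i.+1 == n then hit (coll i%:Z (zrange 0 i)) w && hit (rowl (zrange 0 n) i%:Z) w
  else [&& all (fun y => hit (rowl (zrange 0 i) y) w) (zrange i%:Z (n - i)),
         ~~ hit (coll i%:Z (zrange 0 n.-1)) w, w (i%:Z, n.-1%:Z) &
         all (fun x => hit (coll x (zrange 0 n)) w) (zrange i.+1%:Z (n - i.+1))].

Lemma reachF_rows w a b k : reachF w a b ->
  all (fun y => hit (rowl (zrange 0 a) y) w) (zrange b%:Z k) -> reachF w a (b + k).
Proof.
move=> R; elim: k => [|k IH] h; first by rewrite addn0.
rewrite addnS; apply: reachF_row.
  apply: IH; apply/allP => y hy; apply: (allP h).
  by move: hy; rewrite !mem_zrange; clear; lia.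
by apply: (allP h); rewrite mem_zrange; clear; lia.
Qed.

Lemma reachF_columns w a b k : reachF w a b ->
  all (fun x => hit (coll x (zrange 0 b)) w) (zrange a%:Z k) -> reachF w (a + k) b.
Proof.
move=> R; elim: k => [|k IH] h; first by rewrite addn0.
rewrite addnS; apply: reachF_col.
  apply: IH; apply/allP => y hy; apply: (allP h).
  by move: hy; rewrite !mem_zrange; clear; lia.
by apply: (allP h); rewrite mem_zrange; clear; lia.
Qed.

Lemma detour_reach w i n : (0 < i < n)%N -> reachF w i i -> detour i n w -> reachF w n n.
Proof.
move=> /andP[i0 lt] R; rewrite /detour; case: eqP => [<-|ne].
  by move=> /andP[h1 h2]; apply: reachF_row => //; exact: reachF_col.
move=> /and4P[h1 _ h3 h4].
have := reachF_rows R h1; rewrite subnKC; last exact: ltnW.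
move=> R1; have R2 : reachF w i.+1 n.
  apply: reachF_col R1 _; apply/hasP; exists (i%:Z, n.-1%:Z) => //.
  by rewrite mem_coll eqxx mem_zrange /=; clear -lt; lia.
by have := reachF_columns R2 h4; rewrite subnKC.
Qed.

(** For [i < j], filling the square of side [j] needs an occupied site in column [i] below height
    [j <= n.-1], where the detour from [i] requires emptiness. *)
Lemma detour_excl w i j n : (0 < i < n)%N -> (0 < j < n)%N -> i != j ->
  reachF w i i /\ detour i n w -> ~ (reachF w j j /\ detour j n w).
Proof.
wlog ij : i j / (i < j)%N.
  move=> H hi hj ne h1 h2; have [lt|ge] := ltnP i j; first exact: H i j lt hi hj ne h1 h2.
  have lt : (j < i)%N by rewrite ltn_neqAle eq_sym ne.
  by apply: (H j i lt hj hi _ h2 h1); rewrite eq_sym.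
move=> /andP[i0 ilt] /andP[j0 jlt] _ [Ri di] [Rj _].
have /hasP[z] := reachF_cols Rj (introT andP (conj i0 ij)).
rewrite mem_coll mem_zrange => /andP[z1 z2] wz.
move: di; rewrite /detour ifF; last by apply/negbTE; clear -ij jlt; lia.
move=> /and4P[_ /hasPn + _ _] => /(_ z); rewrite mem_coll z1 mem_zrange wz.
have -> : (0 <= z.2 < 0 + n.-1%:Z) by move: z2; move: (z.2) => y; clear -jlt; lia.
by move=> /(_ isT).
Qed.

(** * Renewal inequality for squares *)

Section Renewal.
Context {R : realType}.
Variable p : R.
Hypotheses (p0 : 0 < p) (p1 : p < 1).
Let p01 : 0 <= p <= 1. Proof. by rewrite !ltW. Qed.

Definition square_prob (n : nat) : R := E p (square n) (fun w => indic R (reachF w n n)) (fun=> false).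

Definition detour_prob (i n : nat) : R :=
  if i.+1 == n then hitp p i * hitp p n
  else hitp p i ^+ (n - i) * (1 - p) ^+ n.-1 * p * hitp p n ^+ (n - i.+1).

Lemma local_reachF n : local_on (square n) (fun w => indic R (reachF w n n)).
Proof.
move=> w w' h; congr (_%:R); congr (nat_of_bool _); apply: asbool_equiv_eq.
by split; apply: reachF_local => z _ zin; rewrite h.
Qed.

Lemma E_reachF i s w : {subset square i <= s} ->
  E p s (fun w => indic R (reachF w i i)) w = square_prob i.
Proof.
move=> sub; rewrite -(E_absorb p _ sub) EC.
rewrite (_ : E p (square i) _ = fun=> square_prob i) ?E_cst//.
by apply/funext => v; apply: E_local; exact: local_reachF.
Qed.

Lemma all_prod (J : Type) (r : seq J) (b : J -> bool) :
  (all b r)%:R = \prod_(j <- r) (b j)%:R :> R.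
Proof. by elim: r => [|j r IH]; rewrite ?big_nil// big_cons -IH /= -natrM mulnb. Qed.

Lemma indep_reachF i s : (forall z, z \in s -> z \notin square i) ->
  indep_of s (fun w => indic R (reachF w i i)).
Proof. by move=> h; apply: local_indep h; exact: local_reachF. Qed.

(** The requirements read disjoint sets: the square, the rows above it, column [i] below its top,
    the top site, and the columns to the right. They are split off in reverse order. *)
Lemma E_detour i n w : (0 < i < n)%N ->
  E p (square n) (fun w => indic R (reachF w i i /\ detour i n w)) w =
  square_prob i * detour_prob i n.
Proof.
move=> /andP[i0 lt].
have sub : {subset square i <= square n}.
  by move=> z; rewrite !mem_square; move: (z.1) (z.2) => x y; clear -lt; lia.
rewrite /detour_prob; have [e|ne] := eqVneq i.+1 n.
  have -> : (fun w => indic R (reachF w i i /\ detour i n w)) = fun w =>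
     (indic R (reachF w i i) * (hit (coll i%:Z (zrange 0 i)) w)%:R) *
     (hit (rowl (zrange 0 n) i%:Z) w)%:R.
    apply/funext => v; rewrite indic_and indic_bool /detour e eqxx.
    by rewrite -mulnb natrM mulrA.
  rewrite E_factor_hit ?uniq_rowl ?uniq_zrange//; first last.
  - apply: indep_ofM.
      apply: indep_reachF => z; rewrite mem_rowl mem_square => /andP[_ /eqP ->].
      by clear; lia.
    apply: indep_of_bool; apply: indep_hit => z; rewrite mem_rowl mem_coll => /andP[_ /eqP ->].
    by rewrite mem_zrange; clear; lia.
  - move=> z; rewrite mem_rowl mem_square mem_zrange add0r => /andP[-> /eqP ->].
    by clear -lt; lia.
  rewrite E_factor_hit ?uniq_coll ?uniq_zrange//; first last.
  - apply: indep_reachF => z; rewrite mem_coll mem_square => /andP[/eqP -> _].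
    by clear; lia.
  - move=> z; rewrite mem_coll mem_square mem_zrange add0r => /andP[/eqP -> h].
    by move: h; move: (z.2) => y; clear -lt; lia.
  by rewrite E_reachF// !size_map !size_iota mulrA.
have lt2 : (i.+1 < n)%N by rewrite ltn_neqAle ne.
pose g1 v := indic R (reachF v i i).
pose g2 v := g1 v * \prod_(y <- zrange i%:Z (n - i)) (hit (rowl (zrange 0 i) y) v)%:R.
pose g3 v := g2 v * (~~ hit (coll i%:Z (zrange 0 n.-1)) v)%:R.
pose g4 v := g3 v * (v (i%:Z, n.-1%:Z))%:R.
have -> : (fun w => indic R (reachF w i i /\ detour i n w)) = fun w =>
   g4 w * \prod_(x <- zrange i.+1%:Z (n - i.+1)) (hit (coll x (zrange 0 n)) w)%:R.
  apply/funext => v; rewrite indic_and indic_bool /detour (negbTE ne).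
  by rewrite -!mulnb !natrM !all_prod /g4 /g3 /g2 !mulrA.
have r1 s : (forall z, z \in s -> z \notin square i) -> indep_of s g1 by exact: indep_reachF.
have r2 s : (forall z, z \in s -> z \notin square i) ->
    (forall z, z \in s -> z \notin box (zrange 0 i) (zrange i%:Z (n - i))) -> indep_of s g2.
  move=> h1 h2; apply: indep_ofM; first exact: r1.
  apply: indep_of_prod => y yin; apply: indep_of_bool; apply: indep_hit => z zs.
  apply: contra (h2 _ zs); rewrite mem_rowl mem_box => /andP[-> /eqP ->]; exact: yin.
have r3 s : (forall z, z \in s -> z \notin square i) ->
    (forall z, z \in s -> z \notin box (zrange 0 i) (zrange i%:Z (n - i))) ->
    (forall z, z \in s -> z \notin coll i%:Z (zrange 0 n.-1)) -> indep_of s g3.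
  move=> h1 h2 h3; apply: indep_ofM; first exact: r2.
  by move=> v z b zs; rewrite (indep_hit h3).
rewrite E_factor_cols ?uniq_zrange//; first last.
- apply: indep_ofM.
    apply: r3 => z; rewrite mem_box mem_zrange => /andP[zx _].
    + by rewrite mem_square; move: zx; move: (z.1) (z.2) => x y; clear; lia.
    + by rewrite mem_box !mem_zrange; move: zx; move: (z.1) (z.2) => x y; clear; lia.
    + by rewrite mem_coll; move: zx; move: (z.1) (z.2 \in _) => x y; clear; lia.
  move=> v z b; rewrite mem_box mem_zrange => /andP[zx _].
  rewrite /upd; case: eqP => // ez; move: zx; rewrite -ez /=; clear; lia.
- move=> z; rewrite mem_box mem_square !mem_zrange add0r => /andP[zx ->]; rewrite andbT.
  by move: zx; move: (z.1) => x; clear -lt2; lia.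
rewrite E_factor_site; first last.
- apply: r3 => z; rewrite inE => /eqP ->.
  + by rewrite mem_square /=; clear; lia.
  + by rewrite mem_box !mem_zrange /=; clear; lia.
  + by rewrite mem_coll mem_zrange eqxx /=; clear; lia.
- by rewrite mem_square /=; clear -lt2; lia.
rewrite E_factor_miss ?uniq_coll ?uniq_zrange//; first last.
- apply: r2 => z; rewrite mem_coll => /andP[/eqP zx _].
  + by rewrite mem_square zx; clear; lia.
  + by rewrite mem_box !mem_zrange zx; clear; lia.
- move=> z; rewrite mem_coll mem_square mem_zrange => /andP[/eqP -> h].
  by move: h; move: (z.2) => y; clear -lt2; lia.
rewrite E_factor_rows ?uniq_zrange//; first last.
- apply: r1 => z; rewrite mem_box mem_square !mem_zrange => /andP[_].
  by move: (z.1) (z.2) => x y; clear; lia.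
- move=> z; rewrite mem_box mem_square !mem_zrange.
  by move: (z.1) (z.2) => x y; clear -lt2; lia.
rewrite E_reachF//.
by rewrite !size_map !size_iota -!mulrA.
Qed.

Lemma square_prob_renewal n : (1 < n)%N ->
  \sum_(1 <= i < n) square_prob i * detour_prob i n <= square_prob n.
Proof.
move=> n1; rewrite /square_prob.
apply: (@le_trans _ _ (E p (square n) (fun w => \sum_(i <- index_iota 1 n)
   indic R (reachF w i i /\ detour i n w)) (fun=> false))).
  rewrite E_sum le_eqVlt; apply/orP; left; apply/eqP.
  by apply: eq_big_seq => i; rewrite mem_index_iota => hi; rewrite E_detour.
apply: (E_le p01) => w; apply: sum_indic_excl; first exact: iota_uniq.
  move=> i j; rewrite !mem_index_iota => hi hj ne; exact: detour_excl.
by move=> i; rewrite mem_index_iota => hi [h1 h2]; exact: detour_reach h1 h2.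
Qed.

End Renewal.

(** * Gain of the detours at scale [1/p] *)

Section LowerNumerics.
Context {R : realType}.
Variables (p : R) (m : nat).
Hypotheses (p0 : 0 < p) (phalf : p <= 2^-1) (m2 : (2 <= m)%N)
  (mp : 4 * (m ^ 2)%:R * p <= 1) (pm : 1 <= 16 * (m ^ 2)%:R * p).

Let p1 : p < 1. Proof. by have := phalf; lra. Qed.
Let p01 : 0 <= p <= 1. Proof. by rewrite !ltW// p1. Qed.
Let q0 : 0 <= 1 - p. Proof. by rewrite subr_ge0 ltW. Qed.
Let u_gt0 k : (0 < k)%N -> 0 < hitp p k := @hitp_gt0 R p p0 p1 k.
Let u_ge0 k : 0 <= hitp p k := hitp_ge0 p0 p1 k.
Let u_le1 k : hitp p k <= 1 := hitp_le1 p1 k.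

Local Notation c0 := (expR (- 16) : R).

(** From side [k.-1] to side [k]: a column of [k.-1] sites, then a row of [k]. The product starts at
    2 because the square of side 1 is the origin. *)
Definition diag_prob (n : nat) : R := \prod_(2 <= k < n.+1) (hitp p k.-1 * hitp p k).

Lemma diag_prob_gt0 n : 0 < diag_prob n.
Proof.
rewrite /diag_prob big_nat; apply: prodr_gt0 => k /andP[k2 _].
by rewrite mulr_gt0// u_gt0//; clear -k2; lia.
Qed.

Lemma diag_probS n : (0 < n)%N -> diag_prob n.+1 = diag_prob n * (hitp p n * hitp p n.+1).
Proof. by move=> n0; rewrite /diag_prob big_nat_recr. Qed.

Lemma diag_prob_ratio i k : (0 < i)%N ->
  diag_prob (i + k) <= diag_prob i * (hitp p (i + k) ^+ k * hitp p (i + k) ^+ k).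
Proof.
move=> i0; elim: k => [|k IH]; first by rewrite addn0 !expr0 !mulr1.
rewrite addnS diag_probS ?addn_gt0 ?i0//.
have h : hitp p (i + k) <= hitp p (i + k).+1 by apply: hitp_homo.
set u' := hitp p (i + k).+1 in h *; set u := hitp p (i + k) in IH h *.
have hu : u ^+ k <= u' ^+ k by rewrite lerXn2r ?nnegrE ?u_ge0.
have D0 := ltW (diag_prob_gt0 i).
apply: (@le_trans _ _ (diag_prob i * (u' ^+ k * u' ^+ k) * (u' * u'))).
  apply: ler_pM.
  - exact: ltW (diag_prob_gt0 _).
  - by rewrite mulr_ge0 ?u_ge0.
  - apply: (le_trans IH); rewrite ler_wpM2l//.
    by apply: ler_pM => //; rewrite exprn_ge0// u_ge0.
  - by rewrite ler_wpM2r ?u_ge0.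
by rewrite le_eqVlt; apply/orP; left; apply/eqP; rewrite !exprS; ring.
Qed.

Lemma diag_prob_ge n : (0 < n)%N -> expR (2 * (- (lambda2 / p) - 1)) <= diag_prob n.
Proof.
move=> n0; have h := prod_hitp_ge p0 p1 n; rewrite expRM_natl.
apply: (@le_trans _ _ ((\prod_(1 <= k < n.+1) hitp p k) ^+ 2)).
  by rewrite lerXn2r ?nnegrE ?expR_ge0// prodr_ge0// => k _; exact: u_ge0.
have -> : diag_prob n = (\prod_(1 <= k < n) hitp p k) * \prod_(2 <= k < n.+1) hitp p k.
  by rewrite /diag_prob big_split /=; congr (_ * _); rewrite big_add1.
have P0 a b : 0 <= \prod_(a <= k < b) hitp p k by rewrite prodr_ge0// => k _; exact: u_ge0.
rewrite expr2; apply: ler_pM => //.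
  by rewrite big_nat_recr//= ler_piMr.
by rewrite big_ltn// ler_piMl.
Qed.

(* The gain of the detours over pure diagonal growth. *)
Definition normalized (n : nat) : R := square_prob p n / diag_prob n.

Lemma square_prob_ge0 n : 0 <= square_prob p n.
Proof. by apply: (E_ge0 p01) => w; exact: indic_ge0. Qed.

Lemma normalized_ge0 n : 0 <= normalized n.
Proof. by rewrite divr_ge0 ?square_prob_ge0// ltW// diag_prob_gt0. Qed.

Lemma normalized1 : normalized 1 = 1.
Proof.
rewrite /normalized /diag_prob big_geq// divr1 /square_prob.
rewrite (_ : (fun w => _) = fun=> 1) ?E_cst//.
by apply/funext => w; rewrite indicT//; exact: reachF_origin.
Qed.

Lemma detour_prob_ge0 i n : 0 <= detour_prob p i n.
Proof.
rewrite /detour_prob; case: eqP => _; first by rewrite mulr_ge0 ?u_ge0.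
by rewrite !mulr_ge0 ?exprn_ge0 ?u_ge0// ltW.
Qed.

(** The diagonal step from [n] contributes exactly [normalized n], so every genuine detour is a pure
    gain. *)
Lemma normalized_renewal n : (0 < n)%N ->
  normalized n + \sum_(1 <= i < n) normalized i * (detour_prob p i n.+1 * diag_prob i / diag_prob n.+1)
  <= normalized n.+1.
Proof.
move=> n0; have D k : diag_prob k != 0 by rewrite gt_eqF// diag_prob_gt0.
have := square_prob_renewal p0 p1 (n0 : (1 < n.+1)%N); rewrite big_nat_recr//=.
rewrite -(ler_pM2r (x := (diag_prob n.+1)^-1)) ?invr_gt0 ?diag_prob_gt0// => h.
apply: le_trans h; rewrite mulrDl addrC mulr_suml; apply: lerD.
  apply: ler_sum => i _; rewrite /normalized le_eqVlt; apply/orP; left; apply/eqP.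
  by field; rewrite !D.
rewrite /normalized /detour_prob eqxx diag_probS// le_eqVlt; apply/orP; left; apply/eqP.
have := u_gt0 n0; have := u_gt0 (ltn0Sn n).
move: (hitp p n) (hitp p n.+1) => x y y0 x0.
by field; rewrite D !gt_eqF.
Qed.

Lemma normalized_le n : (0 < n)%N -> normalized n <= normalized n.+1.
Proof.
move=> n0; apply: le_trans (normalized_renewal n0); rewrite lerDl sumr_ge0// => i _.
by rewrite mulr_ge0 ?normalized_ge0// divr_ge0 ?mulr_ge0 ?detour_prob_ge0// ltW// diag_prob_gt0.
Qed.

Lemma normalized_homo n k : (0 < n)%N -> normalized n <= normalized (n + k).
Proof.
move=> n0; elim: k => [|k IH]; first by rewrite addn0.
by rewrite addnS (le_trans IH)// normalized_le// addn_gt0 n0.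
Qed.

Lemma large_hitp n : (16 * m ^ 2 <= n)%N -> 2^-1 <= hitp p n.
Proof.
move=> hn; have h := expr_1B_le p0 p1 n.
have np : 1 <= n%:R * p.
  apply: (le_trans pm); rewrite -natrM ler_wpM2r ?(ltW p0)// ler_nat.
  exact: hn.
have : (1 + n%:R * p)^-1 <= 2^-1 by rewrite lef_pV2 ?posrE//; lra.
by rewrite /hitp; lra.
Qed.

(** Origin of [c0]: [1 - p >= expR (- (2 * p))] for [p <= 1/2], and [2 * p * 32 * m ^ 2 <= 16]. *)
Lemma power_1B_ge n : (n <= 32 * m ^ 2)%N -> c0 <= (1 - p) ^+ n.
Proof.
move=> hn.
have h : expR (- (2 * p)) <= 1 - p.
  rewrite expRN -[leLHS]mul1r ler_pdivrMr ?expR_gt0//.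
  apply: (@le_trans _ _ ((1 - p) * (1 + 2 * p))).
    by have := p0; have := phalf; nra.
  by rewrite ler_wpM2l ?q0// expR_ge1Dx.
apply: (@le_trans _ _ (expR (- (2 * p)) ^+ n)); last first.
  by rewrite lerXn2r ?nnegrE ?expR_ge0 ?q0.
rewrite -expRM_natl ler_expR mulrN lerN2.
have : n%:R <= 32 * (m ^ 2)%:R :> R by rewrite -natrM ler_nat.
move=> hn'; have := ler_wpM2r (ltW p0) hn'; have := mp; lra.
Qed.

(** With [k = n - i], both routes add about [k] rows and [k] columns. Since [k <= m], replacing
    [hitp p n] by [hitp p i] in [k] rows costs at most a factor 2; the empty column costs [c0] and
    the prescribed occupied site costs [p]. *)
Lemma detour_ratio i n : (16 * m ^ 2 <= i)%N -> (n <= 32 * m ^ 2)%N ->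
  (i.+1 < n)%N -> (n <= i + m)%N ->
  c0 / 2 * p <= detour_prob p i n * diag_prob i / diag_prob n.
Proof.
move=> hi hn lt le.
have i0 : (0 < i)%N by apply: leq_trans hi; rewrite muln_gt0 expn_gt0; clear -m2; lia.
rewrite ler_pdivlMr ?diag_prob_gt0//.
have [k e km] : exists2 k, n = (i + k)%N & (k <= m)%N.
  by exists (n - i)%N; clear -lt le; lia.
have k2 : (1 < k)%N by clear -lt e; lia.
have hu : 2^-1 <= hitp p n by apply: large_hitp; apply: leq_trans hi _; rewrite e leq_addr.
have D0 := ltW (diag_prob_gt0 i).
have c00 : 0 <= c0 := expR_ge0 _.
apply: (@le_trans _ _ (c0 / 2 * p * (diag_prob i * (hitp p n ^+ k * hitp p n ^+ k)))).
  rewrite ler_wpM2l ?mulr_ge0 ?(ltW p0)//.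
  by rewrite e; exact: diag_prob_ratio.
rewrite /detour_prob ifF; last by apply/negbTE; clear -e k2; lia.
have -> : (n - i = k)%N by rewrite e addKn.
have -> : (n - i.+1 = k.-1)%N by clear -e k2; lia.
have ratio : hitp p n ^+ k / 2 <= hitp p i ^+ k.
  have h1 : hitp p n - k%:R * p <= hitp p i by rewrite e; exact: hitp_sub.
  have kp : k%:R * p <= m%:R * p by rewrite ler_wpM2r ?(ltW p0)// ler_nat.
  have mR : 2 <= m%:R :> R by rewrite ler_nat.
  have mmp : m%:R * (2 * (m%:R * p)) <= 2^-1.
    by have := mp; rewrite natrX expr2; lra.
  have x0 : 0 <= 2 * (m%:R * p) by rewrite !mulr_ge0// ltW.
  have x1 : 2 * (m%:R * p) <= 1 by nra.
  have h2 : hitp p n * (1 - 2 * (m%:R * p)) <= hitp p i by nra.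
  have h3 : 2^-1 <= (1 - 2 * (m%:R * p)) ^+ k.
    apply: le_trans (bernoulli k x0 x1).
    have : k%:R * (2 * (m%:R * p)) <= m%:R * (2 * (m%:R * p)).
      by rewrite ler_wpM2r// ler_nat.
    by lra.
  apply: (@le_trans _ _ ((hitp p n * (1 - 2 * (m%:R * p))) ^+ k)).
    by rewrite exprMn ler_wpM2l// exprn_ge0// u_ge0.
  by rewrite lerXn2r ?nnegrE ?u_ge0// mulr_ge0 ?u_ge0// subr_ge0.
have un : hitp p n ^+ k <= hitp p n ^+ k.-1.
  by apply: ler_wiXn2l; [exact: u_ge0|exact: u_le1|exact: leq_pred].
have qn : c0 <= (1 - p) ^+ n.-1 by apply: power_1B_ge; rewrite (leq_trans (leq_pred n)).
have X0 : 0 <= hitp p n ^+ k by rewrite exprn_ge0 ?u_ge0.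
apply: (@le_trans _ _ ((hitp p n ^+ k / 2) * c0 * p * hitp p n ^+ k * diag_prob i)).
  by rewrite le_eqVlt; apply/orP; left; apply/eqP; field.
rewrite ler_wpM2r//; apply: ler_pM => //.
  by rewrite !mulr_ge0// ltW.
rewrite ler_wpM2r ?(ltW p0)//; apply: ler_pM => //.
by rewrite mulr_ge0.
Qed.

(** The first [m] sides make room for detours; each of the next [m] sides then receives [m.-1]
    detours of weight at least [c0 / 2 * p]. In total [m * (m - 1) * p >= 1/32], which gives
    [c0 / 64]. *)
Lemma normalized_double n : (16 * m ^ 2 <= n)%N -> (n + 2 * m <= 32 * m ^ 2)%N ->
  normalized n * (1 + c0 / 64) <= normalized (n + 2 * m).
Proof.
move=> hn hN.
have n0 : (0 < n)%N by apply: leq_trans hn; rewrite muln_gt0 expn_gt0; clear -m2; lia.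
have c00 : 0 <= c0 := expR_ge0 _.
have step k : (k <= m)%N ->
  normalized n + k%:R * ((m.-1)%:R * (c0 / 2 * p * normalized n)) <= normalized (n + m + k).
  elim: k => [|k IH] km; first by rewrite mul0r addr0 addn0 normalized_homo.
  rewrite addnS; apply: le_trans (normalized_renewal _); last by rewrite !addn_gt0 n0.
  rewrite -natr1 mulrDl mul1r addrA; apply: lerD; first by apply: IH; exact: ltnW.
  have lo : (1 <= n + k.+1)%N by rewrite addn_gt0 n0.
  have hi : (n + k.+1 <= n + m + k)%N by clear -km m2; lia.
  (* Only the [m.-1] detours of length between 2 and [m] are kept; they all start beyond [n]. *)
  rewrite (@big_cat_nat _ _ _ (n + k.+1))//=.
  have pos i : 0 <= normalized i * (detour_prob p i (n + m + k).+1 * diag_prob i /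
        diag_prob (n + m + k).+1).
    by rewrite mulr_ge0 ?normalized_ge0// divr_ge0 ?mulr_ge0 ?detour_prob_ge0// ltW// diag_prob_gt0.
  rewrite -[leLHS]add0r; apply: lerD; first by rewrite sumr_ge0.
  apply: (@le_trans _ _ (\sum_(n + k.+1 <= i < n + m + k) c0 / 2 * p * normalized n)).
    rewrite sumr_const_nat -[leRHS]mulr_natl.
    by rewrite (_ : (n + m + k - (n + k.+1) = m.-1)%N)//; clear -m2; lia.
  rewrite [leLHS]big_nat [leRHS]big_nat; apply: ler_sum => i /andP[i1 i2].
  rewrite mulrC; apply: ler_pM.
  - exact: normalized_ge0.
  - by rewrite !mulr_ge0// ltW.
  - have -> : i = (n + (i - n))%N by clear -i1; lia.
    exact: normalized_homo.
  - apply: detour_ratio.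
    + by apply: (leq_trans hn); clear -i1; lia.
    + by apply: leq_trans hN; clear -km; lia.
    + by clear -i2; lia.
    + by clear -i1; lia.
have := step m (leqnn m).
rewrite (_ : n + m + m = n + 2 * m)%N; last by clear; lia.
apply: le_trans; rewrite mulrDr mulr1 lerD2l.
have U0 := normalized_ge0 n.
have mR : 2 <= m%:R :> R by rewrite ler_nat.
have em : (m.-1)%:R = m%:R - 1 :> R.
  by rewrite -subn1 natrB//; apply: leq_trans m2.
have key : 32^-1 <= m%:R * (m.-1)%:R * p.
  rewrite em; have := pm; rewrite natrX expr2 => h.
  have h2 : m%:R * m%:R * p <= 2 * (m%:R * (m%:R - 1) * p).
    rewrite mulrA ler_wpM2r ?(ltW p0)//; nra.
  lra.
rewrite [leRHS](_ : _ = (m%:R * (m.-1)%:R * p) * (c0 / 2 * normalized n)); last by ring.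
apply: (@le_trans _ _ (32^-1 * (c0 / 2 * normalized n))).
  by rewrite le_eqVlt; apply/orP; left; apply/eqP; field.
apply: ler_wpM2r => //; apply: mulr_ge0 => //; exact: divr_ge0.
Qed.

(** Between the sides [16 * m ^ 2] and [32 * m ^ 2] there are [8 * m] blocks of length [2 * m]. *)
Lemma normalized_ge : (1 + c0 / 64) ^+ (8 * m) <= normalized (32 * m ^ 2).
Proof.
have c00 : 0 <= c0 := expR_ge0 _.
have m0 : (0 < 16 * m ^ 2)%N by rewrite muln_gt0 expn_gt0; clear -m2; lia.
have h j : (j <= 8 * m)%N -> (1 + c0 / 64) ^+ j <= normalized (16 * m ^ 2 + 2 * m * j).
  elim: j => [|j IH] hj.
    rewrite muln0 addn0 expr0 -normalized1.
    by rewrite -(prednK m0) -add1n; exact: normalized_homo.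
  have le1 : (2 * m * j.+1 <= 16 * m ^ 2)%N.
    rewrite (_ : 16 * m ^ 2 = 2 * m * (8 * m))%N; last by rewrite -mulnn; clear; lia.
    by rewrite leq_mul2l hj orbT.
  have le2 : (16 * m ^ 2 + 2 * m * j + 2 * m <= 32 * m ^ 2)%N.
    rewrite -addnA -mulnSr (_ : 32 * m ^ 2 = 16 * m ^ 2 + 16 * m ^ 2)%N ?leq_add2l//.
    by clear; lia.
  have := normalized_double (leq_addr _ _) le2.
  rewrite -addnA -mulnSr; apply: le_trans.
  rewrite exprSr; apply: ler_wpM2r; last by apply: IH; exact: ltnW.
  by apply: addr_ge0 => //; exact: divr_ge0.
have := h (8 * m)%N (leqnn _).
by rewrite (_ : 16 * m ^ 2 + 2 * m * (8 * m) = 32 * m ^ 2)%N// -mulnn; clear; lia.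
Qed.

Lemma square_prob_ge n : (32 * m ^ 2 <= n)%N ->
  expR (2 * (- (lambda2 / p) - 1)) * (1 + c0 / 64) ^+ (8 * m) <= square_prob p n.
Proof.
move=> hn; have m0 : (0 < 32 * m ^ 2)%N by rewrite muln_gt0 expn_gt0; clear -m2; lia.
have n0 : (0 < n)%N by exact: leq_trans hn.
rewrite -[leRHS](divfK (lt0r_neq0 (diag_prob_gt0 n))) mulrC.
apply: ler_pM.
- by rewrite exprn_ge0// addr_ge0// divr_ge0// expR_ge0.
- exact: expR_ge0.
- apply: le_trans normalized_ge _; rewrite -/(normalized n) -(subnKC hn).
  exact: normalized_homo.
- exact: diag_prob_ge.
Qed.

End LowerNumerics.

(** * The lower bound *)

Section LowerBound.
Context {R : realType}.

Lemma sides_disjoint N j B z : B \in sides N j -> z \in B -> z \notin square N.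
Proof.
rewrite mem_square /sides !inE => /or4P[] /eqP ->; rewrite ?mem_coll ?mem_rowl.
- by move=> /andP[/eqP -> _]; clear; lia.
- by move=> /andP[/eqP -> _]; clear; lia.
- by move=> /andP[_ /eqP ->]; clear; lia.
- by move=> /andP[_ /eqP ->]; clear; lia.
Qed.

Lemma uniq_side N j B : B \in sides N j -> uniq B.
Proof.
by rewrite /sides !inE => /or4P[] /eqP ->; rewrite ?uniq_coll ?uniq_rowl ?uniq_zrange.
Qed.

Lemma size_side N j B : B \in sides N j -> size B = (N + j.*2)%N.
Proof. by rewrite /sides !inE => /or4P[] /eqP ->; rewrite size_map size_zrange. Qed.

(** The sides avoid the square, so each failure carries the factor [square_prob p N]. The failures
    add up to at most [4 * (1 - p) ^ N / p <= 1/2] of it. *)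
Lemma growth_frobose_ge (p : R) (N : nat) : 0 < p -> p < 1 -> (0 < N)%N ->
  (1 - p) ^+ N <= p / 8 ->
  forall (d : measure_display) (T : measurableType d)
    (P : probability T R) (X : site -> T -> state), has_law_Pp P p X ->
  ((p * square_prob p N / 2)%:E <= P (growth_event step_frobose X))%E.
Proof.
move=> p0 p1 N0 qN d T P X law.
have p01 : 0 <= p <= 1 by rewrite !ltW.
have q0 : 0 <= 1 - p by rewrite subr_ge0 ltW.
have q1 : 1 - p <= 1 by rewrite gerBl ltW.
have mAct : measurable [set w | X origin w = Act] by case: law => h _; exact: h.
pose b (w : site -> bool) := `[< reachF w N N >].
pose bj j (w : site -> bool) := b w && has (fun B => ~~ hit B w) (sides N j).
have lbN s : {subset square N <= s} -> local_on [seq z <- s | z != origin] b.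
  move=> sub w w' h; apply: asbool_equiv_eq; split; apply: reachF_local => z zo zin;
    by rewrite h// mem_filter zo sub.
pose sj j := undup (square N ++ flatten (sides N j)).
have subN j : {subset square N <= sj j}.
  by move=> z zs; rewrite mem_undup (mem_cat z (square N)) zs.
have subB j B : B \in sides N j -> {subset B <= sj j}.
  move=> Bin z zB; rewrite mem_undup (mem_cat z (square N)); apply/orP; right.
  by apply/flattenP; exists B.
have noo j B z : B \in sides N j -> z \in B -> z != origin.
  move=> Bin zB; apply: contraNneq (sides_disjoint Bin zB) => ->.
  by rewrite mem_square /= !ltz_nat N0.
have lbj j : local_on [seq z <- sj j | z != origin] (bj j).
  move=> w w' h; rewrite /bj (lbN (sj j) (@subN j) w w' h); congr (_ && _).
  apply: eq_in_has => B Bin; congr (~~ _); apply: local_hit => z zB.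
  by rewrite h// mem_filter (noo j B z Bin zB) (subB j B Bin).
pose A := [set w | X origin w = Act] `&` [set w | b (occ_at X w)].
pose F j := [set w | X origin w = Act] `&` [set w | bj j (occ_at X w)].
have uN : uniq [seq z <- square N | z != origin] by rewrite filter_uniq// uniq_box// uniq_zrange.
have uj j : uniq [seq z <- sj j | z != origin] by rewrite filter_uniq// undup_uniq.
have os s : origin \notin [seq z <- s | z != origin] by rewrite mem_filter eqxx.
have mA : measurable A.
  apply: measurableI => //.
  by apply: (measurable_occ law (s := [seq z <- square N | z != origin])
    (b := fun w => b w)) => w w' h; rewrite (lbN (square N) _ w w' h).
have mF j : measurable (F j).
  apply: measurableI => //.
  by apply: (measurable_occ law (s := [seq z <- sj j | z != origin])
    (b := fun w => bj j w)) => w w' h; rewrite (lbj j w w' h).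
have rest_o s (f : (site -> bool) -> bool) : local_on [seq z <- s | z != origin] f ->
    indep_of [:: origin] (fun w => (f w)%:R : R).
  move=> hf; apply: indep_of_bool; apply: (local_indep hf) => z; rewrite inE => /eqP ->.
  exact: os.
have PA : P A = (p * square_prob p N)%:E.
  rewrite (occ_law law uN (os _) (lbN _ (fun _ h => h))) E_skip_origin//.
  exact: rest_o (lbN _ (fun _ h => h)).
have pF0 : 0 <= square_prob p N by apply: (E_ge0 p01) => w; exact: indic_ge0.
have PF j : (P (F j) <= (p * (4 * (1 - p) ^+ N * (1 - p) ^+ j * square_prob p N))%:E)%E.
  rewrite (occ_law law (uj j) (os _) (lbj j)) E_skip_origin; last exact: rest_o (lbj j).
  rewrite lee_fin ler_wpM2l ?(ltW p0)//.
  apply: (@le_trans _ _ (E p (sj j) (fun w => \sum_(B <- sides N j)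
     indic R (reachF w N N) * (~~ hit B w)%:R) (fun=> false))).
    apply: (E_le p01) => w; rewrite -mulr_sumr /bj -mulnb natrM ler_wpM2l//.
    elim: (sides N j) => [|B r IH]; rewrite ?big_nil// big_cons /=.
    by case: (hit B w) => /=; rewrite ?add0r// lerDl sumr_ge0.
  rewrite E_sum.
  apply: (@le_trans _ _ (\sum_(B <- sides N j) (1 - p) ^+ N * (1 - p) ^+ j * square_prob p N)).
    rewrite big_seq [leRHS]big_seq; apply: ler_sum => B Bin.
    have rB : indep_of B (fun w => indic R (reachF w N N)).
      by apply: indep_reachF => z; exact: sides_disjoint Bin.
    rewrite (E_factor_miss _ _ (uniq_side Bin) (subB j B Bin) rB).
    rewrite (E_reachF p _ (@subN j)) (size_side Bin) mulrC ler_wpM2r// -exprD.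
    by apply: ler_wiXn2l => //; rewrite leq_add2l -addnn leq_addr.
  by rewrite /sides !big_cons big_nil le_eqVlt; apply/orP; left; apply/eqP; ring.
have sumF n : (\sum_(0 <= j < n) P (F j) <= (p * square_prob p N / 2)%:E)%E.
  apply: (@le_trans _ _ (\sum_(0 <= j < n)
     (p * (4 * (1 - p) ^+ N * (1 - p) ^+ j * square_prob p N))%:E)%E).
    by apply: lee_sum => j _; exact: PF.
  rewrite sumEFin lee_fin.
  have geo : p * \sum_(0 <= j < n) (1 - p) ^+ j = 1 - (1 - p) ^+ n.
    elim: n => [|n IH]; first by rewrite big_geq// mulr0 expr0 subrr.
    by rewrite big_nat_recr//= mulrDr IH exprS; ring.
  have -> : \sum_(0 <= j < n) p * (4 * (1 - p) ^+ N * (1 - p) ^+ j * square_prob p N) =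
     (4 * (1 - p) ^+ N * square_prob p N) * (p * \sum_(0 <= j < n) (1 - p) ^+ j).
    by rewrite !mulr_sumr; apply: eq_bigr => j _; ring.
  have qn0 : 0 <= (1 - p) ^+ n by exact: exprn_ge0.
  have qN0 : 0 <= (1 - p) ^+ N by exact: exprn_ge0.
  rewrite geo; apply: (@le_trans _ _ (4 * (1 - p) ^+ N * square_prob p N)).
    rewrite ler_piMr ?gerBl// !mulr_ge0//.
  have := ler_wpM2r pF0 qN; lra.
have mG : measurable (growth_event step_frobose X).
  by apply: (measurable_growth law); exact: step_frobose_depends.
have sub : A `<=` growth_event step_frobose X `|` \bigcup_j F j.
  move=> w [aw bw]; have [[j hj]|no] := pselect (exists j, has (fun B => ~~ hit B (occ_at X w)) (sides N j)).
    by right; exists j => //; split => //=; rewrite /bj hj andbT.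
  left; apply: (sides_growth N0).
  - by rewrite aw.
  - by move: bw => /asboolP.
  - move=> j B Bin; apply: contrapT => nh; apply: no; exists j.
    by apply/hasP; exists B => //; apply/negP.
have := union_bound mA mG mF sub sumF.
rewrite PA -leeBlDr// -EFinB; apply: le_trans.
by rewrite lee_fin; lra.
Qed.

Definition lower_const : R := ln (1 + expR (- 16) / 64).

Lemma lower_const_gt0 : 0 < lower_const.
Proof. by rewrite ln_gt0// ltrDl divr_gt0 ?expR_gt0. Qed.

(** Since [8 * m >= 2 / sqrt p], the detours gain twice the exponent claimed. The surplus absorbs
    [p], the factor [1/2] and [expR (- 2)], through [expR y >= y ^ 3 / 6]; this is the origin of the
    cubic smallness condition. *)
Lemma lower_exponent (p : R) : 0 < p -> 512 * p <= 1 ->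
  12 * expR 2 * Num.sqrt p <= lower_const ^+ 3 ->
  forall (d : measure_display) (T : measurableType d)
    (P : probability T R) (X : site -> T -> state), has_law_Pp P p X ->
  ((expR ((- (2 * lambda2) + lower_const * Num.sqrt p) / p))%:E <=
     P (growth_event step_frobose X))%E.
Proof.
move=> p0 p512 psmall d T P X law.
have p1 : p < 1 by lra.
pose r := Num.sqrt p.
have r0 : 0 < r by rewrite sqrtr_gt0.
have rr : r * r = p by rewrite -expr2 sqr_sqrtr// ltW.
have r4 : 12 * r <= 1.
  by rewrite leNgt; apply/negP => h; nra.
have ir0 : 0 <= (2 * r)^-1 by rewrite invr_ge0 mulr_ge0// ltW.
pose m := Num.truncn (2 * r)^-1.
have /andP[h1 h2] := truncn_itv ir0; rewrite -/m in h1 h2.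
have rp : 0 < 2 * r by rewrite mulr_gt0.
have mr : m%:R * (2 * r) <= 1 by rewrite -ler_pdivlMr// mul1r.
have mr' : 1 < (m%:R + 1) * (2 * r) by rewrite -ltr_pdivrMr// mul1r natr1.
have m2 : (2 <= m)%N.
  rewrite leqNgt; apply/negP => lt; have : m%:R <= 1 :> R by rewrite -[leRHS]/(1%:R) ler_nat.
  by nra.
have mR : 2 <= m%:R :> R by rewrite ler_nat.
have mm : (m ^ 2)%:R * p = (m%:R * r) * (m%:R * r) by rewrite natrX expr2 -rr; ring.
have x0 : 0 <= m%:R * r by rewrite mulr_ge0// ltW.
have x1 : m%:R * r <= 2^-1 by lra.
have x2 : 4^-1 <= m%:R * r by nra.
have mp : 4 * (m ^ 2)%:R * p <= 1.
  by rewrite -mulrA mm; move: x0 x1; move: (m%:R * r) => x; nra.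
have pm : 1 <= 16 * (m ^ 2)%:R * p.
  by rewrite -mulrA mm; move: x0 x2; move: (m%:R * r) => x; nra.
have phalf : p <= 2^-1 by lra.
(* [K] makes the sides long enough for [growth_frobose_ge]. It costs nothing, as the bound of
   [square_prob_ge] does not depend on the side. *)
pose K := (Num.truncn (8 / p ^+ 2)).+1.
have hK : 8 <= K%:R * p * p.
  have y0 : 0 <= 8 / p ^+ 2 by rewrite divr_ge0 ?exprn_ge0// ltW.
  have /andP[_ h] := truncn_itv y0; rewrite ltr_pdivrMr ?exprn_gt0// in h.
  by rewrite -mulrA -expr2 ltW.
pose N := (32 * m ^ 2 + K)%N.
have N0 : (0 < N)%N by rewrite addn_gt0 orbT.
have qN : (1 - p) ^+ N <= p / 8.
  apply: le_trans (expr_1B_le p0 p1 N) _.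
  have Np : 0 <= N%:R * p by rewrite mulr_ge0// ltW.
  have KN : K%:R * p * p <= N%:R * p * p.
    by rewrite !ler_wpM2r ?(ltW p0)// ler_nat leq_addl.
  rewrite -[leLHS]mul1r ler_pdivrMr; last by lra.
  by rewrite mulrDr mulr1; lra.
apply: le_trans (growth_frobose_ge p0 p1 N0 qN law).
rewrite lee_fin.
have pFN := square_prob_ge p0 phalf m2 mp pm (leq_addr K (32 * m ^ 2) : (32 * m ^ 2 <= N)%N).
have l0 := lower_const_gt0.
have e1 : (1 + expR (- 16) / 64) ^+ (8 * m) = expR (lower_const * (8 * m)%:R).
  by rewrite expRM_natr lnK// posrE addr_gt0// divr_gt0 ?expR_gt0.
have ir : 0 < r^-1 by rewrite invr_gt0.
have m8 : 2 * r^-1 <= (8 * m)%:R.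
  by rewrite natrM ler_pdivrMr// -mulrA; lra.
have rp2 : r / p = r^-1.
  by rewrite -rr invfM mulrA divff ?mul1r// gt_eqF.
have -> : (- (2 * lambda2) + lower_const * Num.sqrt p) / p =
    - (2 * (lambda2 / p)) + lower_const * r^-1.
  by rewrite -/r mulrDl -(mulrA lower_const) rp2; ring.
have big : 2 * expR 2 <= p * expR (lower_const * r^-1).
  have y0 : 0 <= lower_const * r^-1 by rewrite mulr_ge0// ltW.
  have h := expR_ge1Dxn 2 y0.
  have f6 : (3`!)%:R = 6 :> R by [].
  rewrite f6 in h.
  have h3 : 2 * expR 2 * r^-1 ^+ 2 <= (lower_const * r^-1) ^+ 3 / 6.
    rewrite exprMn [r^-1 ^+ 3]exprS.
    have z0 : 0 <= r^-1 ^+ 2 by rewrite exprn_ge0// ltW.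
    have : 12 * expR 2 <= lower_const ^+ 3 * r^-1 by rewrite ler_pdivlMr.
    move=> /(ler_wpM2r z0); lra.
  have ep : p * r^-1 ^+ 2 = 1 by rewrite -rr expr2; field; rewrite gt_eqF.
  have := ler_wpM2l (ltW p0) (le_trans h3 (le_trans (ler_wpDl ler01 (lexx _)) h)).
  by rewrite mulrCA ep mulr1.
apply: (@le_trans _ _ (p * (expR (2 * (- (lambda2 / p) - 1)) *
   (expR (lower_const * r^-1) * expR (lower_const * r^-1))) / 2)).
  have -> : 2 * (- (lambda2 / p) - 1) = - (2 * (lambda2 / p)) - 2 by ring.
  rewrite expRD expRB.
  have E1 := expR_gt0 (- (2 * (lambda2 / p)) : R).
  have E2 := expR_gt0 (lower_const * r^-1).
  have E3 := expR_gt0 (2 : R).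
  move: E1 E2 E3 big; set a := expR (- _); set b := expR (_ * _); set c := expR 2.
  move=> a0 b0 c00 big.
  rewrite [leRHS](_ : _ = a * b * ((p * b) / (2 * c))); last first.
    by field; rewrite gt_eqF.
  rewrite ler_peMr ?mulr_ge0 ?(ltW a0) ?(ltW b0)// ler_pdivlMr ?mulr_gt0// mul1r.
  exact: big.
rewrite ler_pM2r// ler_pM2l//; apply: le_trans pFN.
rewrite ler_wpM2l ?expR_ge0// e1 -expRD ler_expR.
have := ler_wpM2l (ltW l0) m8; lra.
Qed.

End LowerBound.

(** * Assembly of the bounds for both models *)

Theorem theorem3 (R : realType) :
  (* (a) modified local model *)
  (exists c C p0 : R, 0 < c /\ 0 < C /\ 0 < p0 /\
    forall p : R, 0 < p -> p < p0 ->
    forall (d : measure_display) (T : measurableType d)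
           (P : probability T R) (X : site -> T -> state),
      has_law_Pp P p X ->
      ((expR ((- (2 * lambda2) + c * Num.sqrt p) / p))%:E
         <= P (growth_event step_modified X))%E /\
      (P (growth_event step_modified X)
         <= (expR ((- (2 * lambda2)
                    + C * Num.sqrt p * (ln p^-1) ^+ 3) / p))%:E)%E) /\
  (* (b) Frobose local model *)
  (exists c C p0 : R, 0 < c /\ 0 < C /\ 0 < p0 /\
    forall p : R, 0 < p -> p < p0 ->
    forall (d : measure_display) (T : measurableType d)
           (P : probability T R) (X : site -> T -> state),
      has_law_Pp P p X ->
      ((expR ((- (2 * lambda2) + c * Num.sqrt p) / p))%:E
         <= P (growth_event step_frobose X))%E /\
      (P (growth_event step_frobose X)
         <= (expR ((- (2 * lambda2)
                    + C * Num.sqrt p * (ln p^-1) ^+ 3) / p))%:E)%E) /\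
  (* moreover: improved upper bound for the Frobose local model *)
  (exists C p0 : R, 0 < C /\ 0 < p0 /\
    forall p : R, 0 < p -> p < p0 ->
    forall (d : measure_display) (T : measurableType d)
           (P : probability T R) (X : site -> T -> state),
      has_law_Pp P p X ->
      (P (growth_event step_frobose X)
         <= (expR ((- (2 * lambda2)
                    + C * Num.sqrt p * (ln p^-1) ^+ 2) / p))%:E)%E).
Proof.
have [p0 [p00 Hp0]] : exists p0 : R, 0 < p0 /\ forall p : R, 0 < p -> p < p0 ->
    [/\ 512 * expR 4 * p <= 1, 512 * p <= 1 &
      12 * expR 2 * Num.sqrt p <= lower_const ^+ 3].
  have l0 := @lower_const_gt0 R.
  pose delta : R := lower_const ^+ 3 / (12 * expR 2).
  have e2 : 0 < 12 * expR 2 :> R.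
    by apply: mulr_gt0; [rewrite ltr0n|exact: expR_gt0].
  have e4 : 0 < 512 * expR 4 :> R.
    by apply: mulr_gt0; [rewrite ltr0n|exact: expR_gt0].
  have d0 : 0 < delta by rewrite divr_gt0 ?exprn_gt0.
  (* The first entry serves the upper bound, the second the surplus in [lower_exponent]. *)
  exists (Num.min (512 * expR 4)^-1 (delta ^+ 2)); split.
    by rewrite lt_min invr_gt0 e4 exprn_gt0.
  move=> p p0; rewrite lt_min => /andP[h1 h2].
  have h3 : 512 * expR 4 * p <= 1.
    by rewrite mulrC -ler_pdivlMr// mul1r ltW.
  have h4 : 1 <= expR 4 :> R by rewrite -expR0 ler_expR.
  have h5 : 512 * p <= 1.
    by apply: le_trans h3; apply: (ler_wpM2r (ltW p0)); lra.
  split; [exact: h3|exact: h5|].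
  rewrite mulrC -ler_pdivlMr// -/delta -(ger0_norm (ltW d0)) -sqrtr_sqr.
  by apply: ler_wsqrtr; exact: ltW.
have upper2 : forall p : R, 0 < p -> p < p0 ->
    forall (d : measure_display) (T : measurableType d)
           (P : probability T R) (X : site -> T -> state),
      has_law_Pp P p X ->
      (P (growth_event step_modified X)
         <= (expR ((- (2 * lambda2)
                    + 1200 * Num.sqrt p * (ln p^-1) ^+ 2) / p))%:E)%E.
  by move=> p pp lt d T P X law; have [h _ _] := Hp0 p pp lt; exact: upper_exponent.
(* The modified model already has the squared logarithm; the cube is weaker because
   [ln p^-1 >= 4]. *)
have upper3 : forall p : R, 0 < p -> p < p0 ->
    forall (d : measure_display) (T : measurableType d)
           (P : probability T R) (X : site -> T -> state),
      has_law_Pp P p X ->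
      (P (growth_event step_modified X)
         <= (expR ((- (2 * lambda2)
                    + 1200 * Num.sqrt p * (ln p^-1) ^+ 3) / p))%:E)%E.
  move=> p pp lt d T P X law; apply: le_trans (upper2 p pp lt d T P X law) _.
  have [h _ _] := Hp0 p pp lt; have l4 := ell_ge4 pp h.
  rewrite lee_fin ler_expR ler_wpM2r ?invr_ge0 ?(ltW pp)// lerD2l.
  apply: ler_wpM2l; first by apply: mulr_ge0; [exact: ler0n|exact: sqrtr_ge0].
  by apply: ler_weXn2l => //; lra.
have lower : forall p : R, 0 < p -> p < p0 ->
    forall (d : measure_display) (T : measurableType d)
           (P : probability T R) (X : site -> T -> state),
      has_law_Pp P p X ->
      ((expR ((- (2 * lambda2) + lower_const * Num.sqrt p) / p))%:E
         <= P (growth_event step_frobose X))%E.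
  by move=> p pp lt d T P X law; have [_ h1 h2] := Hp0 p pp lt; exact: lower_exponent.
have mono : forall p (d : measure_display) (T : measurableType d)
           (P : probability T R) (X : site -> T -> state),
      has_law_Pp P p X ->
      (P (growth_event step_frobose X) <= P (growth_event step_modified X))%E.
  move=> p d T P X law; apply: le_measure; rewrite ?inE; last exact: growth_frobose_modified.
    by apply: (measurable_growth law); exact: step_frobose_depends.
  by apply: (measurable_growth law); exact: step_modified_depends.
have l0 := @lower_const_gt0 R.
split; [|split].
- exists lower_const, 1200, p0; split; [exact: l0|split; [by rewrite ltr0n|split; [exact: p00|]]].
  move=> p pp lt d T P X law; split; last exact: upper3.
  exact: le_trans (lower p pp lt d T P X law) (mono p d T P X law).
- exists lower_const, 1200, p0; split; [exact: l0|split; [by rewrite ltr0n|split; [exact: p00|]]].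
  move=> p pp lt d T P X law; split; first exact: lower.
  exact: le_trans (mono p d T P X law) (upper3 p pp lt d T P X law).
- exists 1200, p0; split; [by rewrite ltr0n|split; [exact: p00|]].
  move=> p pp lt d T P X law.
  exact: le_trans (mono p d T P X law) (upper2 p pp lt d T P X law).
Qed.
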